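(* There is $\varepsilon_0>0$ and for every $A>0$ there is $C>0$ depending only on $A$ such that the following holds. Let $g,s_1$ and $s_2$ be independent random variables taking values in $\mathrm{PSL}_2(\mathbb{R})$ such that $s_1$ and $s_2$ are absolutely continuous and have finite entropy, and such that $gs_1$ and $gs_2$ have finite entropy. Define $$k:=H(gs_1)-H(s_1)-H(gs_2)+H(s_2),\qquad c:=\tfrac32\log\left(\tfrac23\pi e\,\mathrm{Tr}\,\mathrm{Var}_{\mathrm{Id}}[s_1]\right)-H(s_1).$$ Suppose that $k>0$. Suppose further that $s_1$ and $s_2$ are supported on the ball of radius $\varepsilon$ centred at the identity for some $\varepsilon\in(0,\varepsilon_0)$, and that $\mathrm{Tr}\,\mathrm{Var}_{\mathrm{Id}}[s_1]\ge A\varepsilon^2$. Then $$\mathbb{E}\left[\mathrm{Tr}\,\mathrm{Var}_{gs_2}[g\,|\,gs_2]\right]\ge\tfrac23(k-c-C\varepsilon)\,\mathrm{Tr}\,\mathrm{Var}_{\mathrm{Id}}[s_1].$$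
   Context: Fix a left-invariant Riemannian metric on $\mathrm{PSL}_2(\mathbb{R})$ (balls are with respect to its distance). Identify the Lie algebra $\mathfrak{psl}_2(\mathbb{R})$ with $\mathbb{R}^3$ via a fixed basis, with a fixed Euclidean structure; let $\log$ be the inverse of $\exp$ on a fixed open neighbourhood of the identity. Entropy: let $m$ be Lebesgue measure on $\mathfrak{psl}_2(\mathbb{R})\cong\mathbb{R}^3$, and let $\tilde m$ be the Haar measure on $\mathrm{PSL}_2(\mathbb{R})$ normalized so that $\frac{d\tilde m}{d(m\circ\log)}(\mathrm{Id})=1$. For an absolutely continuous probability measure $\lambda$, $H(\lambda)=-\int\log\frac{d\lambda}{d\tilde m}\,d\lambda$; the entropy of a random variable is that of its law. Finite entropy means that, for the density $f$ with respect to $\tilde m$, $\int f|\log f|\,d\tilde m<\infty$. Variance: for fixed $g_0\in\mathrm{PSL}_2(\mathbb{R})$ and a random variable $g$ such that $g_0^{-1}g$ is always in the domain of $\log$, $\mathrm{Var}_{g_0}[g]$ is the covariance matrix of $\log(g_0^{-1}g)$, and $\mathrm{Tr}\,\mathrm{Var}_{g_0}[g]$ is its trace. For a random variable $h$ and a $\sigma(h)$-measurable random variable $g_0$, $\mathrm{Tr}\,\mathrm{Var}_{g_0}[g\,|\,h]$ is the $\sigma(h)$-measurable random variable $\omega\mapsto\mathrm{Tr}\,\mathrm{Var}_{g_0(\omega)}$ of the regular conditional distribution of $g$ given $h$ at $\omega$. *)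

(* Defs.v *)
From HB Require Import structures.
From mathcomp Require Import all_boot all_order all_algebra.
From mathcomp Require Import all_classical all_reals all_analysis.

Set Implicit Arguments.
Unset Strict Implicit.
Unset Printing Implicit Defensive.

Import Order.TTheory GRing.Theory Num.Theory.
Import numFieldNormedType.Exports.

Local Open Scope classical_set_scope.
Local Open Scope ring_scope.
Local Open Scope quotient_scope.

Section SL2.
Variable R : realType.

Record SL2 := MkSL2 { SL2val :> 'M[R]_2; _ : \det SL2val == 1 }.

HB.instance Definition _ := [isSub for SL2val].
HB.instance Definition _ := [Choice of SL2 by <:].
HB.instance Definition _ := Topological.copy SL2 (initial_topology SL2val).

Lemma det_SL2 (A : SL2) : \det A = 1. Proof. by case: A => A /= /eqP. Qed.

Lemma SL2_unit (A : SL2) : SL2val A \in unitmx.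
Proof. by rewrite unitmxE det_SL2 unitr1. Qed.

Fact SL2_one_subproof : \det (1%:M : 'M[R]_2) == 1.
Proof. by rewrite det1. Qed.
Definition SL2_one := MkSL2 SL2_one_subproof.

Fact SL2_mul_subproof (A B : SL2) : \det (A *m B) == 1.
Proof. by rewrite det_mulmx !det_SL2 mulr1. Qed.
Definition SL2_mul A B := MkSL2 (SL2_mul_subproof A B).

Fact SL2_inv_subproof (A : SL2) : \det (invmx A) == 1.
Proof. by rewrite det_inv det_SL2 invr1. Qed.
Definition SL2_inv A := MkSL2 (SL2_inv_subproof A).

Fact SL2_opp_subproof (A : SL2) : \det (- SL2val A) == 1.
Proof. by rewrite -scaleN1r detZ det_SL2 mulr1 -signr_odd. Qed.
Definition SL2_opp A := MkSL2 (SL2_opp_subproof A).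

Fact SL2_mulA : associative SL2_mul.
Proof. by move=> A B C; apply: val_inj; rewrite /= mulmxA. Qed.
Fact SL2_mul1 : left_id SL2_one SL2_mul.
Proof. by move=> A; apply: val_inj; rewrite /= mul1mx. Qed.
Fact SL2_1mul : right_id SL2_one SL2_mul.
Proof. by move=> A; apply: val_inj; rewrite /= mulmx1. Qed.
Fact SL2_mulV : left_inverse SL2_one SL2_inv SL2_mul.
Proof. by move=> A; apply: val_inj; rewrite /= mulVmx ?SL2_unit. Qed.
Fact SL2_Vmul : right_inverse SL2_one SL2_inv SL2_mul.
Proof. by move=> A; apply: val_inj; rewrite /= mulmxV ?SL2_unit. Qed.

HB.instance Definition _ := isGroup.Build SL2
  SL2_mulA SL2_mul1 SL2_1mul SL2_mulV SL2_Vmul.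

End SL2.

Section PSL2.
Variable R : realType.
Local Notation SL2 := (SL2 R).

Definition pm_eq (A B : SL2) := (A == B) || (A == SL2_opp B).

Fact SL2_oppK : involutive (@SL2_opp R).
Proof. by move=> A; apply: val_inj; rewrite /= opprK. Qed.

Fact pm_eq_refl : reflexive pm_eq.
Proof. by move=> A; rewrite /pm_eq eqxx. Qed.
Fact pm_eq_sym : symmetric pm_eq.
Proof.
by move=> A B; rewrite /pm_eq (eq_sym A B) (eq_sym A)
  (can2_eq SL2_oppK SL2_oppK).
Qed.
Fact pm_eq_trans : transitive pm_eq.
Proof.
move=> B A C /orP[/eqP->//|/eqP->] /orP[/eqP->|/eqP->].
  by rewrite /pm_eq eqxx orbT.
by rewrite SL2_oppK /pm_eq eqxx.
Qed.
Canonical pm_eq_equiv := EquivRel pm_eq pm_eq_refl pm_eq_sym pm_eq_trans.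

Definition PSL2 := quotient_topology {eq_quot pm_eq}.
HB.instance Definition _ := Topological.on PSL2.
HB.instance Definition _ := Quotient.on PSL2.

Definition to_PSL2 (A : SL2) : PSL2 := \pi_PSL2 A.

Lemma to_PSL2P (A B : SL2) : reflect (to_PSL2 A = to_PSL2 B) (pm_eq A B).
Proof. exact: eqmodP. Qed.

Lemma to_PSL2_repr (x : PSL2) : to_PSL2 (repr x) = x.
Proof. exact: reprK. Qed.

Lemma pm_eq_repr (A : SL2) : pm_eq (repr (to_PSL2 A)) A.
Proof. by apply/to_PSL2P; rewrite to_PSL2_repr. Qed.

Definition PSL2_one := to_PSL2 1%g.
Definition PSL2_mul (x y : PSL2) := to_PSL2 (repr x * repr y)%g.
Definition PSL2_inv (x : PSL2) := to_PSL2 (repr x)^-1%g.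

Lemma to_PSL2M (A B : SL2) :
  to_PSL2 (A * B)%g = PSL2_mul (to_PSL2 A) (to_PSL2 B).
Proof.
apply/esym/to_PSL2P.
have /orP[/eqP->|/eqP->] := pm_eq_repr A;
have /orP[/eqP->|/eqP->] := pm_eq_repr B; rewrite /pm_eq -!val_eqE /=.
- by rewrite eqxx.
- by rewrite mulmxN eqxx orbT.
- by rewrite mulNmx eqxx orbT.
- by rewrite mulNmx mulmxN opprK eqxx.
Qed.

Lemma to_PSL2V (A : SL2) : to_PSL2 (A^-1)%g = PSL2_inv (to_PSL2 A).
Proof.
apply/esym/to_PSL2P.
have /orP[/eqP->|/eqP->] := pm_eq_repr A; rewrite /pm_eq -!val_eqE /=.
  by rewrite eqxx.
by rewrite -scaleN1r invmxZ ?invrN1 ?scaleN1r ?eqxx ?orbT // (SL2_unit (SL2_opp A)).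
Qed.

Fact PSL2_mulA : associative PSL2_mul.
Proof.
move=> x y z; rewrite -(to_PSL2_repr x) -(to_PSL2_repr y) -(to_PSL2_repr z).
by rewrite -!to_PSL2M mulgA.
Qed.
Fact PSL2_1mul : left_id PSL2_one PSL2_mul.
Proof. by move=> x; rewrite -(to_PSL2_repr x) -to_PSL2M mul1g. Qed.
Fact PSL2_mul1 : right_id PSL2_one PSL2_mul.
Proof. by move=> x; rewrite -(to_PSL2_repr x) -to_PSL2M mulg1. Qed.
Fact PSL2_mulV : left_inverse PSL2_one PSL2_inv PSL2_mul.
Proof. by move=> x; rewrite -(to_PSL2_repr x) -to_PSL2V -to_PSL2M mulVg. Qed.
Fact PSL2_Vmul : right_inverse PSL2_one PSL2_inv PSL2_mul.
Proof. by move=> x; rewrite -(to_PSL2_repr x) -to_PSL2V -to_PSL2M mulgV. Qed.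

HB.instance Definition _ := isGroup.Build PSL2
  PSL2_mulA PSL2_1mul PSL2_mul1 PSL2_mulV PSL2_Vmul.

HB.instance Definition _ := isPointed.Build PSL2 1%g.

HB.instance Definition _ :=
  Measurable.copy PSL2 (g_sigma_algebraType (@open PSL2)).

End PSL2.

Section PSL2_mul_measurable.
Variable R : realType.
Local Notation PSL2 := (PSL2 R).

Let qball (i : 'M[rat]_2 * nat) : set 'M[R]_2 :=
  ball (map_mx ratr i.1 : 'M[R]_2) i.2.+1%:R^-1.

Let qball_base (A : 'M[R]_2) U : nbhs A U ->
  exists2 i, qball i A & qball i `<=` U.
Proof.
move=> /nbhs_ballP[e /= e0 AU].
have [n ne] : exists n : nat, (n.+1%:R^-1 : R) < e / 2.
  exists (Num.truncn (e / 2)^-1); rewrite invf_plt ?posrE ?divr_gt0//.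
  exact: truncnS_gt.
have n0 : 0 < (n.+1%:R^-1 : R) by rewrite invr_gt0.
have qE k l : {q : rat | `|A k l - ratr q| < n.+1%:R^-1}.
  apply: cid; have [|q] := @rat_in_itvoo R (A k l - n.+1%:R^-1) (A k l + n.+1%:R^-1).
    by rewrite ltrD2l gtrN.
  by rewrite in_itv/= => /andP[? ?]; exists q; rewrite distrC ltr_distl; apply/andP.
exists (\matrix_(k, l) sval (qE k l), n).
  split => // k l; rewrite !mxE /ball/= distrC; exact: (svalP (qE k l)).
move=> B [_ qB]; apply: AU; split => // k l.
rewrite /ball/= [e]splitr.
apply: (le_lt_trans (ler_distD (ratr (sval (qE k l))) _ _)).
apply: ltrD; first exact: (lt_trans (svalP (qE k l))).
by apply: lt_trans ne; have := qB k l; rewrite /ball/= !mxE.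
Qed.

Let qopen (i : 'M[rat]_2 * nat) : set PSL2 :=
  [set to_PSL2 A | A in [set A : SL2 R | qball i A]].

Let qopen_measurable i : measurable (qopen i).
Proof.
apply: sub_sigma_algebra; rewrite /open/= /quotient_open/=.
exists (qball i `|` (fun A => - A) @^-1` qball i).
  apply: openU; first exact: ball_open.
  by move/continuousP : (@opp_continuous 'M[R]_2); apply; exact: ball_open.
apply/seteqP; split=> [A [iA|iA]|A [B iB /to_PSL2P/orP[/eqP BA|/eqP BA]]] /=.
- by exists A.
- exists (SL2_opp A) => //; apply/to_PSL2P.
  by rewrite /pm_eq eqxx orbT.
- by left; rewrite -BA.
- by right; move: iB; rewrite BA.
Qed.

Let mulmx_nbhs (A B : 'M[R]_2) U : nbhs (A *m B) U ->
  exists V W, [/\ nbhs A V, nbhs B W & forall X Y, V X -> W Y -> U (X *m Y)].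
Proof.
move=> [P ABP PU].
have : \forall XY \near (A, B), forall kl : 'I_2 * 'I_2,
    P kl.1 kl.2 ((XY.1 *m XY.2) kl.1 kl.2).
  apply: (@filter_forall _ _
    (fun kl XY => P kl.1 kl.2 ((XY.1 *m XY.2) kl.1 kl.2)) (nbhs (A, B))).
  move=> [k l] /=.
  have : (fun XY : 'M[R]_2 * 'M[R]_2 => (XY.1 *m XY.2) k l) @ (A, B) -->
      (A *m B) k l.
    have E (X Y : 'M[R]_2) : (X *m Y) k l = X k ord0 * Y ord0 l +
        X k (lift ord0 ord0) * Y (lift ord0 ord0) l.
      by rewrite mxE !big_ord_recl big_ord0 addr0.
    rewrite E (eq_cvg _ _ (fun XY => E XY.1 XY.2)).
    have c1 i j : (fun XY : 'M[R]_2 * 'M[R]_2 => XY.1 i j) @ (A, B) --> A i j.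
      apply: (@cvg_comp _ _ _ fst (fun M : 'M[R]_2 => M i j)).
        exact: cvg_fst.
      exact: coord_continuous.
    have c2 i j : (fun XY : 'M[R]_2 * 'M[R]_2 => XY.2 i j) @ (A, B) --> B i j.
      apply: (@cvg_comp _ _ _ snd (fun M : 'M[R]_2 => M i j)).
        exact: cvg_snd.
      exact: coord_continuous.
    by apply: cvgD; apply: cvgM.
  by move=> /(_ _ (ABP k l)).
move=> [[V W] /= [AV BW] VW]; exists V, W; split => // X Y VX WY.
by apply: PU => k l; exact: (VW (X, Y) (conj VX WY) (k, l)).
Qed.

Let qopen_mul (U : set PSL2) (x y : PSL2) : open U -> U (x * y)%g ->
  exists ij, [/\ qopen ij.1 x, qopen ij.2 y &
    forall x' y', qopen ij.1 x' -> qopen ij.2 y' -> U (x' * y')%g].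
Proof.
move=> [D oD DU].
rewrite -{1}(to_PSL2_repr x) -{1}(to_PSL2_repr y) -[X in U X]to_PSL2M => Uxy.
have : D (repr x *m repr y).
  by move: Uxy; rewrite -[U _]/((\pi_PSL2 @^-1` U) (repr x * repr y)%g) -DU.
move=> Dxy; have /mulmx_nbhs[V [W [xV yW VWD]]] := open_nbhs_nbhs (conj oD Dxy).
have [i ix iV] := qball_base xV; have [j jy jW] := qball_base yW.
exists (i, j); split => /=.
- by exists (repr x) => //; exact: to_PSL2_repr.
- by exists (repr y) => //; exact: to_PSL2_repr.
- move=> _ _ [A /iV VA <-] [B /jW WB <-].
  rewrite -[X in U X]to_PSL2M -[U _]/((\pi_PSL2 @^-1` U) (A * B)%g) -DU.
  exact: VWD.
Qed.

Context d (T : measurableType d).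

Definition mfun_mul (f g : T -> PSL2) : T -> PSL2 := fun w => (f w * g w)%g.

Lemma measurable_mfun_mul (f g : T -> PSL2) :
  measurable_fun setT f -> measurable_fun setT g ->
  measurable_fun setT (mfun_mul f g).
Proof.
move=> mf mg; apply: (measurability (@open PSL2)) => // _ [U oU <-].
rewrite setTI.
pose I := [set ij | forall x y, qopen ij.1 x -> qopen ij.2 y -> U (x * y)%g].
pose F ij := if pselect (I ij) then
  f @^-1` qopen ij.1 `&` g @^-1` qopen ij.2 else set0.
have -> : mfun_mul f g @^-1` U = \bigcup_ij F ij.
  apply/seteqP; split=> w /=; rewrite /mfun_mul.
    move=> /(qopen_mul oU)[ij [fw gw ijU]]; exists ij => //.
    by rewrite /F; case: pselect.
  by move=> [ij _]; rewrite /F; case: pselect => // ijU [fw gw]; exact: ijU.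
apply: countable_bigcupT_measurable => [|ij]; first exact: countableP.
rewrite /F; case: (pselect (I ij)) => [?|?]; last exact: measurable0.
apply: measurableI.
  by rewrite -[X in measurable X]setTI; apply: mf.
by rewrite -[X in measurable X]setTI; apply: mg.
Qed.

HB.instance Definition _ (f g : {mfun T >-> PSL2}) :=
  isMeasurableFun.Build _ _ _ _ (mfun_mul f g)
    (measurable_mfun_mul (measurable_funPT f) (measurable_funPT g)).

End PSL2_mul_measurable.

Section LieAlgebra.
Variable R : realType.

Definition sl2 : {vspace 'M[R]_2} := lker (linfun (mxtrace : 'M[R]_2 -> R^o)).

Record is_inner_product (ip : 'M[R]_2 -> 'M[R]_2 -> R) : Prop := {
  ip_sym : {in sl2 &, forall X Y, ip X Y = ip Y X};
  ip_linear : forall a, {in sl2 & &, forall X Y Z,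
    ip (a *: X + Y) Z = a * ip X Z + ip Y Z};
  ip_gt0 : {in sl2, forall X, X != 0 -> 0 < ip X X} }.

(* The left-invariant Riemannian metric on PSL2(R) with inner product ip on the
   tangent space at the identity: gamma^-1 gamma' is the velocity of gamma,
   translated back to the identity. Curves in PSL2(R) are described by their
   lifts to the double cover SL2(R); C^1 and piecewise C^1 curves yield the same
   infimum. *)
Definition is_C1_curve (gamma : R -> SL2 R) :=
  (forall t, derivable (@SL2val R \o gamma) t 1) /\
  continuous (derive1 (@SL2val R \o gamma)).

Definition curve_speed (ip : 'M[R]_2 -> 'M[R]_2 -> R) (gamma : R -> SL2 R) t :=
  let X := invmx (gamma t) *m derive1 (@SL2val R \o gamma) t in Num.sqrt (ip X X).

Definition curve_length ip gamma : R :=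
  (\int[lebesgue_measure]_(t in `[0, 1]) curve_speed ip gamma t)%R.

Definition PSL2_dist ip (x y : PSL2 R) : R :=
  inf [set curve_length ip gamma | gamma in [set gamma |
    [/\ is_C1_curve gamma, to_PSL2 (gamma 0) = x & to_PSL2 (gamma 1) = y]]].

Definition PSL2_ball ip (x : PSL2 R) (r : R) : set (PSL2 R) :=
  [set y | PSL2_dist ip x y < r].

Definition expmx (X : 'M[R]_2) : 'M[R]_2 :=
  limn (series (fun n => n`!%:R^-1 *: X ^+ n)).

Local Notation R3 := (R * R * R)%type.

Definition R3_lebesgue :=
  ((@lebesgue_measure R \x @lebesgue_measure R) \x @lebesgue_measure R)%E.

Definition R3_coord (i : 'I_3) (v : R3) : R := [:: v.1.1; v.1.2; v.2]`_i.

Section Log.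
Variables (b : 3.-tuple 'M[R]_2) (V : set R3).

Definition sl2_of (v : R3) : 'M[R]_2 := \sum_(i < 3) R3_coord i v *: b`_i.

(* The default value of insubd is never used when b consists of traceless
   matrices, since then \det (expmx X) = expR (\tr X) = 1. *)
Definition PSL2_exp (v : R3) : PSL2 R :=
  to_PSL2 (insubd (SL2_one R) (expmx (sl2_of v))).

Definition is_log_domain :=
  [/\ open V, V 0, {in V &, injective PSL2_exp} & open (PSL2_exp @` V)].

(* log : PSL2_exp @` V -> V, extended by 0. *)
Definition PSL2_log (x : PSL2 R) : R3 :=
  xget 0 [set v | V v /\ PSL2_exp v = x].

(* The covariance matrix of log (g0^-1 X), meaningful when g0^-1 X is almost
   surely in the domain of log. Taking X := id gives Var_{g0} of the law P. *)
Definition PSL2_Var d (T : measurableType d) (P : probability T R)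
    (g0 : PSL2 R) (X : T -> PSL2 R) : 'M[R]_3 :=
  \matrix_(i, j) fine (covariance P
    (fun w => R3_coord i (PSL2_log (g0^-1 * X w)%g))
    (fun w => R3_coord j (PSL2_log (g0^-1 * X w)%g))).

(* mu has the density rho with respect to m \o log on the domain of log, where
   (m \o log) A = m (V `&` PSL2_exp @^-1` A). The value at the identity of the
   density is meaningful as rho is continuous. *)
Definition normalized_at_id (mu : set (PSL2 R) -> \bar R) :=
  exists rho : PSL2 R -> R, [/\ {within PSL2_exp @` V, continuous rho},
    (forall x, 0 <= rho x), rho 1%g = 1 &
    forall A, measurable A -> A `<=` PSL2_exp @` V ->
      mu A = (\int[R3_lebesgue]_(v in V `&` PSL2_exp @^-1` A)
                (rho (PSL2_exp v))%:E)%E].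

End Log.

(* On the second countable group PSL2(R), Borel measures which are finite on
   compact sets are regular. *)
Definition is_haar (mu : set (PSL2 R) -> \bar R) :=
  [/\ forall (x : PSL2 R) A, measurable A ->
      mu [set (x * y)%g | y in A] = mu A,
    forall K : set (PSL2 R), compact K -> (mu K < +oo)%E & mu [set: PSL2 R] <> 0%E].

End LieAlgebra.

Section Entropy.
Context d (T : measurableType d) (R : realType).
Variables (mu : {sigma_finite_measure set T -> \bar R}) (la : probability T R).

Definition pdensity (x : T) : R :=
  fine (Radon_Nikodym (charge_of_finite_measure la) mu x).

Definition entropy : R := - (\int[la]_x ln (pdensity x))%R.

Definition finite_entropy :=
  la `<< mu /\
  (\int[mu]_x (pdensity x * `|ln (pdensity x)|)%:E < +oo)%E.

End Entropy.

Section Probability.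
Context d d' (T : measurableType d) (G : measurableType d') (R : realType).
Variable P : probability T R.

Definition independent3 (X Y Z : T -> G) :=
  forall A B C, measurable A -> measurable B -> measurable C ->
  P (X @^-1` A `&` Y @^-1` B `&` Z @^-1` C) =
  (P (X @^-1` A) * P (Y @^-1` B) * P (Z @^-1` C))%E.

(* kappa is a regular conditional distribution of X given Y; its type makes it
   measurable with respect to the sigma-algebra generated by Y. *)
Definition is_rcd d'' (H : measurableType d'') (X : T -> G) (Y : T -> H)
    (kappa : {mfun g_sigma_algebra_preimageType Y >-> pprobability G R}) :=
  forall A, measurable A -> forall B, g_sigma_algebra_preimage Y B ->
  (\int[P]_(w in B) (kappa w : probability G R) A)%E = P (B `&` X @^-1` A).

End Probability.

Arguments is_rcd {d d' T G R} P {d'' H} X Y kappa.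

(* Main.v *)
(* Write X = g s1, Y = g s2, T = Tr Var[s1]. Compare Y^-1 X = s2^-1 s1 with a
   Gaussian on the Lie algebra: let q(y, x) be the density in x, with respect to
   v := log (y^-1 x), of the normal law with covariance (T / 3) Id and mean m(y),
   cut off to a ball of radius O(eps). By left invariance its mass is at most
   1 + O(eps). Integrating ln t <= t - 1 at
   t = f_Y(Y) q(Y, X) / (f_X(X) f_s2(s2)), where the densities of Y, X and s2
   cancel in the expectation of the right-hand side, gives
     H(X) - H(Y) + H(s2) <= O(eps) - E[ln q(Y, X)].
   To first order log (Y^-1 X) = log s1 - log s2. Take
   m(y) = E[log s1] + E[log (y^-1 g) | Y = y]; then log (Y^-1 X) - m(Y) is u - v
   with u = log s1 - E[log s1] and v = log s2 + E[log (Y^-1 g) | Y]. Since u is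
   centred and independent of v, E|u - v|^2 = T + E|v|^2, and E|v|^2 is at most
   E Tr Var_Y[g | Y] because log (Y^-1 g) = - log s2. Expanding ln q, the bound
   reads k - c <= 3 / (2 T) E|v|^2 + O(eps). *)

From HB Require Import structures.
Require Import Defs.
From mathcomp Require Import all_boot all_order all_algebra.
From mathcomp Require Import all_classical all_reals all_analysis.
From mathcomp Require Import measurable_realfun.
From mathcomp Require Import ring lra.

Set Implicit Arguments.
Unset Strict Implicit.
Unset Printing Implicit Defensive.

Import Order.TTheory GRing.Theory Num.Theory.
Import numFieldNormedType.Exports.

Local Open Scope classical_set_scope.
Local Open Scope ring_scope.

(** * The exponential of traceless matrices *)

(** The law of [g] is arbitrary, so nothing can be smoothed or differentiated in it. What can be
    used is that [g] cancels in Y^-1 X and that left translation by it preserves Haar measure. The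
    orders of magnitude fix the shape of the estimate. The first-order formula for log (Y^-1 X) has
    an error O(eps^2), so squared distances to the mean are off by O(eps^3), and T >= A eps^2 turns
    this into O(eps) after division by T. The restrictions on eps itself come from the charts, so
    eps0 can precede A. The mass bound needs a rate, while the Haar density in logarithmic
    coordinates is only known to be continuous. The rate comes from invariance: a tiny cube at v is
    compared with one at 0. Two further obstacles are the balls, defined by infima of curve lengths
    and brought into coordinates by a Gronwall estimate, and smallness that holds only almost
    surely, repaired by clamping coordinates to their range. Finally, m has to be a measurable
    function on the group, which is why the conditional mean is factored through Y. *)

Section parity_exponential.
Variable R : realType.
Implicit Types (b : bool) (d M : R).

Definition par_coeff b d : R^nat :=
  fun n => (odd n == b)%:R * (d ^+ n./2 / n`!%:R).

(* [par_exp false d] is cosh (sqrt d), and [par_exp true d] is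
   sinh (sqrt d) / sqrt d; both are entire functions of d. *)
Definition par_exp b d : R := limn (series (par_coeff b d)).

(** Only [n./2] powers of [d] stand over n!, and M >= 1 allows them to be rounded up to M^n. Both
    series are thus dominated by that of e^M. *)
Lemma par_coeff_le b d M n : 1 <= M -> `|d| <= M ->
  `|par_coeff b d n| <= exp_coeff M n.
Proof.
move=> M1 dM; rewrite /par_coeff /exp_coeff /= normrM.
have M0 : 0 <= M by apply: le_trans M1.
rewrite (le_trans (ler_piMl _ _))//; first by case: eqP; rewrite ?normr1 ?normr0.
rewrite normrM normfV normr_nat ler_wpM2r ?invr_ge0//.
rewrite normrX (le_trans (lerXn2r _ _ _ dM)) ?nnegrE//.
by rewrite ler_weXn2l// leq_half_double -addnn leqW// leq_addr.
Qed.

Lemma is_cvg_par_coeff b d : cvgn (series (par_coeff b d)).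
Proof.
apply: normed_cvg; pose M := 1 + `|d|.
have M1 : 1 <= M by rewrite lerDl.
apply: (series_le_cvg _ _ _ (is_cvg_series_exp_coeff M)) => n //=.
  by rewrite exp_coeff_ge0// (le_trans _ M1).
by apply: par_coeff_le => //; rewrite lerDr.
Qed.

Lemma cvg_par_exp b d : series (par_coeff b d) @ \oo --> par_exp b d.
Proof. exact: is_cvg_par_coeff. Qed.

(** The mean value factor n is absorbed in 2^n, so that over the whole series these bounds sum to
    e^(2 M). *)
Lemma dist_expr_le M d e n : 1 <= M -> `|d| <= M -> `|e| <= M ->
  `|d ^+ n - e ^+ n| <= `|d - e| * (2 * M) ^+ n.
Proof.
move=> M1 dM eM; have M0 : 0 <= M by apply: le_trans M1.
elim: n => [|n IH]; first by rewrite !expr0 subrr normr0 mulr1.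
have -> : d ^+ n.+1 - e ^+ n.+1 = d * (d ^+ n - e ^+ n) + (d - e) * e ^+ n.
  by rewrite !exprS; ring.
rewrite (le_trans (ler_normD _ _))// !normrM.
have h1 : `|d| * `|d ^+ n - e ^+ n| <= M * (`|d - e| * (2 * M) ^+ n).
  exact: ler_pM.
have h2 : `|e ^+ n| <= (2 * M) ^+ n.
  rewrite normrX (le_trans (lerXn2r _ _ _ eM)) ?nnegrE// lerXn2r ?nnegrE//.
    by rewrite mulr_ge0.
  by rewrite ler_peMl// ler1n.
rewrite (le_trans (lerD h1 (ler_wpM2l (normr_ge0 _) h2)))//.
rewrite exprS (mulrCA _ (2 * M)).
have : 0 <= `|d - e| * (2 * M) ^+ n by rewrite mulr_ge0// exprn_ge0// mulr_ge0.
by move: (`|d - e| * _) => z z0; nra.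
Qed.

Lemma par_exp_lipschitz b M d e : 1 <= M -> `|d| <= M -> `|e| <= M ->
  `|par_exp b d - par_exp b e| <= expR (2 * M) * `|d - e|.
Proof.
move=> M1 dM eM; have M0 : 0 <= M by apply: le_trans M1.
have cB : (fun n => `|series (par_coeff b d) n - series (par_coeff b e) n|) @ \oo
    --> `|par_exp b d - par_exp b e|.
  by apply: cvg_norm; apply: cvgB; exact: cvg_par_exp.
have cM : (fun n => series (exp_coeff (2 * M)) n * `|d - e|) @ \oo
    --> expR (2 * M) * `|d - e|.
  by apply: cvgMr_tmp; exact: is_cvg_series_exp_coeff.
rewrite -(cvg_lim _ cB)// -(cvg_lim _ cM)//; apply: ler_lim.
- by apply/cvg_ex; exists `|par_exp b d - par_exp b e|.
- by apply/cvg_ex; exists (expR (2 * M) * `|d - e|).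
apply: nearW => n; rewrite /series/= -sumrB mulr_suml.
rewrite (le_trans (ler_norm_sum _ _ _))//; apply: ler_sum => k _.
rewrite /par_coeff -mulrBr -mulrBl normrM.
rewrite (le_trans (ler_piMl _ _))//; first by case: eqP; rewrite ?normr1 ?normr0.
rewrite normrM normfV normr_nat /exp_coeff/= mulrAC ler_wpM2r ?invr_ge0//.
rewrite (le_trans (dist_expr_le _ M1 dM eM))// mulrC ler_wpM2r//.
rewrite ler_weXn2l//; last by rewrite leq_half_double -addnn leqW// leq_addr.
by rewrite (le_trans M1)// ler_peMl// ler1n.
Qed.

Lemma par_exp0 b : par_exp b 0 = 1.
Proof.
apply: cvg_lim => //; apply: cvg_near_cst.
exists 2%N => // -[//|[//|n]] _; rewrite /series/= !big_nat_recl//= big1 => [|k _].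
  rewrite addr0 /par_coeff/= fact0 factS fact0 !expr0 muln1 !divr1.
  by case: b; rewrite !(mul1r, mul0r, addr0, add0r).
by rewrite /par_coeff/= exprS !mul0r mulr0.
Qed.

Lemma continuous_par_exp b : continuous (par_exp b).
Proof.
move=> d; apply/cvgrPdist_le => e e0.
pose M := `|d| + 1; have M1 : 1 <= M by rewrite lerDr.
have E0 : 0 < expR (2 * M) by exact: expR_gt0.
near=> x.
have xd : `|d - x| <= 1 by near: x; apply: cvgr_dist_le => //; exact: cvg_id.
have xM : `|x| <= M.
  by rewrite -(subrK d x) addrC (le_trans (ler_normD _ _))// lerD2l distrC.
rewrite (le_trans (par_exp_lipschitz b M1 _ xM)) ?lerDl//.
rewrite mulrC -ler_pdivlMr//; near: x.
by apply: cvgr_dist_le; [exact: cvg_id|rewrite divr_gt0].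
Unshelve. all: by end_near. Qed.

(** Even and odd terms of the exponential series: e^r = cosh r + sinh r. *)
Lemma par_exp_sqr (r : R) :
  par_exp false (r ^+ 2) + r * par_exp true (r ^+ 2) = expR r.
Proof.
have c : series (par_coeff false (r ^+ 2)) n
    + r * series (par_coeff true (r ^+ 2)) n @[n --> \oo] -->
    par_exp false (r ^+ 2) + r * par_exp true (r ^+ 2).
  by apply: cvgD; [|apply: cvgMr]; exact: cvg_par_exp.
apply: esym; rewrite -(cvg_lim _ c)// /expR; congr (lim (_ @ \oo)).
apply/funext => n; rewrite /series/= mulr_sumr -big_split/=.
apply: eq_bigr => k _; rewrite /par_coeff /exp_coeff/= -exprM mul2n.
have -> : r ^+ k = r ^+ odd k * r ^+ k./2.*2.
  by rewrite -exprD odd_double_half.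
by case: (odd k) => /=; ring.
Qed.

Lemma par_exp_Nsqr (r : R) : par_exp false (- r ^+ 2) = cos r /\
  r * par_exp true (- r ^+ 2) = sin r.
Proof.
split.
  rewrite cos.unlock; congr (lim (_ @ \oo)); apply/funext => n.
  apply: eq_bigr => k _; rewrite /par_coeff /cos_coeff/=; case: (boolP (odd k)) => ko /=.
    by rewrite !mul0r.
  have -> : r ^+ k = (r ^+ 2) ^+ k./2.
    by rewrite -exprM mul2n -[in LHS](odd_double_half k) (negPf ko).
  by rewrite exprNn -exprnP; ring.
have c : r * series (par_coeff true (- r ^+ 2)) n @[n --> \oo] -->
    r * par_exp true (- r ^+ 2).
  by apply: cvgMl_tmp; exact: cvg_par_exp.
rewrite -(cvg_lim _ c)// sin.unlock; congr (lim (_ @ \oo)); apply/funext => n.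
rewrite /series/= mulr_sumr; apply: eq_bigr => k _.
rewrite /par_coeff /sin_coeff/=; case: (boolP (odd k)) => ko /=; last first.
  by rewrite !mul0r mulr0.
have -> : r ^+ k = r * (r ^+ 2) ^+ k./2.
  by rewrite -exprM mul2n -exprS -[in LHS](odd_double_half k) ko.
have -> : k.-1./2 = k./2 by rewrite -[in LHS](odd_double_half k) ko /= doubleK.
by rewrite (exprNn (r ^+ 2)) !mul1r !mulrA (mulrC r).
Qed.

(** For d >= 0 this is e^r e^(-r) = 1 with r = sqrt d, for d < 0 it is cos^2 + sin^2 = 1 at sqrt
    (-d). It becomes det (exp X) = 1. *)
Lemma par_exp_det d : par_exp false d ^+ 2 - d * par_exp true d ^+ 2 = 1.
Proof.
have [d0|d0] := leP 0 d.
  have dE : Num.sqrt d ^+ 2 = d by rewrite sqr_sqrtr.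
  have e1 := par_exp_sqr (Num.sqrt d); have := par_exp_sqr (- Num.sqrt d).
  rewrite sqrrN dE in e1 * => e2; rewrite -[RHS](expRxMexpNx_1 (Num.sqrt d)) -e1 -e2.
  have H (c s t : R) : (c + t * s) * (c + - t * s) = c ^+ 2 - t ^+ 2 * s ^+ 2.
    by ring.
  by rewrite H dE.
have dE : - Num.sqrt (- d) ^+ 2 = d by rewrite sqr_sqrtr ?opprK// oppr_ge0 ltW.
have [e1 e2] := par_exp_Nsqr (Num.sqrt (- d)); rewrite dE in e1 e2.
rewrite -(cos2Dsin2 (Num.sqrt (- d))) -e1 -e2 exprMn sqr_sqrtr ?mulNr//.
by rewrite oppr_ge0 ltW.
Qed.

End parity_exponential.

(** * Exponential and logarithm of 2 by 2 matrices *)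

Section matrix2.
Variable R : realType.
Implicit Types A B X Y : 'M[R]_2.

Lemma ord2P (P : 'I_2 -> Prop) : P 0 -> P 1 -> forall i, P i.
Proof.
move=> P0 P1 i; case: (unliftP 0 i) => [j ->|->//].
by rewrite (_ : lift 0 j = 1)//; apply: val_inj; rewrite /= (ord1 j).
Qed.

Lemma mx2P A B : A 0 0 = B 0 0 -> A 0 1 = B 0 1 -> A 1 0 = B 1 0 ->
  A 1 1 = B 1 1 -> A = B.
Proof.
move=> e00 e01 e10 e11; apply/matrixP => i j; move: i j.
by apply: ord2P; apply: ord2P.
Qed.

Lemma mulmx2E A B i j : (A *m B) i j = A i 0 * B 0 j + A i 1 * B 1 j.
Proof.
rewrite mxE !big_ord_recl big_ord0 addr0.
by rewrite (_ : lift ord0 ord0 = 1)//; exact: val_inj.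
Qed.

Lemma mxtrace2 A : \tr A = A 0 0 + A 1 1.
Proof.
rewrite /mxtrace !big_ord_recl big_ord0 addr0.
by rewrite (_ : lift ord0 ord0 = 1)//; exact: val_inj.
Qed.

Lemma det2 A : \det A = A 0 0 * A 1 1 - A 0 1 * A 1 0.
Proof.
rewrite (expand_det_row _ 0) !big_ord_recl big_ord0 addr0 /cofactor !det_mx11 !mxE.
have -> : lift ord0 ord0 = 1 :> 'I_2 by exact: val_inj.
have -> : lift 1 0 = 0 :> 'I_2 by exact: val_inj.
rewrite /=; ring.
Qed.

Lemma mx_entry_norm A i j : `|A i j| <= `|A|.
Proof.
by rewrite [leRHS]/Num.Def.normr/= mx_normrE; apply: (le_bigmax _ _ (i, j)).
Qed.

Lemma mx_norm_le A c : 0 <= c -> (forall i j, `|A i j| <= c) -> `|A| <= c.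
Proof.
move=> c0 Ac; rewrite [leLHS]/Num.Def.normr/= mx_normrE.
by apply: bigmax_le => // -[i j] _; exact: Ac.
Qed.

Lemma norm_mulmx2 A B : `|A *m B| <= 2 * (`|A| * `|B|).
Proof.
apply: mx_norm_le => [|i j]; first by rewrite !mulr_ge0.
rewrite mulmx2E (le_trans (ler_normD _ _))// !normrM mulr2n mulrDl mul1r.
by rewrite lerD// ler_pM// mx_entry_norm.
Qed.

Definition sl2_part A := A - (\tr A / 2)%:M.

Lemma sl2_partE A i j : sl2_part A i j = A i j - (\tr A / 2) *+ (i == j).
Proof. by rewrite !mxE. Qed.

Lemma norm_sl2_part A : `|sl2_part A| <= 2 * `|A|.
Proof.
apply: mx_norm_le => [|i j]; first by rewrite mulr_ge0.
rewrite sl2_partE (le_trans (ler_normB _ _))// mulr2n mulrDl mul1r.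
rewrite lerD ?mx_entry_norm//; case: eqP => _; last by rewrite normr0.
rewrite mulr1n mxtrace2 normrM (@ger0_norm _ 2^-1)// ler_pdivrMr//.
rewrite (le_trans (ler_normD _ _))// mulr_natr mulr2n.
by rewrite lerD// mx_entry_norm.
Qed.

Lemma tr_sl2_part A : \tr (sl2_part A) = 0.
Proof. by rewrite mxtrace2 !sl2_partE !eqxx !mulr1n mxtrace2; field. Qed.

Lemma det_sl2_part A : \det A = (\tr A / 2) ^+ 2 + \det (sl2_part A).
Proof. by rewrite !det2 !sl2_partE !eqxx/= !mulr0n !mulr1n !mxtrace2; field. Qed.

(** Cayley-Hamilton at trace 0. *)
Lemma sqr_sl2 X : \tr X = 0 -> X *m X = (- \det X)%:M.
Proof.
rewrite mxtrace2 => /eqP; rewrite addr_eq0 => /eqP X0.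
by apply: mx2P; rewrite mulmx2E mxE det2 X0/=; ring.
Qed.

Lemma det_dist_le X Y r : `|X| <= r -> `|Y| <= r ->
  `|\det X - \det Y| <= 4 * r * `|X - Y|.
Proof.
move=> Xr Yr; rewrite !det2.
have -> : X 0 0 * X 1 1 - X 0 1 * X 1 0 - (Y 0 0 * Y 1 1 - Y 0 1 * Y 1 0) =
  X 0 0 * (X 1 1 - Y 1 1) + (X 0 0 - Y 0 0) * Y 1 1
  + (- X 0 1) * (X 1 0 - Y 1 0) + (- (X 0 1 - Y 0 1)) * Y 1 0 by ring.
have E i j k l (Z : 'M[R]_2) : `|Z| <= r ->
    `|Z i j| * `|(X - Y) k l| <= r * `|X - Y|.
  by move=> Zr; rewrite ler_pM// ?mx_entry_norm// (le_trans (mx_entry_norm _ _ _)).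
have := E 0 0 1 1 X Xr; have := E 1 1 0 0 Y Yr.
have := E 0 1 1 0 X Xr; have := E 1 0 0 1 Y Yr; rewrite !mxE => h1 h2 h3 h4.
rewrite (le_trans (ler_normD _ _))//.
rewrite (le_trans (lerD (ler_normD _ _) (lexx _)))//.
rewrite (le_trans (lerD (lerD (ler_normD _ _) (lexx _)) (lexx _)))//.
by rewrite !normrM !normrN; lra.
Qed.

Lemma norm_det_le X : `|\det X| <= 2 * `|X| ^+ 2.
Proof.
rewrite det2 (le_trans (ler_normB _ _))// !normrM mulr2n mulrDl mul1r expr2.
by rewrite lerD// ler_pM// mx_entry_norm.
Qed.

(** X^2 is the scalar -det X, so every power of X is a scalar times 1 or X, and the series splits by
    parity into two scalar series. *)
Lemma expmxE X : \tr X = 0 ->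
  expmx X = (par_exp false (- \det X))%:M + par_exp true (- \det X) *: X.
Proof.
move=> trX; apply: cvg_lim => //.
have -> : series (fun n => n`!%:R^-1 *: X ^+ n) =
    fun n => series (par_coeff false (- \det X)) n *: (1%:M : 'M[R]_2)
      + series (par_coeff true (- \det X)) n *: X.
  apply/funext => n; rewrite /series/= !scaler_suml -big_split/=.
  apply: eq_bigr => k _; rewrite /par_coeff.
  have -> : X ^+ k = (- \det X) ^+ k./2 *: X ^+ odd k.
    rewrite -{1}(odd_double_half k) addnC exprD -muln2 mulnC exprM.
    rewrite [X in X ^+ _ * _](_ : _ = (- \det X)%:M); last first.
      by rewrite -sqr_sl2// expr2.
    by rewrite -rmorphXn/= -mul_scalar_mx.
  case: (odd k); rewrite !(mul0r, mul1r, scale0r, addr0, add0r)/=.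
    by rewrite expr1 scalerA mulrC.
  by rewrite expr0 scalerA mulrC.
rewrite -(scalemx1 _ (par_exp false _)).
apply: cvgD; apply: cvgZr_tmp; exact: cvg_par_exp.
Qed.

Lemma expmx_entry X i j : \tr X = 0 -> expmx X i j =
  par_exp false (- \det X) *+ (i == j) + par_exp true (- \det X) * X i j.
Proof. by move=> /expmxE ->; rewrite !mxE. Qed.

Lemma expmx0 : expmx 0 = 1 :> 'M[R]_2.
Proof. by rewrite expmxE ?mxtrace0// det0 oppr0 par_exp0 scaler0 addr0. Qed.

Lemma det_expmx X : \tr X = 0 -> \det (expmx X) = 1.
Proof.
move=> trX; have D := par_exp_det (- \det X).
have := trX; rewrite mxtrace2 => /eqP; rewrite addr_eq0 => /eqP X0.
have dX : \det X = - X 1 1 ^+ 2 - X 0 1 * X 1 0 by rewrite det2 X0; ring.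
rewrite det2 !expmx_entry//= -D; move: (par_exp _ _) (par_exp _ _) => c s.
by rewrite dX X0; ring.
Qed.

Lemma expmxN X : \tr X = 0 -> expmx (- X) *m expmx X = 1.
Proof.
move=> trX; have trN : \tr (- X) = 0 by rewrite raddfN/= trX oppr0.
have dN : \det (- X) = \det X by rewrite !det2 !mxE; ring.
have D := par_exp_det (- \det X).
have := trX; rewrite mxtrace2 => /eqP; rewrite addr_eq0 => /eqP X0.
have dX : \det X = - X 1 1 ^+ 2 - X 0 1 * X 1 0 by rewrite det2 X0; ring.
have sqr (c s : R) : c ^+ 2 - (- \det X) * s ^+ 2 = 1 ->
    (c%:M - s *: X) *m (c%:M + s *: X) = 1.
  rewrite dX => D1; apply: mx2P; rewrite mulmx2E !mxE/= ?mulr0n ?mulr1n -?D1 ?X0; ring.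
by rewrite -[RHS](sqr _ _ D) !expmxE// dN scalerN.
Qed.

(** 1 - 1/4 <= e^(-1/4) gives e^(1/4) <= 4/3, and (4/3)^8 < 10. *)
Lemma expR2_le10 : expR 2 <= 10 :> R.
Proof.
have := expR_ge1Dx (- (1 / 4) : R); rewrite expRN => h.
have e0 : 0 < expR (1 / 4 : R) by exact: expR_gt0.
have e1 : expR (1 / 4 : R) <= 4 / 3.
  rewrite -[leLHS]invrK -[leRHS]invrK lef_pV2 ?posrE ?invr_gt0//; last first.
  by lra.
have -> : 2 = 8%:R * (1 / 4) :> R by lra.
rewrite expRM_natl (le_trans (lerXn2r 8 _ _ e1)) ?nnegrE ?ltW//.
by lra.
Qed.

Lemma par_exp_near1 b (d : R) : `|d| <= 1 -> `|par_exp b d - 1| <= 10 * `|d|.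
Proof.
move=> d1; have := @par_exp_lipschitz R b 1 d 0 (lexx _) d1.
rewrite normr0 ler01 subr0 par_exp0 => /(_ isT) h; rewrite (le_trans h)//.
by rewrite ler_wpM2r// mulr1 expR2_le10.
Qed.

(** In exp X = C + S X the traceless part is t = S X, where C and S are functions of d = -det X. So
    X must be t / S, and d must solve d S(d)^2 = -det t, which is done by the intermediate value
    theorem. Since S = 1 + O(d) and d = O(|X|^2), X differs from t only at third order. *)
Lemma logmx_exists A : \det A = 1 -> 0 < \tr A -> `|sl2_part A| <= 1 / 20 ->
  exists X, [/\ \tr X = 0, expmx X = A, `|X| <= 2 * `|sl2_part A| &
    `|X - sl2_part A| <= 160 * `|sl2_part A| ^+ 3].
Proof.
move=> detA trA; set t := sl2_part A => t20.
have t0 : 0 <= `|t| by [].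
pose f (d : R) := d * par_exp true d ^+ 2.
have cf : continuous f.
  move=> x; apply: cvgM; first exact: cvg_id.
  by apply: cvgM; exact: continuous_par_exp.
have S1 (d : R) : `|d| <= 1 / 20 -> 1 / 2 <= par_exp true d.
  move=> d20; have d1 : `|d| <= 1 by lra.
  by have := par_exp_near1 true d1; rewrite ler_norml => /andP[]; lra.
have eta : `|\det t| <= 1 / 200.
  by rewrite (le_trans (norm_det_le _))//; nra.
(* At the endpoints S >= 1/2, so [f] has opposite signs there and absolute value at least 1/80,
   while |det t| <= 1/200. *)
have [|||d dI fd] := @IVT R f (- (1 / 20)) (1 / 20) (- \det t).
- lra.
- exact: continuous_subspaceT.
- have a1 : 1 / 2 <= @par_exp R true (- (1 / 20)) by apply: S1; rewrite normrN ger0_norm; lra.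
  have a2 : 1 / 2 <= @par_exp R true (1 / 20) by apply: S1; rewrite ger0_norm; lra.
  move: eta; rewrite ler_norml => /andP[e1 e2].
  by rewrite ge_min le_max /f; apply/andP; split; apply/orP; [left|right]; nra.
have d20 : `|d| <= 1 / 20 by move: dI; rewrite ler_norml in_itv.
have d1 : `|d| <= 1 by lra.
have {}S1 := S1 d d20.
set S := par_exp true d in fd S1.
have S0 : S != 0 by rewrite gt_eqF//; lra.
pose X := S^-1 *: t.
have tX : t = S *: X by rewrite scalerA divff// scale1r.
have trX : \tr X = 0 by rewrite mxtraceZ tr_sl2_part mulr0.
have dX : - \det X = d.
  by rewrite /X detZ exprVn -mulrN -fd /f -/S mulrCA mulVf ?mulr1// expf_neq0.
have XE : `|t| = S * `|X| by rewrite {1}tX normrZ ger0_norm//; lra.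
have X0 : 0 <= `|X| by [].
exists X; split => //.
- have D := par_exp_det d; rewrite -/S in D.
  have C0 : 1 / 2 <= par_exp false d.
    by have := par_exp_near1 false d1; rewrite ler_norml => /andP[]; lra.
  (* Both squares equal 1 + d S^2, by det A = 1 and by [par_exp_det]. Positivity of the trace of A
     then excludes the opposite sign. *)
  have trE : (\tr A / 2) ^+ 2 = par_exp false d ^+ 2.
    move: fd; rewrite /f -/S => fd; have := det_sl2_part A; rewrite -/t; lra.
  have /eqP := trE; rewrite eqrXn2 ?divr_ge0//; [|lra..].
  move=> /eqP {}trE; rewrite expmxE// dX -tX -trE /t /sl2_part.
  by rewrite addrC subrK.
- nra.
have -> : X - t = (1 - S) *: X by rewrite scalerBl scale1r -tX.
rewrite normrZ distrC.
have h1 : `|S - 1| <= 10 * `|d| by exact: par_exp_near1.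
have h2 : `|d| <= 2 * `|X| ^+ 2 by rewrite -dX normrN norm_det_le.
have h3 : `|X| <= 2 * `|t| by nra.
have h4 : `|S - 1| <= 20 * `|X| ^+ 2 by lra.
have h5 : `|X| ^+ 3 <= (2 * `|t|) ^+ 3 by rewrite lerXn2r ?nnegrE//; lra.
have : `|S - 1| * `|X| <= 20 * `|X| ^+ 2 * `|X| by rewrite ler_wpM2r.
move: h5; rewrite exprMn !exprS expr0; lra.
Qed.

(* Baker-Campbell-Hausdorff to first order, with an error controlled by the
   difference [Y - X]. *)
Lemma logmx_expmx_mul r X Y : r <= 1 / 100 -> \tr X = 0 -> \tr Y = 0 ->
  `|X| <= r -> `|Y| <= r ->
  exists Z, [/\ \tr Z = 0, expmx Z = expmx (- X) *m expmx Y &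
    `|Z - (Y - X)| <= 20 * r * `|Y - X|].
Proof.
move=> r100 trX trY Xr Yr; set A := _ *m _.
have trN : \tr (- X) = 0 by rewrite raddfN/= trX oppr0.
have dN : \det (- X) = \det X by rewrite !det2 !mxE; ring.
have detA : \det A = 1 by rewrite det_mulmx !det_expmx// mulr1.
have r0 : 0 <= r by rewrite (le_trans _ Xr).
have dXY : `|- \det X - - \det Y| <= 4 * r * `|Y - X|.
  by rewrite -opprD normrN (distrC Y) det_dist_le.
have dX : `|- \det X| <= 2 * r ^+ 2.
  by rewrite normrN (le_trans (norm_det_le _))// ler_pM2l// lerXn2r ?nnegrE.
have dY : `|- \det Y| <= 2 * r ^+ 2.
  by rewrite normrN (le_trans (norm_det_le _))// ler_pM2l// lerXn2r ?nnegrE.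
have r2 : 2 * r ^+ 2 <= r / 50 by rewrite expr2; nra.
have dX1 : `|- \det X| <= 1 by lra.
have dY1 : `|- \det Y| <= 1 by lra.
have cX := par_exp_near1 false dX1; have sX := par_exp_near1 true dX1.
have cY := par_exp_near1 false dY1; have sY := par_exp_near1 true dY1.
have cXY := @par_exp_lipschitz R false 1 _ _ (lexx _) dX1 dY1.
have sXY := @par_exp_lipschitz R true 1 _ _ (lexx _) dX1 dY1.
rewrite mulr1 in cXY sXY.
have e2 := expR2_le10; have e0 := expR_ge0 (2 : R).
set T := Y - X in dXY *; have T0 : 0 <= `|T| by [].
have {}cXY := le_trans cXY (ler_pM e0 (normr_ge0 _) e2 dXY).
have {}sXY := le_trans sXY (ler_pM e0 (normr_ge0 _) e2 dXY).
have AE : A = (par_exp false (- \det X) * par_exp false (- \det Y))%:M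
  + (par_exp false (- \det X) * par_exp true (- \det Y)) *: Y
  - (par_exp true (- \det X) * par_exp false (- \det Y)) *: X
  - (par_exp true (- \det X) * par_exp true (- \det Y)) *: (X *m Y).
  rewrite /A !expmxE// dN.
  move: (X *m Y) (mulmx2E X Y) => M ME.
  by apply: mx2P; rewrite mulmx2E !mxE/= ?mulr0n ?mulr1n ME; ring.
move: AE cXY sXY cX sX cY sY.
move: (par_exp false (- \det X)) (par_exp true (- \det X)) => cX sX.
move: (par_exp false (- \det Y)) (par_exp true (- \det Y)) => cY sY AE.
move=> hc hs hcX hsX hcY hsY.
have tXY : `|sl2_part (X *m Y)| <= 4 * (r * `|T|).
  (* X X is a scalar matrix, so Y may be replaced by T = Y - X under the traceless part; this makes
     the bilinear term proportional to T. *)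
  have -> : sl2_part (X *m Y) = sl2_part (X *m T).
    rewrite mulmxBr sqr_sl2//; move: (X *m Y) => M.
    by apply: mx2P; rewrite !sl2_partE !mxtrace2 !mxE/= ?mulr0n ?mulr1n; field.
  rewrite (le_trans (norm_sl2_part _))// (_ : 4 = 2 * 2); last lra.
  rewrite -mulrA ler_pM2l// (le_trans (norm_mulmx2 _ _))// ler_pM2l//.
  by rewrite ler_wpM2r.
(* Each term carries a factor T: the first openly, the second because its coefficient vanishes at X
   = Y and is bounded by the Lipschitz estimates, the third by [tXY]. *)
have tA : sl2_part A - T = (cX * sY - 1) *: T + (cX * sY - sX * cY) *: X
    - (sX * sY) *: sl2_part (X *m Y).
  have := trX; rewrite mxtrace2 => /eqP; rewrite addr_eq0 => /eqP X0.
  have := trY; rewrite mxtrace2 => /eqP; rewrite addr_eq0 => /eqP Y0.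
  rewrite AE /T; move: (X *m Y) => M.
  by apply: mx2P; rewrite !(mxE, sl2_partE, mxtrace2)/= ?mulr0n ?mulr1n ?X0 ?Y0; field.
have {}hcX : `|cX - 1| <= r / 5 by clear -hcX dX r2; lra.
have {}hsX : `|sX - 1| <= r / 5 by clear -hsX dX r2; lra.
have {}hcY : `|cY - 1| <= r / 5 by clear -hcY dY r2; lra.
have {}hsY : `|sY - 1| <= r / 5 by clear -hsY dY r2; lra.
move: (hcX) (hsX) (hcY) (hsY); rewrite !ler_norml.
move=> /andP[cX0 cX1] /andP[sX0 sX1] /andP[cY0 cY1] /andP[sY0 sY1].
(* The trace is close to 2, which puts A on the branch required by [logmx_exists]. *)
have trA : 0 < \tr A.
  have -> : \tr A = 2 * (cX * cY) - sX * sY * \tr (X *m Y).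
    rewrite AE; move: (X *m Y) => M; move: trX trY.
    rewrite !mxtrace2 => /eqP; rewrite addr_eq0 => /eqP X0.
    by move=> /eqP; rewrite addr_eq0 => /eqP Y0; rewrite !mxE X0 Y0 /=; ring.
  have hM : `|X *m Y| <= 2 * (r * r).
    by rewrite (le_trans (norm_mulmx2 _ _))// ler_pM2l// ler_pM.
  have htr : \tr (X *m Y) <= 4 * (r * r).
    rewrite mxtrace2 (le_trans (ler_norm _))// (le_trans (ler_normD _ _))//.
    have := mx_entry_norm (X *m Y) 0 0; have := mx_entry_norm (X *m Y) 1 1; lra.
  have c1 : 9 / 10 <= cX * cY by clear -cX0 cX1 cY0 cY1 r100 r0; nra.
  have s1 : 0 <= sX * sY by clear -sX0 sX1 sY0 sY1 r100 r0; nra.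
  have s2 : sX * sY <= 2 by clear -sX0 sX1 sY0 sY1 r100 r0; nra.
  clear -c1 s1 s2 htr r0 r100; nra.
have q1 : `|cX * sY - 1| <= r.
  rewrite ler_norml; clear -cX0 cX1 sY0 sY1 r100 r0.
  by apply/andP; split; nra.
have q2 : `|cX * sY - sX * cY| <= 100 * (r * `|T|).
  have -> : cX * sY - sX * cY = cX * (- (sX - sY)) + sX * (cX - cY) by ring.
  rewrite (le_trans (ler_normD _ _))// !normrM normrN.
  have nc : `|cX| <= 5 / 4 by rewrite ler_norml; clear -cX0 cX1 r100 r0; lra.
  have ns : `|sX| <= 5 / 4 by rewrite ler_norml; clear -sX0 sX1 r100 r0; lra.
  have n1 := ler_pM (normr_ge0 _) (normr_ge0 _) nc hs.
  have n2 := ler_pM (normr_ge0 _) (normr_ge0 _) ns hc.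
  clear -n1 n2; lra.
have q3 : `|sX * sY| <= 5 / 4.
  rewrite ler_norml; clear -sX0 sX1 sY0 sY1 r100 r0.
  by apply/andP; split; nra.
have rT : 0 <= r * `|T| by rewrite mulr_ge0.
have tAT : `|sl2_part A - T| <= 7 * (r * `|T|).
  rewrite tA (le_trans (ler_normB _ _))// (le_trans (lerD (ler_normD _ _) (lexx _)))//.
  rewrite !normrZ -(normrM sX).
  have n1 := ler_wpM2r T0 q1.
  have n2 := ler_pM (normr_ge0 _) (normr_ge0 _) q2 Xr.
  have n3 := ler_pM (normr_ge0 _) (normr_ge0 _) q3 tXY.
  have n4 := ler_wpM2l rT r100.
  clear -n1 n2 n3 n4; lra.
have T2r : `|T| <= 2 * r.
  by rewrite (le_trans (ler_normB _ _))//; clear -Xr Yr; lra.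
have tA2 : `|sl2_part A| <= 11 / 10 * `|T|.
  rewrite -[sl2_part A](subrK T) (le_trans (ler_normD _ _))//.
  clear -tAT r100 T0 r0; nra.
have [|Z [trZ ZA _ Zt]] := logmx_exists detA trA.
  clear -tA2 T2r r100; lra.
exists Z; split => //.
rewrite (_ : Z - T = (Z - sl2_part A) + (sl2_part A - T)); last first.
  by rewrite addrA subrK.
rewrite (le_trans (ler_normD _ _))//.
have t3 : `|sl2_part A| ^+ 3 <= (11 / 10 * `|T|) ^+ 3.
  by rewrite lerXn2r ?nnegrE// mulr_ge0.
have TT : `|T| ^+ 3 <= 4 / 100 * (r * `|T|).
  have T1 : `|T| ^+ 2 <= 4 / 100 * r by rewrite expr2; clear -T2r r0 r100 T0; nra.
  by rewrite exprSr (le_trans (ler_wpM2r T0 T1))// mulrA.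
rewrite exprMn in t3; clear -t3 TT Zt tAT rT; lra.
Qed.

End matrix2.

(** * Exponential coordinates on PSL2 *)

Section exponential_coordinates.
Variables (R : realType) (b : 3.-tuple 'M[R]_2).
Hypothesis hb : basis_of (sl2 R) b.
Local Notation R3 := (R * R * R)%type.
Implicit Types (u v w : R3) (X Y : 'M[R]_2).

Lemma sl2P X : (X \in sl2 R) = (\tr X == 0).
Proof. by rewrite /sl2 memv_ker lfunE. Qed.

Lemma R3_normE v : `|v| = Num.max (Num.max `|v.1.1| `|v.1.2|) `|v.2|.
Proof. by case: v => [[x y] z]. Qed.

Lemma R3_norm_le v r : (`|v| <= r) = [&& `|v.1.1| <= r, `|v.1.2| <= r & `|v.2| <= r].
Proof. by rewrite R3_normE !ge_max andbA. Qed.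

Lemma R3_coord_le (i : 'I_3) v : `|R3_coord i v| <= `|v|.
Proof.
have := lexx `|v|; rewrite {1}R3_norm_le => /and3P[h1 h2 h3].
by rewrite /R3_coord; case: i => -[|[|[|]]].
Qed.

Lemma sl2_ofE v : sl2_of b v = v.1.1 *: b`_0 + v.1.2 *: b`_1 + v.2 *: b`_2.
Proof. by rewrite /sl2_of !big_ord_recl big_ord0 addr0 !addrA. Qed.

Lemma sl2_ofD u v : sl2_of b (u + v) = sl2_of b u + sl2_of b v.
Proof.
case: u v => [[x y] z] [[x' y'] z']; rewrite !sl2_ofE /= !scalerDl.
by rewrite [RHS]addrACA; congr (_ + _); rewrite addrACA.
Qed.

Lemma sl2_ofN v : sl2_of b (- v) = - sl2_of b v.
Proof. by case: v => [[x y] z]; rewrite !sl2_ofE /= !scaleNr !opprD. Qed.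

Lemma tr_sl2_of v : \tr (sl2_of b v) = 0.
Proof.
have trb i : (i < 3)%N -> \tr b`_i = 0.
  move=> i3; apply/eqP; rewrite -sl2P (basis_mem hb)// mem_nth//.
  by rewrite size_tuple.
by rewrite sl2_ofE !mxtraceD !mxtraceZ !trb// !mulr0 !addr0.
Qed.

Definition sl2_coord X : R3 := (coord b 0 X, coord b 1 X, coord b 2 X).

Lemma sl2_coordK X : \tr X = 0 -> sl2_of b (sl2_coord X) = X.
Proof.
move=> /eqP; rewrite -sl2P => Xs; rewrite [RHS](coord_basis hb Xs).
rewrite sl2_ofE !big_ord_recl big_ord0 addr0 !addrA.
by congr (_ + _ + _); congr (coord b _ X *: _); exact: val_inj.
Qed.

Lemma sl2_ofK v : sl2_coord (sl2_of b v) = v.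
Proof.
case: v => [[x y] z]; have fb := basis_free hb.
rewrite /sl2_coord /sl2_of; congr (_, _, _); rewrite coord_sum_free//.
Qed.

Lemma mx_functional_le (f : 'M[R]_2 -> R) : linear f ->
  exists2 K, 0 < K & forall X, `|f X| <= K * `|X|.
Proof.
move=> lf; pose g := GRing.isLinear.Build _ _ _ _ f lf.
pose F : {linear 'M[R]_2 -> R} := HB.pack f g.
exists (1 + \sum_i \sum_j `|F (delta_mx i j)|).
  rewrite ltr_pwDl//; apply: sumr_ge0 => i _; apply: sumr_ge0 => j _ //.
move=> X; rewrite -[f X]/(F X) {1}(matrix_sum_delta X).
rewrite linear_sum (le_trans (ler_norm_sum _ _ _))//.
rewrite mulrDl mul1r ler_wpDl// mulr_suml; apply: ler_sum => i _.
rewrite linear_sum (le_trans (ler_norm_sum _ _ _))//.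
rewrite mulr_suml; apply: ler_sum => j _.
by rewrite linearZ/= normrM mulrC ler_wpM2l// mx_entry_norm.
Qed.

Lemma sl2_coord_le : exists2 K, 1 <= K & forall X, `|sl2_coord X| <= K * `|X|.
Proof.
have co i : exists2 K, 0 < K & forall X, `|coord b i X| <= K * `|X|.
  by apply: mx_functional_le => a x y; rewrite linearP.
have [K0 K00 h0] := co 0; have [K1 K10 h1] := co 1; have [K2 K20 h2] := co 2.
exists (1 + K0 + K1 + K2); first by rewrite -!addrA lerDl ltW// !addr_gt0.
move=> X; have X0 : 0 <= `|X| by [].
have := h0 X; have := h1 X; have := h2 X.
by rewrite R3_norm_le /=; move=> ? ? ?; apply/and3P; split; nra.
Qed.

Lemma sl2_of_le : exists2 K, 1 <= K & forall v, `|sl2_of b v| <= K * `|v|.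
Proof.
exists (1 + `|b`_0| + `|b`_1| + `|b`_2|).
  by rewrite -!addrA lerDl !addr_ge0.
move=> v; have v0 : 0 <= `|v| by [].
have := lexx `|v|; rewrite {1}R3_norm_le => /and3P[h1 h2 h3].
rewrite sl2_ofE (le_trans (ler_normD _ _))//.
rewrite (le_trans (lerD (ler_normD _ _) (lexx _)))// !normrZ.
have := ler_wpM2r (normr_ge0 b`_0) h1; have := ler_wpM2r (normr_ge0 b`_1) h2.
have := ler_wpM2r (normr_ge0 b`_2) h3; nra.
Qed.

Lemma SL2val_exp v :
  SL2val (insubd (SL2_one R) (expmx (sl2_of b v))) = expmx (sl2_of b v).
Proof. by rewrite val_insubd det_expmx ?eqxx// tr_sl2_of. Qed.

Lemma to_PSL2_mul (A B C : SL2 R) : SL2val C = A *m B ->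
  to_PSL2 C = (to_PSL2 A * to_PSL2 B)%g.
Proof.
by move=> E; rewrite (_ : C = (A * B)%g) ?to_PSL2M//; exact: val_inj.
Qed.

Lemma PSL2_exp0 : PSL2_exp b 0 = 1%g.
Proof.
congr to_PSL2; apply: val_inj; rewrite [LHS]SL2val_exp -[0]subr0 sl2_ofD sl2_ofN subrr.
by rewrite expmx0.
Qed.

Lemma PSL2_expN v : PSL2_exp b (- v) = ((PSL2_exp b v)^-1)%g.
Proof.
apply: (mulIg (PSL2_exp b v)); rewrite mulVg; apply/esym/to_PSL2_mul.
transitivity (expmx (- sl2_of b v) *m expmx (sl2_of b v)).
  by rewrite expmxN ?tr_sl2_of.
rewrite -sl2_ofN.
by congr (_ *m _); apply/esym; exact: SL2val_exp.
Qed.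

(** Subtracting 1 does not change the traceless part, and closeness to 1 keeps the trace positive,
    so [logmx_exists] applies; its solution is then read in the basis [b]. *)
Lemma PSL2_log_exists : exists2 r0 : R, 0 < r0 & exists2 K : R, 1 <= K &
  forall (A : SL2 R), `|SL2val A - 1| <= r0 ->
  exists2 w, PSL2_exp b w = to_PSL2 A & `|w| <= K * `|SL2val A - 1|.
Proof.
have [K K1 hK] := sl2_coord_le.
exists (1 / 40); first lra; exists (4 * K); first by lra.
move=> A A40; have tA : `|sl2_part A| <= 2 * `|SL2val A - 1|.
  rewrite (_ : sl2_part A = sl2_part (SL2val A - 1)) ?norm_sl2_part//.
  by apply: mx2P; rewrite !(sl2_partE, mxtrace2) !mxE/= ?mulr0n ?mulr1n; field.
have [|||X [trX XA Xt _]] := @logmx_exists R A.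
- exact: det_SL2.
- have := mx_entry_norm (SL2val A - 1) 0 0; have := mx_entry_norm (SL2val A - 1) 1 1.
  rewrite mxtrace2 !mxE/= !ler_norml => /andP[h1 _] /andP[h2 _]; lra.
- lra.
exists (sl2_coord X).
  by congr to_PSL2; apply: val_inj; rewrite [LHS]SL2val_exp sl2_coordK.
rewrite (le_trans (hK X))//; have := normr_ge0 X; nra.
Qed.

(** This is [logmx_expmx_mul] in the basis [b]. The error is kept proportional to |v - u|, not just
    to r^2, because the comparison of Haar measures uses points much closer to each other than r. *)
Lemma PSL2_log_mul : exists2 r0 : R, 0 < r0 & exists2 K : R, 1 <= K &
  forall r u v, r <= r0 -> `|u| <= r -> `|v| <= r ->
  exists2 w, PSL2_exp b w = ((PSL2_exp b u)^-1 * PSL2_exp b v)%g &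
    `|w - (v - u)| <= K * r * `|v - u|.
Proof.
have [K K1 hK] := sl2_coord_le; have [L L1 hL] := sl2_of_le.
exists (1 / 100 / L); first by rewrite divr_gt0//; lra.
exists (20 * K * L * L); first by nra.
move=> r u v rr ur vr; have L0 : 0 < L by lra.
have r0 : 0 <= r by rewrite (le_trans _ ur).
have hr w : `|w| <= r -> `|sl2_of b w| <= L * r.
  by move=> wr; rewrite (le_trans (hL w))// ler_pM2l.
have Lr : L * r <= 1 / 100 by move: rr; rewrite ler_pdivlMr// mulrC.
have [Z [trZ ZE Zd]] := logmx_expmx_mul Lr (tr_sl2_of u) (tr_sl2_of v) (hr _ ur) (hr _ vr).
exists (sl2_coord Z).
  rewrite -PSL2_expN; apply: to_PSL2_mul.
  rewrite [LHS]SL2val_exp (sl2_coordK trZ) ZE -sl2_ofN.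
  by congr (_ *m _); apply/esym; exact: SL2val_exp.
have E : sl2_coord Z - (v - u) =
    sl2_coord (Z - (sl2_of b v - sl2_of b u)).
  rewrite -{1}(sl2_ofK v) -{1}(sl2_ofK u).
  by rewrite /sl2_coord !linearB/=.
rewrite E (le_trans (hK _))// (le_trans (ler_wpM2l _ Zd))//; first lra.
rewrite -sl2_ofN -sl2_ofD; have := hL (v - u).
have : 0 <= K * (L * r) by rewrite !mulr_ge0//; lra.
move=> h1 h2; have := ler_wpM2l h1 h2; lra.
Qed.

End exponential_coordinates.

Local Open Scope quotient_scope.

(** * Cubes in R^3 *)

Section cube.
Variable R : realType.
Local Notation R3 := (R * R * R)%type.
Implicit Types (c v : R3) (r : R).

(** The norm of a triple is the maximum norm, so this closed ball is a product of intervals. *)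
Definition cube c r : set R3 := [set v | `|v - c| <= r].

Lemma cubeE c r : cube c r = `[c.1.1 - r, c.1.1 + r]%classic `*`
  `[c.1.2 - r, c.1.2 + r]%classic `*` `[c.2 - r, c.2 + r]%classic.
Proof.
apply/seteqP; split => -[[x y] z]; case: c => [[cx cy] cz];
  rewrite /cube /= R3_norm_le /= !in_itv/= !ler_distl.
  by move=> /and3P[-> -> ->].
by move=> [[-> ->] ->].
Qed.

Lemma cube_compact c r : compact (cube c r).
Proof. by rewrite cubeE; do 2?apply: compact_setX; exact: segment_compact. Qed.

Lemma cube_measurable c r : measurable (cube c r).
Proof. by rewrite cubeE; do 2?apply: measurableX; exact: measurable_itv. Qed.

(** Rational centres and radii 1/(n+1) suffice. The cubes are closed, hence compact, so that their
    images under the exponential are closed in PSL2; this is how images of open sets become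
    measurable. *)
Lemma open_bigcup_cubes (U : set R3) : open U ->
  exists C : (rat * rat * rat * nat) -> R3 * R,
  U = \bigcup_(i in [set i | cube (C i).1 (C i).2 `<=` U]) cube (C i).1 (C i).2.
Proof.
move=> oU.
exists (fun i => (ratr i.1.1.1, ratr i.1.1.2, ratr i.1.2, i.2.+1%:R^-1)).
apply/seteqP; split => [v Uv|v [i iU iv]]; last exact: iU.
have /nbhs_ballP[e /= e0 vU] := open_nbhs_nbhs (conj oU Uv).
have [n ne] : exists n : nat, (n.+1%:R^-1 : R) < e / 2.
  exists (Num.truncn (e / 2)^-1); rewrite invf_plt ?posrE ?divr_gt0//.
  exact: truncnS_gt.
have n0 : 0 < (n.+1%:R^-1 : R) by rewrite invr_gt0.
have qE (x : R) : {q : rat | `|x - ratr q| <= n.+1%:R^-1}.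
  apply: cid; have [|q] := @rat_in_itvoo R (x - n.+1%:R^-1) (x + n.+1%:R^-1).
    by rewrite ltrD2l gtrN.
  rewrite in_itv/= => /andP[? ?]; exists q; rewrite ltW// distrC ltr_distl.
  by apply/andP.
exists (sval (qE v.1.1), sval (qE v.1.2), sval (qE v.2), n) => /=; last first.
  by rewrite /cube/= R3_norm_le /= !(svalP (qE _)).
move=> w; rewrite /cube/= => h; apply: vU.
rewrite -ball_normE /ball_/=.
set q := (ratr _, _, _) in h; have vq : `|v - q| <= n.+1%:R^-1.
  by rewrite /q R3_norm_le /= !(svalP (qE _)).
rewrite (le_lt_trans (ler_distD q _ _))// [ltRHS]splitr ltrD//.
  exact: le_lt_trans ne.
by rewrite distrC (le_lt_trans h).
Qed.

Lemma open_R3_measurable (U : set R3) : open U -> measurable U.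
Proof.
move=> /open_bigcup_cubes[C ->]; rewrite bigcup_mkcond.
apply: countable_bigcupT_measurable => [|i]; first exact: countableP.
by case: ifP => _ //; exact: cube_measurable.
Qed.

End cube.

(** * Topology and measurability on PSL2 *)

Section topology_PSL2.
Variable R : realType.
Local Notation R3 := (R * R * R)%type.
Local Notation PSL2 := (PSL2 R).

Lemma open_PSL2P (U : set PSL2) : open U <->
  exists2 D : set 'M[R]_2, open D & (forall A : SL2 R, D A <-> U (to_PSL2 A)).
Proof.
split=> [[D oD DU]|[D oD DU]].
  exists D => // A; rewrite -[U _]/((\pi_PSL2 @^-1` U) A) -DU; split => //.
by exists D => //; apply/seteqP; split => A /=; have [] := DU A.
Qed.

Lemma open_PSL2_measurable (U : set PSL2) : open U -> measurable U.
Proof. exact: sub_sigma_algebra. Qed.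

Lemma PSL2_measurable_fun d (T : measurableType d) (f : T -> PSL2) :
  (forall U, open U -> measurable (f @^-1` U)) -> measurable_fun setT f.
Proof.
move=> h; apply: (measurability (@open PSL2)) => // _ [U oU <-].
by rewrite setTI; exact: h.
Qed.

Lemma mx2_continuous (T : topologicalType) (f : T -> 'M[R]_2) :
  (forall i j, continuous (fun x => f x i j)) -> continuous f.
Proof.
move=> cf x; apply/cvgrPdist_le => e e0; near=> y.
apply: mx_norm_le => [|i j]; first exact: ltW.
rewrite !mxE; move: i j; near: y.
apply: filter_forall => i; apply: filter_forall => j.
exact: ((cvgrPdist_le _ _).1 (cf i j x)).
Unshelve. all: by end_near. Qed.

(** Cayley-Hamilton at determinant 1. The inverse is thereby linear in the entries, which makes its
    continuity plain. *)
Lemma SL2val_inv (A : SL2 R) : SL2val (A^-1)%g = (\tr A)%:M - SL2val A.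
Proof.
have : SL2val (A^-1)%g *m A = 1%:M by rewrite mulVmx// SL2_unit.
have dA := det_SL2 A; rewrite det2 in dA.
move=> h; rewrite -[LHS]mulmx1; have <- : A *m ((\tr A)%:M - SL2val A) = 1%:M.
  by apply: mx2P; rewrite mulmx2E !mxE mxtrace2/= ?mulr0n ?mulr1n -?dA; ring.
by rewrite mulmxA h mul1mx.
Qed.

Lemma PSL2_inv_measurable d (T : measurableType d) (f : T -> PSL2) :
  measurable_fun setT f -> measurable_fun setT (fun x => (f x)^-1%g).
Proof.
move=> mf; apply: PSL2_measurable_fun => U oU.
rewrite -[X in measurable X]/(f @^-1` [set x | U (x^-1)%g]) -[X in measurable X]setTI.
apply: mf => //; apply: open_PSL2_measurable.
have [D oD DU] := (open_PSL2P U).1 oU.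
apply/open_PSL2P; exists ((fun A : 'M[R]_2 => (\tr A)%:M - A) @^-1` D).
  have c : continuous (fun A : 'M[R]_2 => (\tr A)%:M - A).
    apply: mx2_continuous => i j.
    have -> : (fun A : 'M[R]_2 => ((\tr A)%:M - A) i j) =
        (fun A => (A 0 0 + A 1 1) * (i == j)%:R - A i j).
      by apply/funext => A; rewrite !mxE mxtrace2 mulr_natr.
    have ce k l : continuous (fun A : 'M[R]_2 => A k l) by exact: coord_continuous.
    move=> A; apply: (@cvgB _ _ _ (nbhs A)); last exact: ce.
    by apply: (@cvgMr_tmp _ _ (nbhs A)); apply: (@cvgD _ _ _ (nbhs A)); exact: ce.
  by move/continuousP : c; exact.
by move=> A; rewrite /= -SL2val_inv DU to_PSL2V.
Qed.

Lemma PSL2_mul_measurable d (T : measurableType d) (f g : T -> PSL2) :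
  measurable_fun setT f -> measurable_fun setT g ->
  measurable_fun setT (fun x => f x * g x)%g.
Proof. exact: measurable_mfun_mul. Qed.

Lemma translate_measurable (g : PSL2) (A : set PSL2) : measurable A ->
  measurable [set (g * x)%g | x in A].
Proof.
move=> mA.
have -> : [set (g * x)%g | x in A] = (fun x => g^-1 * x)%g @^-1` A.
  apply/seteqP; split => [_ [x Ax <-]|x Ax] /=; first by rewrite mulKg.
  by exists (g^-1 * x)%g => //; rewrite mulVKg.
by rewrite -[X in measurable X]setTI; apply: PSL2_mul_measurable.
Qed.

Section coordinates.
Variable b : 3.-tuple 'M[R]_2.
Hypothesis hb : basis_of (sl2 R) b.

Lemma expmx_sl2_of_continuous : continuous (fun v : R3 => expmx (sl2_of b v)).
Proof.
have c1 : continuous (fun v : R3 => v.1.1).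
  by move=> v; apply: (@cvg_comp _ _ _ fst fst); exact: cvg_fst.
have c2 : continuous (fun v : R3 => v.1.2).
  by move=> v; apply: (@cvg_comp _ _ _ fst snd); [exact: cvg_fst|exact: cvg_snd].
have c3 : continuous (fun v : R3 => v.2) by move=> v; exact: cvg_snd.
have cs : continuous (sl2_of b).
  have -> : sl2_of b = fun v => v.1.1 *: b`_0 + v.1.2 *: b`_1 + v.2 *: b`_2.
    by apply/funext => v; rewrite sl2_ofE.
  move=> v; apply: cvgD; first apply: cvgD.
  - by apply: cvgZr_tmp; exact: c1.
  - by apply: cvgZr_tmp; exact: c2.
  - by apply: cvgZr_tmp; exact: c3.
have ce i j : continuous (fun v => sl2_of b v i j).
  by move=> v; apply: (@cvg_comp _ _ _ _ (fun M : 'M[R]_2 => M i j));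
    [exact: cs|exact: coord_continuous].
have cp t : continuous (fun v => par_exp t (- \det (sl2_of b v))).
  move=> v; apply: (@cvg_comp _ _ _ _ (par_exp t)); last exact: continuous_par_exp.
  have -> : (fun v => - \det (sl2_of b v)) = fun v => - (sl2_of b v 0 0 *
      sl2_of b v 1 1 - sl2_of b v 0 1 * sl2_of b v 1 0).
    by apply/funext => w; rewrite det2.
  rewrite det2; apply: cvgN; apply: cvgB; apply: cvgM; exact: ce.
apply: mx2_continuous => i j.
have -> : (fun v => expmx (sl2_of b v) i j) = fun v =>
    par_exp false (- \det (sl2_of b v)) * (i == j)%:R
    + par_exp true (- \det (sl2_of b v)) * sl2_of b v i j.
  by apply/funext => v; rewrite expmx_entry ?tr_sl2_of// mulr_natr.
by move=> v; apply: cvgD; [apply: cvgMr_tmp|apply: cvgM]; [exact: cp|exact: cp|exact: ce].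
Qed.

Lemma PSL2_exp_continuous : continuous (PSL2_exp b).
Proof.
apply/continuousP => U /open_PSL2P[D oD DU].
have -> : PSL2_exp b @^-1` U = (fun v => expmx (sl2_of b v)) @^-1` D.
  apply/seteqP; split => v /=; rewrite -(SL2val_exp hb) /PSL2_exp;
  by have [] := DU (insubd (SL2_one R) (expmx (sl2_of b v))).
by move/continuousP : expmx_sl2_of_continuous; exact.
Qed.

Lemma PSL2_exp_measurable : measurable_fun setT (PSL2_exp b).
Proof.
apply: PSL2_measurable_fun => U oU; apply: open_R3_measurable.
by move/continuousP : PSL2_exp_continuous; exact.
Qed.

(** The preimage in SL2 of the image is given by E and -E, where E, the set of the matrices exp v,
    is compact and so closed in the space of matrices. *)
Lemma PSL2_exp_compact_closed (K : set R3) : compact K ->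
  closed (PSL2_exp b @` K).
Proof.
move=> cK; rewrite -openC.
pose E := (fun v => expmx (sl2_of b v)) @` K.
have cE : compact E.
  apply: continuous_compact => //; apply: continuous_subspaceT.
  exact: expmx_sl2_of_continuous.
have clE : closed E by apply: compact_closed => //; exact: norm_hausdorff.
apply/open_PSL2P; exists (~` E `&` (fun A => - A) @^-1` (~` E)).
  apply: openI; first by rewrite openC.
  by move/continuousP : (@opp_continuous 'M[R]_2); apply; rewrite openC.
move=> A; split => /=.
  move=> [E1 E2] [v Kv /to_PSL2P/orP[/eqP vA|/eqP vA]].
    by apply: E1; exists v => //; rewrite -vA SL2val_exp.
  by apply: E2; exists v => //; rewrite -(SL2val_exp hb) vA.
move=> nE; split => -[v Kv vA]; apply: nE; exists v => //; apply/to_PSL2P.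
  by apply/orP; left; apply/eqP/val_inj; rewrite [LHS]SL2val_exp.
by apply/orP; right; apply/eqP/val_inj; rewrite [LHS]SL2val_exp.
Qed.

Lemma PSL2_exp_compact_measurable (K : set R3) : compact K ->
  measurable (PSL2_exp b @` K).
Proof.
move=> /PSL2_exp_compact_closed clK; rewrite -[X in measurable X]setCK.
by apply: measurableC; apply: open_PSL2_measurable; rewrite openC.
Qed.

Lemma PSL2_exp_open_measurable (U : set R3) : open U ->
  measurable (PSL2_exp b @` U).
Proof.
move=> /open_bigcup_cubes[C ->]; rewrite image_bigcup bigcup_mkcond.
apply: countable_bigcupT_measurable => [|i]; first exact: countableP.
by case: ifP => _ //; apply: PSL2_exp_compact_measurable; exact: cube_compact.
Qed.

Section log.
Variable V : set R3.
Hypothesis hV : is_log_domain b V.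

Lemma PSL2_expK v : V v -> PSL2_log b V (PSL2_exp b v) = v.
Proof.
have [_ _ injV _] := hV => Vv; rewrite /PSL2_log.
have [Vw] : [set v0 | V v0 /\ PSL2_exp b v0 = PSL2_exp b v]
    (xget 0 [set v0 | V v0 /\ PSL2_exp b v0 = PSL2_exp b v]).
  by apply: (@xgetPex _ 0); exists v.
by apply: injV; rewrite inE.
Qed.

Lemma PSL2_log_notin x : ~ (PSL2_exp b @` V) x -> PSL2_log b V x = 0.
Proof. by move=> nx; apply: xgetPN => v [Vv vx]; apply: nx; exists v. Qed.

(** Off its domain the logarithm has the default value 0, so the preimage gains the whole complement
    of the domain exactly when U contains 0. *)
Lemma PSL2_log_preimage (U : set R3) : open U ->
  measurable (PSL2_log b V @^-1` U).
Proof.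
have [oV V0 _ _] := hV => oU.
have mV : measurable (PSL2_exp b @` V) by exact: PSL2_exp_open_measurable.
have -> : PSL2_log b V @^-1` U = PSL2_exp b @` (U `&` V) `|`
    (if pselect (U 0) then ~` (PSL2_exp b @` V) else set0).
  apply/seteqP; split => [x /= Ux|x /= [[v [Uv Vv] <-]|]].
  - have [[v Vv vx]|nx] := pselect ((PSL2_exp b @` V) x).
      by left; exists v => //; split => //; rewrite -(PSL2_expK Vv) vx.
    right; rewrite PSL2_log_notin// in Ux.
    by case: (pselect (U 0)).
  - by rewrite PSL2_expK.
  - by case: (pselect (U 0)) => // U0 nx; rewrite PSL2_log_notin.
apply: measurableU; first by apply: PSL2_exp_open_measurable; exact: openI.
by case: (pselect (U 0)) => h /=; [exact: measurableC|exact: measurable0].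
Qed.

Lemma R3_coord_continuous (i : 'I_3) : continuous (@R3_coord R i).
Proof.
case: i => -[|[|[|//]]] ? v.
- by apply: (@cvg_comp _ _ _ fst fst); exact: cvg_fst.
- by apply: (@cvg_comp _ _ _ fst snd); [exact: cvg_fst|exact: cvg_snd].
- exact: cvg_snd.
Qed.

Lemma PSL2_log_measurable (i : 'I_3) :
  measurable_fun setT (fun x => R3_coord i (PSL2_log b V x)).
Proof.
apply: (measurability _ (measurable_realfun.RGenOInfty.measurableE R)) => /= _ [_ [a ->] <-].
rewrite setTI -[X in measurable X]/(PSL2_log b V @^-1` (R3_coord i @^-1` _)).
apply: PSL2_log_preimage.
by have /continuousP := @R3_coord_continuous i; apply; exact: itv_open_ends_open.
Qed.

End log.
End coordinates.
End topology_PSL2.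

(** * Riemannian balls *)

Section path_existence.
Variable R : realType.

Definition upper_mx (p : R) : 'M[R]_2 := 1%:M + p *: delta_mx 0 1.
Definition lower_mx (p : R) : 'M[R]_2 := 1%:M + p *: delta_mx 1 0.

Fact det_upper_mx p : \det (upper_mx p) == 1.
Proof. by rewrite det2 !mxE/=; apply/eqP; ring. Qed.

Fact det_lower_mx p : \det (lower_mx p) == 1.
Proof. by rewrite det2 !mxE/=; apply/eqP; ring. Qed.

Definition SL2_upper p : SL2 R := MkSL2 (det_upper_mx p).
Definition SL2_lower p : SL2 R := MkSL2 (det_lower_mx p).

(** Three shears reach every matrix of determinant 1 whose lower left entry is nonzero. The fourth
    makes this entry nonzero, and s = 0 or s = 1 will do. *)
Lemma SL2_decomposition (A : SL2 R) : exists p q r s,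
  A = (SL2_upper p * SL2_lower q * SL2_upper r * SL2_lower s)%g.
Proof.
have dA := det_SL2 A; rewrite det2 in dA.
have [s s0] : exists s, A 1 0 - A 1 1 * s != 0.
  have [c0|c0] := eqVneq (A 1 0) 0.
    exists 1; rewrite c0 mulr1 sub0r oppr_eq0; apply/negP => /eqP d0.
    by move/eqP: dA; rewrite c0 d0 !mulr0 subr0 eq_sym oner_eq0.
  by exists 0; rewrite mulr0 subr0.
set q := A 1 0 - A 1 1 * s in s0.
exists ((A 0 0 - A 0 1 * s - 1) / q), q, ((A 1 1 - 1) / q), s.
have E10 : A 1 0 = q + A 1 1 * s by rewrite /q subrK.
have E01 : A 0 1 = ((A 0 0 - A 0 1 * s) * A 1 1 - 1) / q.
  by apply: (mulIf s0); rewrite mulfVK// /q; lra.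
have E00 : A 0 0 = (A 0 0 - A 0 1 * s) + A 0 1 * s by rewrite subrK.
apply: val_inj; move: (A 0 0 - A 0 1 * s) E00 E01 => a E00 E01.
clearbody q; apply: mx2P; rewrite /= !mulmx2E !mxE/=.
- by rewrite E00 E01; field.
- by rewrite E01; field.
- by rewrite E10; field.
- by field.
Qed.

(** Scaling all four shears by t joins 1 to any element of SL2 by a curve with polynomial
    entries. *)
Definition polynomial_curve (p q r s : R) (t : R) : SL2 R :=
  (SL2_upper (p * t) * SL2_lower (q * t) * SL2_upper (r * t) * SL2_lower (s * t))%g.

Lemma polynomial_curve_entry p q r s i j :
  exists P : {poly R}, (fun t => polynomial_curve p q r s t i j) = horner P.
Proof.
pose U (a : R) : 'M[{poly R}]_2 := 1%:M + (a *: 'X) *: delta_mx 0 1.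
pose L (a : R) : 'M[{poly R}]_2 := 1%:M + (a *: 'X) *: delta_mx 1 0.
exists ((U p *m L q *m U r *m L s) i j); apply/funext => t.
have Ut a : map_mx (horner_eval t) (U a) = upper_mx (a * t).
  by apply: mx2P; rewrite !mxE/= /horner_eval ?mulr0n ?mulr1n !hornerE ?mulr0 ?mulr1 ?addr0 ?add0r.
have Lt a : map_mx (horner_eval t) (L a) = lower_mx (a * t).
  by apply: mx2P; rewrite !mxE/= /horner_eval ?mulr0n ?mulr1n !hornerE ?mulr0 ?mulr1 ?addr0 ?add0r.
have ME (M : 'M[{poly R}]_2) : (M i j).[t] = map_mx (horner_eval t) M i j.
  by rewrite mxE.
by rewrite ME !map_mxM/= !Ut !Lt.
Qed.

Lemma polynomial_curve_C1 p q r s : is_C1_curve (polynomial_curve p q r s).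
Proof.
have dg t : derivable (@SL2val R \o polynomial_curve p q r s) t 1.
  apply/derivable_mxP => i j; have [P PE] := polynomial_curve_entry p q r s i j.
  by rewrite /= [X in derivable X]PE; exact: derivable_horner.
split; first exact: dg.
apply: mx2_continuous => i j.
have [P PE] := polynomial_curve_entry p q r s i j.
have -> : (fun t => derive1 (@SL2val R \o polynomial_curve p q r s) t i j) =
    horner P^`().
  apply/funext => t; rewrite derive1E derive_mx// mxE.
  by rewrite derivE derive1E -PE.
exact: continuous_horner.
Qed.

(* Without it [PSL2_dist] could be the junk value [inf set0 = 0], and balls would
   not be small. *)
Lemma PSL2_connected (x : PSL2 R) : exists gamma : R -> SL2 R,
  [/\ is_C1_curve gamma, to_PSL2 (gamma 0) = 1%g & to_PSL2 (gamma 1) = x].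
Proof.
have [p [q [r [s A]]]] := SL2_decomposition (repr x).
exists (polynomial_curve p q r s); split; first exact: polynomial_curve_C1.
  rewrite -[RHS]/(to_PSL2 1%g); congr to_PSL2; apply: val_inj.
  by rewrite /= !mulr0 /upper_mx /lower_mx !scale0r !addr0 !mulmx1.
by rewrite /polynomial_curve !mulr1 -A to_PSL2_repr.
Qed.

End path_existence.

Section inner_product.
Variables (R : realType) (ip : 'M[R]_2 -> 'M[R]_2 -> R).
Hypothesis hip : is_inner_product ip.
Local Notation R3 := (R * R * R)%type.

Definition sl2_mx (v : R3) : 'M[R]_2 :=
  v.1.1 *: (delta_mx 0 0 - delta_mx 1 1) + v.1.2 *: delta_mx 0 1
  + v.2 *: delta_mx 1 0.

Lemma sl2_mxE X : \tr X = 0 -> X = sl2_mx (X 0 0, X 0 1, X 1 0).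
Proof.
rewrite mxtrace2 => /eqP; rewrite addrC addr_eq0 => /eqP X1.
by apply: mx2P; rewrite !mxE/= ?X1; ring.
Qed.

Lemma sl2_mx_in v : sl2_mx v \in sl2 R.
Proof. by rewrite sl2P mxtrace2 !mxE/=; apply/eqP; ring. Qed.

(** The quadratic form of [ip] in the standard basis H, E, F of sl2. The axioms on [ip] are
    algebraic, so continuity is obtained from this explicit polynomial. *)
Definition ip_form (v : R3) : R :=
  let H := sl2_mx (1, 0, 0) in let E := sl2_mx (0, 1, 0) in
  let F := sl2_mx (0, 0, 1) in
  v.1.1 ^+ 2 * ip H H + v.1.2 ^+ 2 * ip E E + v.2 ^+ 2 * ip F F
  + 2 * (v.1.1 * v.1.2) * ip H E + 2 * (v.1.1 * v.2) * ip H F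
  + 2 * (v.1.2 * v.2) * ip E F.

Lemma ip_formE v : ip (sl2_mx v) (sl2_mx v) = ip_form v.
Proof.
have [ips ipl _] := hip; rewrite /ip_form.
set H := sl2_mx (1, 0, 0); set E := sl2_mx (0, 1, 0); set F := sl2_mx (0, 0, 1).
have Hs : H \in sl2 R by exact: sl2_mx_in.
have Es : E \in sl2 R by exact: sl2_mx_in.
have Fs : F \in sl2 R by exact: sl2_mx_in.
have s0 : (0 : 'M[R]_2) \in sl2 R by rewrite mem0v.
have ip0 Z : Z \in sl2 R -> ip 0 Z = 0.
  move=> Zs; have := ipl (-1) 0 0 Z s0 s0 Zs.
  by rewrite scaler0 addr0 mulN1r addNr.
have dec : sl2_mx v = v.1.1 *: H + (v.1.2 *: E + (v.2 *: F + 0)).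
  by apply: mx2P; rewrite !mxE/=; ring.
have Zs x : x *: F + 0 \in sl2 R by rewrite memvD ?memvZ.
have Ys x y : y *: E + (x *: F + 0) \in sl2 R by rewrite memvD ?memvZ.
have vs : sl2_mx v \in sl2 R by exact: sl2_mx_in.
have expand Z : Z \in sl2 R ->
    ip (sl2_mx v) Z = v.1.1 * ip H Z + v.1.2 * ip E Z + v.2 * ip F Z.
  by move=> Zin; rewrite dec !ipl// ip0// addr0 !addrA.
rewrite expand// !(ips _ (sl2_mx v))// !expand//.
rewrite (ips E H)// (ips F H)// (ips F E)//; ring.
Qed.

Lemma ip_form_continuous : continuous ip_form.
Proof.
have c1 : continuous (fun v : R3 => v.1.1).
  by move=> v; apply: (@cvg_comp _ _ _ fst fst); exact: cvg_fst.
have c2 : continuous (fun v : R3 => v.1.2).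
  by move=> v; apply: (@cvg_comp _ _ _ fst snd); [exact: cvg_fst|exact: cvg_snd].
have c3 : continuous (fun v : R3 => v.2) by move=> v; exact: cvg_snd.
move=> v; rewrite /ip_form/=; do 5?apply: cvgD; apply: cvgMr_tmp.
- by apply: cvgM; exact: c1.
- by apply: cvgM; exact: c2.
- by apply: cvgM; exact: c3.
- by apply: cvgMl_tmp; apply: cvgM; [exact: c1|exact: c2].
- by apply: cvgMl_tmp; apply: cvgM; [exact: c1|exact: c3].
- by apply: cvgMl_tmp; apply: cvgM; [exact: c2|exact: c3].
Qed.

Lemma ip_formZ a v : ip_form (a *: v) = a ^+ 2 * ip_form v.
Proof.
case: v => [[x y] z]; have -> : a *: (x, y, z) = (a * x, a * y, a * z) by [].
by rewrite /ip_form/=; ring.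
Qed.

(** The quadratic form attains a positive minimum on the compact unit sphere of the maximum norm;
    homogeneity does the rest. *)
Lemma ip_ge : exists2 c : R, 0 < c &
  forall X, \tr X = 0 -> c * `|X| <= Num.sqrt (ip X X).
Proof.
pose S : set R3 := [set v | `|v| = 1].
have cS : compact S.
  apply: (@subclosed_compact _ _ (cube 0 1)); last 2 first.
  - exact: cube_compact.
  - by move=> v; rewrite /S /cube/= subr0 => ->.
  have -> : S = (fun v : R3 => `|v|) @^-1` [set (1 : R)] by [].
  by apply: closed_comp => [v _|]; [exact: norm_continuous|exact: closed_eq].
have S0 : S !=set0.
  by exists (1, 0, 0); rewrite /S/= R3_normE/= normr0 normr1 !max_l.
have [v vS vmin] := compact_EVT_min S0 cS (continuous_subspaceT ip_form_continuous).
rewrite inE /S/= in vS.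
have m0 : 0 < ip_form v.
  rewrite -ip_formE; apply: (ip_gt0 hip); first exact: sl2_mx_in.
  apply/eqP => /matrixP v0; move: vS; case: v v0 {vmin} => [[x y] z] v0.
  have -> : x = 0 by have := v0 0 0; rewrite !mxE/=; lra.
  have -> : y = 0 by have := v0 0 1; rewrite !mxE/=; lra.
  have -> : z = 0 by have := v0 1 0; rewrite !mxE/=; lra.
  by rewrite R3_normE/= normr0 !maxxx => /eqP; rewrite eq_sym oner_eq0.
exists (Num.sqrt (ip_form v)); first by rewrite sqrtr_gt0.
move=> X trX; have [->|X0] := eqVneq X 0; first by rewrite normr0 mulr0 sqrtr_ge0.
have nX : 0 < `|X| by rewrite normr_gt0.
rewrite (sl2_mxE trX) ip_formE; set w := (_, _, _).
have wX : `|w| = `|X|.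
  apply/eqP; rewrite eq_le R3_norm_le !mx_entry_norm/=; apply: mx_norm_le => //.
  have := trX; rewrite mxtrace2 => /eqP; rewrite addrC addr_eq0 => /eqP X1.
  have := lexx `|w|; rewrite {1}R3_norm_le => /and3P[h1 h2 h3].
  by apply: ord2P; apply: ord2P => //; rewrite X1 normrN.
rewrite -(sl2_mxE trX) -wX.
have w0 : 0 < `|w| by rewrite wX.
have /vmin : `|w|^-1 *: w \in S.
  by rewrite inE /S/= normrZ gtr0_norm ?invr_gt0// mulVf// gt_eqF.
rewrite ip_formZ exprVn mulrC ler_pdivlMr ?exprn_gt0// => h.
have -> : Num.sqrt (ip_form v) * `|w| = Num.sqrt (ip_form v * `|w| ^+ 2).
  by rewrite sqrtrM ?ltW// sqrtr_sqr normr_id.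
by rewrite ler_wsqrtr.
Qed.

Section curve.
Variable gamma : R -> SL2 R.
Hypothesis hg : is_C1_curve gamma.

Definition curve_entry (i j : 'I_2) (t : R) : R := SL2val (gamma t) i j.
Definition curve_entry' (i j : 'I_2) (t : R) : R :=
  derive1 (@SL2val R \o gamma) t i j.
Local Notation g := curve_entry.
Local Notation g' := curve_entry'.

Lemma curve_entry_derive i j (t : R) : is_derive t 1 (g i j) (g' i j t).
Proof.
have [dg _] := hg; have := dg t => /[dup] /derivable_mxP dgt dt.
by split; [exact: dgt|rewrite /curve_entry' derive1E derive_mx// mxE].
Qed.

Lemma curve_entry_continuous i j : continuous (g i j).
Proof.
move=> t; apply/differentiable_continuous/derivable1_diffP.
by have [] := curve_entry_derive i j t.
Qed.

Lemma curve_entry'_continuous i j : continuous (g' i j).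
Proof.
have [_ cg] := hg => t.
apply: (@cvg_comp _ _ _ _ (fun M : 'M[R]_2 => M i j)); first exact: cg.
exact: coord_continuous.
Qed.

Definition velocity t : 'M[R]_2 := invmx (gamma t) *m derive1 (@SL2val R \o gamma) t.

Lemma velocityE i j t : velocity t i j =
  (\tr (gamma t) *+ (i == 0) - g i 0 t) * g' 0 j t
  + (\tr (gamma t) *+ (i == 1) - g i 1 t) * g' 1 j t.
Proof.
rewrite /velocity -[invmx _]/(SL2val (gamma t)^-1%g) SL2val_inv mulmx2E.
by rewrite !mxE.
Qed.

Lemma velocity_continuous i j : continuous (velocity ^~ i ^~ j).
Proof.
have E : velocity ^~ i ^~ j = fun t =>
    ((g 0 0 t + g 1 1 t) * (i == 0)%:R - g i 0 t) * g' 0 j t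
    + ((g 0 0 t + g 1 1 t) * (i == 1)%:R - g i 1 t) * g' 1 j t.
  by apply/funext => t; rewrite velocityE mxtrace2 !mulr_natr.
rewrite E => t.
have cg k l : g k l x @[x --> t] --> g k l t by exact: curve_entry_continuous.
have cg' k l : g' k l x @[x --> t] --> g' k l t by exact: curve_entry'_continuous.
apply: cvgD; apply: cvgM; [|exact: cg'| |exact: cg'].
  by apply: cvgB; [apply: cvgMr_tmp; apply: cvgD|]; exact: cg.
by apply: cvgB; [apply: cvgMr_tmp; apply: cvgD|]; exact: cg.
Qed.

(** The trace of gamma^-1 gamma' is the derivative of det gamma, which is constant. *)
Lemma tr_velocity t : \tr (velocity t) = 0.
Proof.
have dt : is_derive t 1 (fun t => g 0 0 t * g 1 1 t - g 0 1 t * g 1 0 t)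
   (g 0 0 t * g' 1 1 t + g' 0 0 t * g 1 1 t - (g 0 1 t * g' 1 0 t + g' 0 1 t * g 1 0 t)).
  have := curve_entry_derive; move=> h.
  apply: is_deriveB; apply: is_derive_eq (is_deriveM (h _ _ _) (h _ _ _)) _.
    by rewrite /GRing.scale/=; ring.
  by rewrite /GRing.scale/=; ring.
have : (fun t => g 0 0 t * g 1 1 t - g 0 1 t * g 1 0 t) = cst 1.
  by apply/funext => x; rewrite -det2 det_SL2.
move=> E; move: dt; rewrite E => -[_]; rewrite derive_cst => E0.
rewrite mxtrace2 !velocityE mxtrace2/= ?mulr0n ?mulr1n -/(curve_entry _ _ _).
by move: E0; rewrite /curve_entry; lra.
Qed.

Lemma curve_speed_continuous : continuous (curve_speed ip gamma).
Proof.
move=> t; apply: (@cvg_comp _ _ _ _ Num.sqrt); last exact: sqrt_continuous.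
pose v s : R3 := (velocity s 0 0, velocity s 0 1, velocity s 1 0).
have E s : ip (velocity s) (velocity s) = ip_form (v s).
  by rewrite (sl2_mxE (tr_velocity s)) ip_formE.
have cv : continuous v.
  move=> s; have h i j : velocity x i j @[x --> s] --> velocity s i j.
    exact: velocity_continuous.
  exact: (cvg_pair (cvg_pair (h 0 0) (h 0 1)) (h 1 0)).
have -> : (fun s => ip (velocity s) (velocity s)) = ip_form \o v.
  by apply/funext => s; rewrite E.
by rewrite E; exact: (continuous_comp (cv t) (@ip_form_continuous (v t))).
Qed.

(* The term [e ^+ 2] makes the square root of [curve_sqdist] differentiable. *)
Definition curve_sqdist (s e t : R) : R :=
  \sum_(i < 2) \sum_(j < 2) (g i j t - s *+ (i == j)) ^+ 2 + e ^+ 2.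
Definition curve_sqdist' (s t : R) : R :=
  \sum_(i < 2) \sum_(j < 2) 2 * (g i j t - s *+ (i == j)) * g' i j t.

Local Notation F := curve_sqdist.
Local Notation F' := curve_sqdist'.

Lemma sum2E (f : 'I_2 -> R) : \sum_(i < 2) f i = f 0 + f 1.
Proof.
rewrite !big_ord_recl big_ord0 addr0.
by rewrite (_ : lift ord0 ord0 = 1)//; exact: val_inj.
Qed.

Lemma curve_sqdist_derive (s e t : R) : is_derive t 1 (F s e) (F' s t).
Proof.
have := curve_entry_derive; move=> h.
have h2 i j : is_derive t 1 (fun t => (g i j t - s *+ (i == j)) ^+ 2)
    (2 * (g i j t - s *+ (i == j)) * g' i j t).
  have hc : is_derive t 1 (fun t => g i j t - s *+ (i == j)) (g' i j t).
    by rewrite -[X in is_derive _ _ _ X]subr0; apply: is_deriveB.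
  under eq_fun do rewrite expr2.
  by apply: is_derive_eq (is_deriveM hc hc) _; rewrite /GRing.scale/=; ring.
have E : F s e = (fun t => (g 0 0 t - s *+ (0%R == 0%R :> 'I_2)) ^+ 2
    + (g 0 1 t - s *+ (0%R == 1%R :> 'I_2)) ^+ 2
    + ((g 1 0 t - s *+ (1%R == 0%R :> 'I_2)) ^+ 2
    + (g 1 1 t - s *+ (1%R == 1%R :> 'I_2)) ^+ 2) + e ^+ 2).
  by apply/funext => x; rewrite /curve_sqdist !sum2E.
have E' : F' s t = 2 * (g 0 0 t - s *+ (0%R == 0%R :> 'I_2)) * g' 0 0 t
    + 2 * (g 0 1 t - s *+ (0%R == 1%R :> 'I_2)) * g' 0 1 t
    + (2 * (g 1 0 t - s *+ (1%R == 0%R :> 'I_2)) * g' 1 0 t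
    + 2 * (g 1 1 t - s *+ (1%R == 1%R :> 'I_2)) * g' 1 1 t) + 0.
  by rewrite /curve_sqdist' !sum2E addr0.
by rewrite E E'; do 3?apply: is_deriveD.
Qed.

Lemma curve_sqdist'_continuous (s : R) : continuous (F' s).
Proof.
have E : F' s = (fun t => 2 * (g 0 0 t - s *+ (0%R == 0%R :> 'I_2)) * g' 0 0 t
    + 2 * (g 0 1 t - s *+ (0%R == 1%R :> 'I_2)) * g' 0 1 t
    + (2 * (g 1 0 t - s *+ (1%R == 0%R :> 'I_2)) * g' 1 0 t
    + 2 * (g 1 1 t - s *+ (1%R == 1%R :> 'I_2)) * g' 1 1 t)).
  by apply/funext => t; rewrite /curve_sqdist' !sum2E.
rewrite E => t.
have h i j : 2 * (g i j x - s *+ (i == j)) * g' i j x @[x --> t] -->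
    2 * (g i j t - s *+ (i == j)) * g' i j t.
  apply: cvgM; last exact: curve_entry'_continuous.
  apply: cvgMl_tmp; apply: cvgB; first exact: curve_entry_continuous.
  exact: cvg_cst.
by apply: cvgD; apply: cvgD; exact: h.
Qed.

Lemma entry_le_curve_sqdist (s e : R) i j (t : R) :
  `|g i j t - s *+ (i == j)| <= Num.sqrt (F s e t).
Proof.
rewrite -sqrtr_sqr ler_wsqrtr// /curve_sqdist.
rewrite (bigD1 i)//= (bigD1 j)//= -!addrA lerDl !addr_ge0 ?sqr_ge0//.
  by apply: sumr_ge0 => k _; exact: sqr_ge0.
by apply: sumr_ge0 => k _; apply: sumr_ge0 => l _; exact: sqr_ge0.
Qed.

Lemma curve_sqdist_gt0 (s e t : R) : 0 < e -> 0 < F s e t.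
Proof.
move=> e0; rewrite /curve_sqdist ltr_wpDl ?exprn_gt0//.
by apply: sumr_ge0 => k _; apply: sumr_ge0 => l _; exact: sqr_ge0.
Qed.

(** Let V be the velocity and S the square root of [curve_sqdist]. As gamma' = gamma V and the
    entries of gamma are at most 1 + S, each of the four terms is at most 2 S times 2 (1 + S)
    |V|. *)
Lemma curve_sqdist'_le (s e t : R) : `|s| = 1 -> 0 < e -> `|F' s t| <=
  16 * (Num.sqrt (F s e t) * (1 + Num.sqrt (F s e t))) * `|velocity t|.
Proof.
move=> s1 e0; set S := Num.sqrt _; have S0 : 0 <= S by exact: sqrtr_ge0.
have gS i j : `|g i j t| <= 1 + S.
  rewrite -(subrK (s *+ (i == j)) (g i j t)) addrC (le_trans (ler_normD _ _))//.
  by rewrite lerD ?entry_le_curve_sqdist//; case: eqP => _; rewrite ?mulr1n ?s1 ?mulr0n ?normr0.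
have gE : derive1 (@SL2val R \o gamma) t = gamma t *m velocity t.
  by rewrite /velocity mulmxA mulmxV ?mul1mx// SL2_unit.
have g'S i j : `|g' i j t| <= 2 * (1 + S) * `|velocity t|.
  rewrite /curve_entry' gE mulmx2E (le_trans (ler_normD _ _))// !normrM.
  have h k := ler_pM (normr_ge0 _) (normr_ge0 _) (gS i k) (mx_entry_norm (velocity t) k j).
  by have := h 0; have := h 1; rewrite /curve_entry; lra.
rewrite /curve_sqdist' !sum2E.
have h i j : `|2 * (g i j t - s *+ (i == j)) * g' i j t| <=
    4 * (S * (1 + S) * `|velocity t|).
  rewrite -mulrA normrM normrM ger0_norm//.
  have := ler_pM (normr_ge0 _) (normr_ge0 _) (entry_le_curve_sqdist s e i j t) (g'S i j).
  by rewrite -/S; lra.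
rewrite (le_trans (ler_normD _ _))//.
have := ler_normD (2 * (g 0 0 t - s *+ (0%R == 0%R :> 'I_2)) * g' 0 0 t)
   (2 * (g 0 1 t - s *+ (0%R == 1%R :> 'I_2)) * g' 0 1 t).
have := ler_normD (2 * (g 1 0 t - s *+ (1%R == 0%R :> 'I_2)) * g' 1 0 t)
   (2 * (g 1 1 t - s *+ (1%R == 1%R :> 'I_2)) * g' 1 1 t).
have := h 0 0; have := h 0 1; have := h 1 0; have := h 1 1; lra.
Qed.

(** A Gronwall argument: the derivative of ln (1 + sqrt F) is at most 8 |V|, hence at most 8 / c
    times the speed, so this function grows by at most 8 e / c along the curve. It starts at ln (1 +
    e), since [e] is both the bound on the length and the regularization inside F. *)
Lemma curve_length_ge (c s e : R) : 0 < c ->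
  (forall X : 'M[R]_2, \tr X = 0 -> c * `|X| <= Num.sqrt (ip X X)) ->
  `|s| = 1 -> SL2val (gamma 0) = s%:M -> 0 < e -> curve_length ip gamma < e ->
  `|SL2val (gamma 1) - s%:M| <= (1 + e) * expR (8 / c * e) - 1.
Proof.
move=> c0 hc s1 g0 e0 ge.
pose Phi (t : R) : R := ln (1 + Num.sqrt (F s e t)).
pose phi (t : R) : R := (1 + Num.sqrt (F s e t))^-1 * ((2 * Num.sqrt (F s e t))^-1 * F' s t).
have sF t : 0 < Num.sqrt (F s e t) by rewrite sqrtr_gt0 curve_sqdist_gt0.
have sF1 t : 0 < 1 + Num.sqrt (F s e t) by rewrite addr_gt0.
have dPhi (t : R) : is_derive t 1 Phi (phi t).
  apply: (@is_derive1_comp _ (@ln R) (fun t => 1 + Num.sqrt (F s e t))).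
    exact: is_derive1_ln.
  rewrite -[X in is_derive _ _ _ X]add0r; apply: is_deriveD.
  apply: (@is_derive1_comp _ Num.sqrt (F s e)); last exact: curve_sqdist_derive.
  by apply: is_derive1_sqrt; exact: curve_sqdist_gt0.
have cPhi : continuous Phi.
  move=> t; apply/differentiable_continuous/derivable1_diffP.
  by have [] := dPhi t.
have cF : continuous (F s e).
  move=> t; apply/differentiable_continuous/derivable1_diffP.
  by have [] := curve_sqdist_derive s e t.
have csF : continuous (fun t => Num.sqrt (F s e t)).
  by move=> t; apply: (@cvg_comp _ _ _ (F s e)); [exact: cF|exact: sqrt_continuous].
have cphi : continuous phi.
  move=> t; apply: cvgM.
    apply: cvgV; first by rewrite gt_eqF.
    by apply: cvgD; [exact: cvg_cst|exact: csF].
  apply: cvgM; last exact: curve_sqdist'_continuous.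
  apply: cvgV; first by rewrite gt_eqF// mulr_gt0.
  by apply: cvgMl_tmp; exact: csF.
have FTC : (\int[lebesgue_measure]_(t in `[0%R, 1%R]) (phi t)%:E =
    (Phi 1)%:E - (Phi 0)%:E)%E.
  apply: continuous_FTC2 => //; first exact: continuous_subspaceT.
    split; first by move=> t _; have [] := dPhi t.
      by apply: cvg_at_right_filter; exact: cPhi.
    by apply: cvg_at_left_filter; exact: cPhi.
  by move=> t _; have [_ <-] := dPhi t; rewrite derive1E.
have cI (f : R -> R) : continuous f ->
    lebesgue_measure.-integrable `[0%R, 1%R] (EFin \o f).
  move=> cf; apply: continuous_compact_integrable; first exact: segment_compact.
  exact: continuous_subspaceT.
have cS := curve_speed_continuous.
have le : Phi 1 - Phi 0 <= 8 / c * curve_length ip gamma.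
  rewrite -RintegralZl//; last exact: cI.
  have -> : Phi 1 - Phi 0 = (\int[lebesgue_measure]_(t in `[0%R, 1%R]) phi t)%R.
    by rewrite /Rintegral FTC.
  apply: le_Rintegral => //; first exact: cI.
    by apply: (cI (fun t => 8 / c * curve_speed ip gamma t)) => t; apply: cvgMl_tmp; exact: cS.
  move=> t _; rewrite (le_trans (ler_norm _))//.
  have sF2 : 0 < 2 * Num.sqrt (F s e t) by rewrite mulr_gt0.
  rewrite /phi normrM normfV normrM normfV (gtr0_norm (sF1 t)) (gtr0_norm sF2).
  rewrite ler_pdivrMl// ler_pdivrMl ?mulr_gt0//.
  rewrite (le_trans (curve_sqdist'_le t s1 e0))//.
  have := hc _ (tr_velocity t); rewrite -/(curve_speed ip gamma t).
  have := sF t; have := sF1 t; move: (Num.sqrt (F s e t)) => S S1 S0 h.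
  have -> : 2 * S * ((1 + S) * (8 / c * curve_speed ip gamma t)) =
     16 * (S * (1 + S)) * (curve_speed ip gamma t / c) by field; rewrite gt_eqF.
  rewrite ler_pM2l ?mulr_gt0// ler_pdivlMr// mulrC; exact: h.
have Phi0 : Phi 0 = ln (1 + e).
  rewrite /Phi /curve_sqdist big1 => [|i _]; last first.
    by rewrite big1// => j _; rewrite /curve_entry g0 mxE subrr expr0n.
  by rewrite add0r sqrtr_sqr gtr0_norm.
have Phi1 : 1 + Num.sqrt (F s e 1) <= (1 + e) * expR (8 / c * e).
  have e1 : 0 < 1 + e by rewrite addr_gt0.
  have -> : 1 + Num.sqrt (F s e 1) = expR (Phi 1) by rewrite /Phi lnK ?posrE.
  have -> : (1 + e) * expR (8 / c * e) = expR (Phi 0 + 8 / c * e).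
    by rewrite expRD Phi0 lnK ?posrE.
  rewrite ler_expR -lerBlDl (le_trans le)// ler_pM2l ?divr_gt0//; exact: ltW.
apply: mx_norm_le => [|i j].
  have := sF 1; lra.
rewrite !mxE (le_trans (entry_le_curve_sqdist s e i j 1))//; lra.
Qed.

End curve.

Lemma expR_le_1Dx_expR (x : R) : expR x <= 1 + x * expR x.
Proof.
have := expR_ge1Dx (- x); rewrite expRN => h.
have e0 := expR_gt0 x; have := ler_wpM2r (ltW e0) h.
rewrite mulVf ?gt_eqF//; lra.
Qed.

(** A distance below e is witnessed by a curve of length below e. If its lift starts at -1 instead
    of 1, the opposite of its endpoint is the lift sought. The constant comes from (1 + e)(1 + M e)
    - 1 <= (1 + 2 M) e for e <= 1. *)
Lemma PSL2_ball_lift : exists2 K : R, 1 <= K &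
  forall e x, 0 < e -> e <= 1 -> PSL2_ball ip 1%g e x ->
  exists2 A : SL2 R, to_PSL2 A = x & `|SL2val A - 1| <= K * e.
Proof.
have [c c0 hc] := ip_ge; have c8 : 0 < 8 / c by rewrite divr_gt0.
pose M := 8 / c * expR (8 / c).
have M0 : 0 <= M by rewrite mulr_ge0 ?expR_ge0// ltW.
exists (1 + 2 * M); first by rewrite lerDl mulr_ge0.
move=> e x e0 e1 /inf_lt[].
  have [gamma [g1 g2 g3]] := PSL2_connected x.
  by exists (curve_length ip gamma); exists gamma.
move=> _ [gamma [g1 /to_PSL2P g2 g3] <-] ge.
have [s s1 g0] : exists2 s : R, `|s| = 1 & SL2val (gamma 0) = s%:M.
  case/orP: g2 => /eqP ->; first by exists 1; rewrite ?normr1.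
  by exists (-1); rewrite ?normrN1//= raddfN.
have h := curve_length_ge g1 c0 hc s1 g0 e0 ge.
have {}h : `|SL2val (gamma 1) - s%:M| <= (1 + 2 * M) * e.
  rewrite (le_trans h)//; have := expR_le_1Dx_expR (8 / c * e).
  have : expR (8 / c * e) <= expR (8 / c) by rewrite ler_expR ler_piMr// ltW.
  have y0 : 0 <= 8 / c * e by rewrite mulr_ge0// ltW.
  move=> h1 h2; have h3 := ler_wpM2l y0 h1; rewrite -/M in h3.
  have {}h3 : expR (8 / c * e) <= 1 + M * e by rewrite /M; lra.
  have : (1 + e) * expR (8 / c * e) <= (1 + e) * (1 + M * e).
    by rewrite ler_wpM2l// addr_ge0// ltW.
  have : M * e * e <= M * e by rewrite ler_piMr// mulr_ge0// ltW.
  by clearbody M; move: (expR _) => E; lra.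
move/eqP: s1; rewrite eqr_norml ler01 andbT => /orP[/eqP sE|/eqP sE]; subst s.
  by exists (gamma 1).
exists (SL2_opp (gamma 1)).
  by rewrite -g3; apply/to_PSL2P; rewrite /pm_eq eqxx orbT.
by move: h; rewrite raddfN/= opprK -normrN opprD.
Qed.

End inner_product.

(** * Haar measure in exponential coordinates *)

(** With z = K x <= 1/2, the cube of 1 + 2 z is at most 1 + 14 z. *)
Lemma density_arith (R : realType) (K x y : R) : 1 <= K -> 0 < x ->
  2 * K * x <= 1 -> y - x <= (1 + x) * (1 + 2 * (K * x)) ^+ 3 ->
  y <= 1 + (2 + 28 * K) * x.
Proof.
rewrite -mulrA => K1 x0 Kx1 h.
have x1 : 2 * x <= 1 by nra.
have Kx0 : 0 < K * x by nra.
have t3 : (1 + 2 * (K * x)) ^+ 3 <= 1 + 14 * (K * x).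
  by move: (K * x) Kx0 Kx1 => z z0 z1; rewrite !exprS expr0; nra.
have := ler_wpM2l (_ : 0 <= 1 + x) t3 => /(_ ltac:(lra)) h2.
nra.
Qed.

Section haar_density.
Variables (R : realType) (b : 3.-tuple 'M[R]_2) (V : set (R * R * R)).
Hypotheses (hb : basis_of (sl2 R) b) (hV : is_log_domain b V).
Variable mt : {sigma_finite_measure set (PSL2 R) -> \bar R}.
Hypotheses (hmt : is_haar mt) (hmt1 : normalized_at_id b V mt).
Local Notation R3 := (R * R * R)%type.
Local Notation Exp := (PSL2_exp b).

Lemma lebesgue_itvcc (a c : R) : a <= c ->
  lebesgue_measure (`[a, c]%classic : set R) = (c - a)%:E.
Proof.
move=> ac; rewrite lebesgue_measure_itv/= lte_fin.
by case: ltP => // ca; rewrite (@le_anti _ _ a c) ?ac// subrr.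
Qed.

Lemma lebesgue_cube (c : R3) r : 0 <= r ->
  R3_lebesgue (cube c r) = ((2 * r) ^+ 3)%:E.
Proof.
move=> r0; have le x : x - r <= x + r :> R by lra.
rewrite cubeE /R3_lebesgue product_measure1E//; last exact: measurableX.
rewrite [X in (X * _)%E]product_measure1E//.
have E x : lebesgue_measure (`[x - r, x + r]%classic : set R) = (2 * r)%:E.
  by rewrite lebesgue_itvcc//; congr EFin; ring.
transitivity ((2 * r)%:E * (2 * r)%:E * (2 * r)%:E)%E.
  by congr (_ * _ * _)%E; exact: E.
by rewrite -!EFinM; congr EFin; rewrite !exprS expr0; ring.
Qed.

Lemma cube_sub_log_domain : exists2 r, 0 < r & cube 0 r `<=` V.
Proof.
have [oV V0 _ _] := hV.
have /nbhs_ballP[e /= e0 eV] := open_nbhs_nbhs (conj oV V0).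
exists (e / 2); first by rewrite divr_gt0.
move=> v; rewrite /cube/= subr0 => h; apply: eV.
rewrite -ball_normE /ball_/= sub0r normrN (le_lt_trans h)//.
by rewrite ltr_pdivrMr// ltr_pMr// ltr1n.
Qed.

Section density.
Variable rho : PSL2 R -> R.
Hypotheses (crho : {within Exp @` V, continuous rho}) (rho0 : forall x, 0 <= rho x).
Hypothesis (rho1 : rho 1%g = 1).
Hypothesis mtE : forall A, measurable A -> A `<=` Exp @` V ->
  mt A = (\int[@R3_lebesgue R]_(v in V `&` Exp @^-1` A) (rho (Exp v))%:E)%E.

Lemma density_continuous v : V v -> {for v, continuous (rho \o Exp)}.
Proof.
have [_ _ _ oE] := hV => Vv.
move: crho; rewrite continuous_open_subspace// => crho'.
apply: continuous_comp; first exact: PSL2_exp_continuous.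
by apply: crho'; rewrite inE; exists v.
Qed.

Lemma density_measurable : measurable_fun V (rho \o Exp).
Proof.
have [oV _ _ _] := hV.
apply: (measurability _ (RGenOInfty.measurableE R)) => /= _ [_ [a ->] <-].
apply: open_R3_measurable; rewrite openE => v [Vv av].
apply: filterI; first exact: open_nbhs_nbhs.
apply: (density_continuous Vv); apply: open_nbhs_nbhs; split => //; exact: itv_open_ends_open.
Qed.

Lemma haar_exp D : D `<=` V -> compact D ->
  mt (Exp @` D) = (\int[@R3_lebesgue R]_(v in D) (rho (Exp v))%:E)%E.
Proof.
move=> DV cD; have [_ _ injE _] := hV.
rewrite mtE; [|exact: PSL2_exp_compact_measurable|by move=> _ [v Dv <-]; exists v => //; exact: DV].
congr (integral _ _ _); apply/seteqP; split => [v [Vv [w Dw wv]]|v Dv].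
  have <- // : w = v by exact: (injE _ _ (mem_set (DV _ Dw)) (mem_set Vv) wv).
by split; [exact: DV|exists v].
Qed.

Lemma haar_cube_le c h m : cube c h `<=` V -> 0 <= h ->
  (forall v, cube c h v -> rho (Exp v) <= m) ->
  (mt (Exp @` cube c h) <= (m * (2 * h) ^+ 3)%:E)%E.
Proof.
move=> cV h0 cm; rewrite haar_exp//; last exact: cube_compact.
have mC := cube_measurable c h.
rewrite EFinM -(lebesgue_cube c h0) -integral_cst//.
apply: ge0_le_integral => //.
- by move=> v _; rewrite lee_fin.
- apply/measurable_EFinP; apply: measurable_funS density_measurable => //.
  by have [oV _ _ _] := hV; exact: open_R3_measurable.
Qed.

Lemma haar_cube_ge c h m : cube c h `<=` V -> 0 <= h -> 0 <= m ->
  (forall v, cube c h v -> m <= rho (Exp v)) ->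
  ((m * (2 * h) ^+ 3)%:E <= mt (Exp @` cube c h))%E.
Proof.
move=> cV h0 m0 cm; rewrite haar_exp//; last exact: cube_compact.
have mC := cube_measurable c h.
rewrite EFinM -(lebesgue_cube c h0) -integral_cst//.
apply: ge0_le_integral => //.
- apply/measurable_EFinP; apply: measurable_funS density_measurable => //.
  by have [oV _ _ _] := hV; exact: open_R3_measurable.
Qed.

Lemma density_near v e : V v -> 0 < e -> exists2 d, 0 < d &
  forall h, h <= d -> cube v h `<=` V /\
    forall u, cube v h u -> `|rho (Exp u) - rho (Exp v)| <= e.
Proof.
move=> Vv e0; have [oV _ _ _] := hV.
have : \forall u \near v, V u /\ `|rho (Exp u) - rho (Exp v)| <= e.
  apply: filterI; first exact: open_nbhs_nbhs.
  have /cvgrPdist_le/(_ _ e0) := density_continuous Vv.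
  by apply: filterS => u /= h; rewrite distrC; exact: h.
move=> /nbhs_ballP[d /= d0 dV].
exists (d / 2); first by rewrite divr_gt0.
have sub u h : h <= d / 2 -> cube v h u -> ball v d u.
  move=> hd; rewrite /cube/= => h1; rewrite -ball_normE /ball_/= distrC.
  by rewrite (le_lt_trans h1)// (le_lt_trans hd)// ltr_pdivrMr// ltr_pMr// ltr1n.
by move=> h hd; split=> u /(sub _ _ hd)/dV[].
Qed.

(* Left translation by exp v maps exp (cube 0 h) onto a set containing
   exp (cube v h') with h' = (1 - O(|v|)) h; both have the same Haar measure. *)
Lemma density_le : exists2 r0, 0 < r0 & exists2 K : R, 1 <= K &
  forall v, `|v| <= r0 -> V v /\ rho (Exp v) <= 1 + K * `|v|.
Proof.
have [r1 r10 r1V] := cube_sub_log_domain.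
have [r2 r20 [K K1 hK]] := PSL2_log_mul hb.
have K0 : 0 < K by lra.
have [inv _ _] := hmt.
(* The three bounds keep v in the chart, 2 |v| in the range of [PSL2_log_mul], and 2 K |v| below 1
   for [density_arith]. *)
pose r0 := Num.min r1 (Num.min (r2 / 2) (2 * K)^-1).
exists r0; first by rewrite !lt_min r10 divr_gt0//= invr_gt0 mulr_gt0.
exists (2 + 28 * K); first by lra.
move=> v; rewrite !le_min => /and3P[vr1 vr2 vK].
have V0 : V 0 by have [] := hV.
have Vv : V v by apply: r1V; rewrite /cube/= subr0.
split => //; have [->|v0] := eqVneq v 0.
  by rewrite (PSL2_exp0 hb) rho1 normr0 mulr0 addr0.
set x := `|v| in vr1 vr2 vK *; have x0 : 0 < x by rewrite normr_gt0.
have [d d0 hd] := density_near Vv x0.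
have [d' d'0 hd'] := density_near V0 x0.
(* On cubes of this size around 0 and v the density moves by at most x; h <= x keeps the cube around
   v within radius 2 x of 0. *)
pose h := Num.min d (Num.min d' x).
have h0 : 0 < h by rewrite !lt_min d0 d'0.
have : h <= h by []; rewrite {2}/h !le_min => /and3P[hhd hhd' hhx].
have [h1 h1'] := hd' _ hhd'.
(* If Exp w = (Exp v)^-1 Exp u, then |w| <= |u - v| + 2 K x |u - v| = t |u - v|, so radius h / t is
   carried into radius h. The loss t depends on x but not on h. *)
pose t := 1 + 2 * (K * x).
have t1 : 1 <= t by rewrite lerDl !mulr_ge0// ltW.
have t0 : 0 < t by lra.
pose h2 := h / t.
have h20 : 0 < h2 by rewrite divr_gt0.
have h2h : h2 <= h by rewrite ler_pdivrMr// ler_peMr// ltW.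
have [h3 h3'] := hd _ (le_trans h2h hhd).
have sub : Exp @` cube v h2 `<=` [set (Exp v * y)%g | y in Exp @` cube 0 h].
  move=> _ [u uv <-].
  have ux : `|u| <= 2 * x.
    rewrite -(subrK v u) (le_trans (ler_normD _ _))//.
    by rewrite /cube/= in uv; rewrite -/x; lra.
  have [|||w wE hw] := hK (2 * x) v u.
  - by move: vr2; rewrite ler_pdivlMr// mulrC.
  - by rewrite -/x; lra.
  - by [].
  exists (Exp w); last by rewrite wE mulVKg.
  exists w => //; rewrite /cube/= subr0.
  rewrite -(subrK (u - v) w) (le_trans (ler_normD _ _))//.
  have uvh : `|u - v| <= h / t by [].
  move: uvh; rewrite ler_pdivlMr// => uvh.
  by rewrite (le_trans (lerD hw (lexx _)))// (le_trans _ uvh)// /t; lra.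
have mC (c : R3) (s : R) : measurable (Exp @` cube c s).
  by apply: PSL2_exp_compact_measurable => //; exact: cube_compact.
have mle : (mt (Exp @` cube v h2) <= mt (Exp @` cube 0%R h))%E.
  rewrite -(inv (Exp v) (Exp @` cube 0 h)) ?le_measure ?inE//.
  exact: translate_measurable.
have up : (mt (Exp @` cube 0%R h) <= ((1 + x) * (2 * h) ^+ 3)%:E)%E.
  apply: haar_cube_le; [exact: h1|exact: ltW|move=> u /h1'].
  by rewrite (PSL2_exp0 hb) rho1 ler_norml => /andP[_]; lra.
(* [haar_cube_ge] asks for a nonnegative lower bound, here rho (Exp v) - x; in the remaining case
   the claim is immediate. *)
have [rx|rx] := leP (rho (Exp v)) x.
  by rewrite (le_trans rx)//; nra.
have dn : (((rho (Exp v) - x) * (2 * h2) ^+ 3)%:E <= mt (Exp @` cube v h2))%E.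
  apply: haar_cube_ge; [exact: h3|exact: ltW|lra|move=> u /h3'].
  by rewrite ler_norml lerBrDr addrC => /andP[].
have := le_trans dn (le_trans mle up); rewrite lee_fin.
have -> : (2 * h2) ^+ 3 = (2 * h) ^+ 3 / t ^+ 3.
  by rewrite /h2 mulrA expr_div_n.
rewrite mulrA ler_pdivrMr ?exprn_gt0// mulrAC ler_pM2r ?exprn_gt0 ?mulr_gt0//.
move=> h4; apply: density_arith h4 => //.
by move: vK; rewrite -[(2 * K)^-1]mul1r ler_pdivlMr ?mulr_gt0// [in leLHS]mulrC.
Qed.

End density.

Lemma haar_le_lebesgue : exists2 r0, 0 < r0 & exists2 K : R, 1 <= K &
  cube 0 r0 `<=` V /\
  forall r A, 0 <= r -> r <= r0 -> measurable A ->
    (mt (A `&` (Exp @` cube 0%R r)) <=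
     (1 + K * r)%:E * R3_lebesgue (cube 0%R r `&` Exp @^-1` A))%E.
Proof.
have [rho [crho rho0 rho1 mtE]] := hmt1.
have [r0 r00 [K K1 hK]] := density_le crho rho0 rho1 mtE.
have cV r : r <= r0 -> cube 0 r `<=` V.
  by move=> rr0 v; rewrite /cube/= subr0 => vr; have [] := hK v (le_trans vr rr0).
exists r0 => //; exists K => //; split; first exact: cV.
move=> r A rge0 rr0 mA.
have mC : measurable (Exp @` cube 0 r).
  by apply: PSL2_exp_compact_measurable => //; exact: cube_compact.
have mE : measurable (cube 0 r `&` Exp @^-1` A).
  apply: measurableI; first exact: cube_measurable.
  by rewrite -[X in measurable X]setTI; apply: PSL2_exp_measurable.
rewrite mtE; [|exact: measurableI|]; last first.
  by move=> _ [_ [v vr <-]]; exists v => //; exact: (cV _ rr0).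
have -> : V `&` Exp @^-1` (A `&` (Exp @` cube 0 r)) = cube 0 r `&` Exp @^-1` A.
  have [_ _ injE _] := hV.
  apply/seteqP; split => [v [Vv [Av [w cw wv]]]|v [cv Av]].
    have wv' : w = v by exact: (injE _ _ (mem_set (cV _ rr0 _ cw)) (mem_set Vv) wv).
    by split; [rewrite -wv'; exact: cw|exact: Av].
  by split; [exact: (cV _ rr0)|split => //; exists v].
rewrite -integral_cst//; apply: ge0_le_integral => //.
- by move=> v _; rewrite lee_fin.
- apply/measurable_EFinP; apply: measurable_funS (density_measurable crho) => //.
    by have [oV _ _ _] := hV; exact: open_R3_measurable.
  by move=> v [cv _]; exact: (cV _ rr0).
move=> v [cv _]; rewrite lee_fin; move: cv; rewrite /cube/= subr0 => vr.
have [_ h] := hK v (le_trans vr rr0); rewrite (le_trans h)// lerD2l ler_wpM2l//.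
lra.
Qed.

End haar_density.

(** * Densities, independence and kernels *)

Definition pushforward_measure d d' (T1 : measurableType d)
    (T2 : measurableType d') (R : realType) (m : {measure set T1 -> \bar R})
    (f : T1 -> T2) (mf : measurable_fun setT f) : {measure set T2 -> \bar R} :=
  measure_function_pushforward__canonical__measure_function_Measure m mf.

Section density.
Context d (T : measurableType d) (R : realType).
Variables (mu : {sigma_finite_measure set T -> \bar R}) (la : probability T R).
Hypothesis lamu : la `<< mu.

(* A version of the density [pdensity mu la] that is nonnegative everywhere. *)
Definition rn_density (x : T) : R := fine (Radon_Nikodym_SigmaFinite.f la mu x).

Lemma rn_densityE x : (rn_density x)%:E = Radon_Nikodym_SigmaFinite.f la mu x.
Proof. by rewrite fineK// Radon_Nikodym_SigmaFinite.f_fin_num. Qed.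

Lemma rn_density_ge0 x : 0 <= rn_density x.
Proof. by rewrite -lee_fin rn_densityE Radon_Nikodym_SigmaFinite.f_ge0. Qed.

Lemma measurable_rn_density : measurable_fun setT rn_density.
Proof.
apply/measurable_EFinP.
rewrite [X in measurable_fun _ X](_ : _ = Radon_Nikodym_SigmaFinite.f la mu).
  exact: measurable_int (Radon_Nikodym_SigmaFinite.f_integrable lamu).
by apply/funext => x; exact: rn_densityE.
Qed.

Lemma integral_rn_density (f : T -> \bar R) : (forall x, 0 <= f x)%E ->
  measurable_fun setT f ->
  (\int[la]_x f x = \int[mu]_x (f x * (rn_density x)%:E))%E.
Proof.
move=> f0 mf; rewrite -(Radon_Nikodym_SigmaFinite.change_of_variables lamu f0 measurableT mf).
by apply: eq_integral => x _; rewrite rn_densityE.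
Qed.

(** The law of the zero set of the density is the integral of the density over that set. *)
Lemma rn_density_gt0 : {ae la, forall x, 0 < rn_density x}.
Proof.
have mN : measurable (rn_density @^-1` [set 0]).
  by rewrite -[X in measurable X]setTI; exact: measurable_rn_density.
exists (rn_density @^-1` [set 0]); split => //.
  rewrite (Radon_Nikodym_SigmaFinite.f_integral lamu)//.
  by rewrite integral0_eq// => x /=; rewrite -rn_densityE => ->.
move=> x /= /negP; rewrite -leNgt => x0; apply/eqP.
by rewrite eq_le x0 rn_density_ge0.
Qed.

Lemma pdensity_ae : ae_eq mu setT (pdensity mu la) rn_density.
Proof.
have := ae_eq_Radon_Nikodym_SigmaFinite lamu measurableT.
apply: filterS => x /(_ Logic.I) h _.
by rewrite /pdensity -h.
Qed.

Lemma measurable_pdensity : measurable_fun setT (pdensity mu la).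
Proof.
apply: (measurable_comp (F := setT)) => //.
Qed.

Lemma pdensity_ae_la : ae_eq la setT (pdensity mu la) rn_density.
Proof.
have [N [mN N0 NS]] := pdensity_ae.
by exists N; split => //; exact: (null_content_dominatesP _ _).1 lamu N mN N0.
Qed.

(** For the density f, integrating f |ln f| against [mu] is integrating |ln f| against [la]. *)
Lemma integrable_ln_rn_density : finite_entropy mu la ->
  la.-integrable setT (EFin \o (fun x => ln (rn_density x))).
Proof.
move=> [_ fe].
have mln : measurable_fun setT (fun x => ln (rn_density x)).
  by apply: measurableT_comp => //; exact: measurable_rn_density.
apply/integrableP; split; first exact/measurable_EFinP.
have mn : measurable_fun setT (fun x => `|ln (rn_density x)|).
  exact: measurableT_comp.
rewrite (eq_integral (fun x => `|ln (rn_density x)|%:E))//.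
rewrite integral_rn_density//; last exact/measurable_EFinP.
apply: le_lt_trans fe; rewrite le_eqVlt; apply/orP; left; apply/eqP.
apply: ae_eq_integral => //.
- by apply: emeasurable_funM; apply/measurable_EFinP => //; exact: measurable_rn_density.
- apply/measurable_EFinP; apply: measurable_funM; first exact: measurable_pdensity.
  by do 2?apply: measurableT_comp => //; exact: measurable_pdensity.
apply: filterS pdensity_ae => x h _; rewrite -EFinM mulrC.
by rewrite (h Logic.I).
Qed.

Lemma entropyE : entropy mu la = - (\int[la]_x ln (rn_density x))%R.
Proof.
rewrite /entropy /Rintegral; congr (- fine _); apply: ae_eq_integral => //.
- apply/measurable_EFinP; apply: measurableT_comp => //; exact: measurable_pdensity.
- apply/measurable_EFinP; apply: measurableT_comp => //; exact: measurable_rn_density.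
by apply: filterS pdensity_ae_la => x h _; rewrite (h Logic.I).
Qed.

End density.

Lemma rectangle_measure_unique d1 d2 (T1 : measurableType d1)
    (T2 : measurableType d2) (R : realType)
    (m1 m2 : {measure set (T1 * T2)%type -> \bar R}) :
  (m1 setT < +oo)%E ->
  (forall A B, measurable A -> measurable B -> m1 (A `*` B) = m2 (A `*` B)) ->
  forall E, measurable E -> m1 E = m2 E.
Proof.
move=> fin m12.
pose C : set (set (T1 * T2)) := [set A `*` B | A in measurable & B in measurable].
apply: (measure_unique C (fun=> setT)).
- by rewrite measurable_prod_measurableType.
- move=> _ _ [A1 mA1 [A2 mA2 <-]] [B1 mB1 [B2 mB2 <-]].
  exists (A1 `&` B1); first exact: measurableI.
  by exists (A2 `&` B2); [exact: measurableI|rewrite setXI].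
- by move=> _; exists setT => //; exists setT => //; rewrite setXTT.
- by rewrite bigcup_const.
- by move=> _ [A mA [B mB <-]]; exact: m12.
- by move=> _.
Qed.

Section independence.
Context d d' (T : measurableType d) (G : measurableType d') (R : realType).
Variable P : probability T R.

Lemma independent3_swap (X Y Z : T -> G) :
  independent3 P X Y Z -> independent3 P X Z Y.
Proof.
move=> XYZ A B C mA mB mC.
by rewrite setIAC XYZ// -!muleA [X in (_ * X)%E]muleC.
Qed.

Variables X Y Z : {RV P >-> G}.
Hypothesis XYZ : independent3 P X Y Z.

Let XY w := (X w, Y w).
Let mXY : measurable_fun setT XY.
Proof. exact: measurable_fun_pair. Qed.

(** For fixed B both sides are finite measures in A, so rectangles are enough. There the law of the
    pair factors by independence with the whole space as third set. *)
Lemma independent3_pair (A : set (G * G)) (B : set G) :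
  measurable A -> measurable B ->
  P (XY @^-1` A `&` Z @^-1` B) = (P (XY @^-1` A) * P (Z @^-1` B))%E.
Proof.
move=> mA mB.
have mZ (C : set G) : measurable C -> measurable (Z @^-1` C).
  by move=> mC; rewrite -[X in measurable X]setTI; exact: measurable_funPT.
have pfin (C : set T) : measurable C -> P C \is a fin_num.
  by move=> mC; exact: fin_num_measure.
have p0 : 0 <= fine (P (Z @^-1` B)) by exact: fine_ge0.
pose m1 := pushforward_measure (mrestr P (mZ _ mB)) mXY.
pose m2 := mscale (NngNum p0) (pushforward_measure P mXY).
have m1E C : m1 C = P (XY @^-1` C `&` Z @^-1` B) by [].
have m2E C : m2 C = (P (XY @^-1` C) * P (Z @^-1` B))%E.
  rewrite muleC -[X in (X * _)%E]fineK; last exact: pfin (mZ _ mB).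
  by [].
rewrite -m1E -m2E.
apply: rectangle_measure_unique mA => [|A1 A2 mA1 mA2].
  by rewrite m1E preimage_setT setTI ltey_eq; apply/orP; left; apply: pfin; exact: (mZ _ mB).
rewrite [LHS]m1E [RHS]m2E.
have -> : XY @^-1` (A1 `*` A2) = X @^-1` A1 `&` Y @^-1` A2 by [].
have := XYZ mA1 mA2 measurableT; rewrite preimage_setT setIT probability_setT mule1 => ->.
exact: XYZ.
Qed.

(** By [independent3_pair] the law of ((X, Y), Z) is a product measure, to which Tonelli applies. *)
Lemma independent3_integral (f : G * G * G -> \bar R) :
  measurable_fun setT f -> (forall z, 0 <= f z)%E ->
  (\int[P]_w f (X w, Y w, Z w) =
   \int[P]_w \int[distribution P Z]_z f (X w, Y w, z))%E.
Proof.
move=> mf f0.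
have mXYZ : measurable_fun setT (fun w => (X w, Y w, Z w)).
  exact: measurable_fun_pair.
pose XY' : {mfun T >-> (G * G)%type} := HB.pack XY (isMeasurableFun.Build _ _ _ _ _ mXY).
have -> : (\int[P]_w f (X w, Y w, Z w) =
    \int[pushforward_measure P mXYZ]_z f z)%E.
  have := @ge0_integral_pushforward _ _ _ _ R _ mXYZ P setT f measurableT mf (fun x _ => f0 x).
  by rewrite preimage_setT => <-.
have U := @product_measure_unique _ _ _ _ R (distribution P XY') (distribution P Z)
  (pushforward_measure P mXYZ).
rewrite (eq_measure_integral (distribution P XY' \x distribution P Z)%E); last first.
  move=> A mA _; apply/esym/U => // A1 B mA1 mB.
  exact: independent3_pair.
rewrite fubini_tonelli1//.
rewrite (ge0_integral_distribution XY')//.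
- exact: measurable_fun_fubini_tonelli_F.
- by move=> z; apply: integral_ge0.
Qed.

End independence.

Section kernel_integral.
Context d d' (T : measurableType d) (G : measurableType d') (R : realType).
Variable kappa : T -> pprobability G R.
Hypothesis mkappa : measurable_fun setT kappa.

Lemma kernel_integral_measurable (f : T * G -> \bar R) :
  measurable_fun setT f -> (forall z, 0 <= f z)%E ->
  measurable_fun setT (fun w => \int[kappa w : probability G R]_x f (w, x))%E.
Proof.
move=> mf f0.
exact: (measurable_fun_integral_sfinite_kernel f (kprobability mkappa) f0 mf).
Qed.

Context d2 (H : measurableType d2).
Variables (P : probability T R) (X : T -> G) (Y : T -> H).
Hypotheses (mX : measurable_fun setT X) (mY : measurable_fun setT Y).

Let mpair w : measurable_fun setT (fun x : G => (x, Y w)).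
Proof. exact: measurable_fun_pair. Qed.

(** Given w, the law of (x, Y w) with x drawn from [kappa w]. The dummy factor [unit] is the shape
    asked for by the composition [kcomp] with P, regarded as a constant kernel on [unit]. *)
Definition joint (z : unit * T) : {measure set (G * H)%type -> \bar R} :=
  pushforward_measure (kappa z.2 : probability G R) (mpair z.2).

Let joint_measurable U : measurable U -> measurable_fun setT (joint ^~ U).
Proof.
move=> mU.
have -> : joint ^~ U = (fun w => \int[kappa w : probability G R]_x
    (\1_U (x, Y w))%:E)%E \o snd.
  apply/funext => -[u w] /=; rewrite -[LHS]/((kappa w : probability G R) _).
  have mD : measurable ((fun x : G => (x, Y w)) @^-1` U).
    by rewrite -[X in measurable X]setTI; apply: mpair.
  by rewrite -[RHS]/(\int[_]_x (\1_((fun x : G => (x, Y w)) @^-1` U) x)%:E)%E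
    integral_indic// setIT.
apply: measurableT_comp => //.
apply: (kernel_integral_measurable (f := fun z => (\1_U (z.2, Y z.1))%:E)) => //.
have mg : measurable_fun setT (fun z : T * G => (z.2, Y z.1)).
  by apply: measurable_fun_pair => //; exact: measurableT_comp.
apply/measurable_EFinP; apply: (@measurable_indic _ _ _ _ ((fun z => (z.2, Y z.1)) @^-1` U)).
by rewrite -[X in measurable X]setTI; exact: mg.
Qed.

HB.instance Definition _ :=
  @isKernel.Build _ _ (unit * T)%type (G * H)%type R joint joint_measurable.

Let joint_prob z : joint z setT = 1%E.
Proof. exact: probability_setT. Qed.

HB.instance Definition _ :=
  @Kernel_isProbability.Build _ _ (unit * T)%type (G * H)%type R joint joint_prob.

(** Both sides integrate f, once against P composed with the kernel and once against the law of (X,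
    Y). These two measures agree on rectangles, where the equality is the defining property of a
    regular conditional distribution. *)
Lemma disintegration (f : G * H -> \bar R) :
  (forall A B, measurable A -> measurable B ->
    (\int[P]_(w in Y @^-1` B) (kappa w : probability G R) A =
     P (Y @^-1` B `&` X @^-1` A))%E) ->
  measurable_fun setT f -> (forall z, 0 <= f z)%E ->
  (\int[P]_w \int[kappa w : probability G R]_x f (x, Y w) =
   \int[P]_w f (X w, Y w))%E.
Proof.
move=> rcd mf f0.
have mXY : measurable_fun setT (fun w => (X w, Y w)) by exact: measurable_fun_pair.
have mc : measurable_fun [set: unit] (fun=> P : pprobability T R) by exact: measurable_cst.
have h := integral_kcomp (kprobability mc) joint tt f0 mf.
transitivity (\int[kcomp (kprobability mc) joint tt]_z f z)%E.
  rewrite h; apply: eq_integral => w _.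
  have := @ge0_integral_pushforward _ _ _ _ R _ (mpair w) (kappa w : probability G R)
    setT f measurableT mf (fun x _ => f0 x).
  by rewrite preimage_setT => <-.
have := @ge0_integral_pushforward _ _ _ _ R _ mXY P setT f measurableT mf (fun x _ => f0 x).
rewrite preimage_setT => <-; apply: eq_measure_integral => A mA _.
apply: (@rectangle_measure_unique _ _ G H R
  ((kprobability mc \; joint)%E tt) (pushforward_measure P mXY)) mA.
- rewrite -[X in (X < _)%E]/(\int[P]_w (joint (tt, w) setT))%E.
  under eq_integral do rewrite joint_prob.
  by rewrite integral_cst// mul1e ltey_eq fin_num_measure.
- move=> A1 B mA1 mB.
  transitivity (\int[P]_w (joint (tt, w) (A1 `*` B)))%E => //.
  transitivity (P (Y @^-1` B `&` X @^-1` A1)); last first.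
    by rewrite -[RHS]/(P _); congr (P _); apply/seteqP; split => w [].
  rewrite -rcd// [RHS]integral_mkcond; apply: eq_integral => w _.
  transitivity ((kappa w : probability G R) ((fun x => (x, Y w)) @^-1` (A1 `*` B))) => //.
  rewrite patchE; case: ifPn => [|]; rewrite ?inE ?notin_setE => YB.
    by congr ((kappa w : probability G R) _); apply/seteqP; split => x // [].
  rewrite (_ : _ @^-1` _ = set0) ?measure0//.
  by apply/seteqP; split => x // [].
Qed.

End kernel_integral.

Section factorization.
Context d d' (T : measurableType d) (H : measurableType d') (R : realType).
Variables (Y : T -> H).

(* Doob-Dynkin: eta < q is the preimage of some B q under Y for every rational
   q, and mu y := inf {q | y \in B q} recovers eta. *)
Lemma measurable_factorization (eta : T -> R) :
  measurable_fun [set: g_sigma_algebra_preimageType Y] eta ->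
  exists2 mu : H -> R, measurable_fun setT mu & forall w, eta w = mu (Y w).
Proof.
move=> meta.
have BE (q : rat) : exists B : set H, measurable B /\
    Y @^-1` B = eta @^-1` `]-oo, ratr q[%classic.
  have : measurable (eta @^-1` `]-oo, ratr q[%classic : set (g_sigma_algebra_preimageType Y)).
    by rewrite -[X in measurable X]setTI; apply: meta => //; exact: measurable_itv.
  by move=> [B mB]; rewrite setTI => BE; exists B.
pose B q := sval (cid (BE q)).
have mB q : measurable (B q) by rewrite /B; case: cid => ? [].
have BY q : Y @^-1` (B q) = eta @^-1` `]-oo, ratr q[%classic.
  by rewrite /B; case: cid => ? [].
pose m (q : rat) (y : H) : \bar R := if y \in B q then (ratr q)%:E else +oo%E.
pose M y := ereal_inf [set m q y | q in setT].
have mltP q y (a : R) : (m q y < a%:E)%E <-> B q y /\ ratr q < a.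
  by rewrite /m; case: ifPn; rewrite ?inE ?notin_setE => Bq; split => // -[].
exists (fine \o M) => [|w].
  apply: measurableT_comp => //.
  apply: (measurability _ (ErealGenInftyO.measurableE R)) => _ [_ [a ->] <-].
  rewrite setTI (_ : M @^-1` _ =
      \bigcup_q (if ratr q < a then B q else set0)); last first.
    apply/seteqP; split => [y|y [q _]] /=.
      rewrite in_itv/= => /ereal_inf_lt[_ [q _ <-] /mltP[Bq qa]].
      by exists q => //; rewrite qa.
    case: ifPn => // qa Bq; rewrite in_itv/=; apply: le_lt_trans (_ : (m q y < _)%E).
      by apply: ereal_inf_lbound; exists q.
    exact/mltP.
  apply: countable_bigcupT_measurable => [|q]; first exact: countableP.
  by case: ifPn.
have BYP q : B q (Y w) <-> eta w < ratr q.
  have : (Y @^-1` (B q)) w <-> (eta @^-1` `]-oo, ratr q[%classic) w by rewrite BY.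
  by rewrite /= in_itv.
suff h : M (Y w) = (eta w)%:E by rewrite /= h.
apply/eqP; rewrite eq_le; apply/andP; split.
  apply/lee_addgt0Pr => x x0.
  have [|q] := @rat_in_itvoo R (eta w) (eta w + x); first by rewrite ltrDl.
  rewrite in_itv/= => /andP[q1 q2].
  apply: ereal_inf_le; exists (m q (Y w)); first by exists q.
  by apply/ltW; rewrite -EFinD; apply/mltP; split => //; exact/BYP.
apply: le_ereal_inf_tmp => _ [q _ <-]; rewrite /m; case: ifPn => [|_]; last exact: leey.
by rewrite inE => /BYP/ltW; rewrite lee_fin.
Qed.

End factorization.

Lemma integral_product_ge0 d1 d2 (T1 : measurableType d1) (T2 : measurableType d2)
    (R : realType) (m1 : {sigma_finite_measure set T1 -> \bar R})
    (m2 : {sigma_finite_measure set T2 -> \bar R}) (f : T1 -> R) (g : T2 -> R) :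
  measurable_fun setT f -> measurable_fun setT g ->
  (forall x, 0 <= f x) -> (forall y, 0 <= g y) ->
  (\int[(m1 \x m2)%E]_z (f z.1 * g z.2)%:E =
   (\int[m1]_x (f x)%:E) * (\int[m2]_y (g y)%:E))%E.
Proof.
move=> mf mg f0 g0.
rewrite (@fubini_tonelli1 _ _ _ _ _ m1 m2 (fun z => (f z.1 * g z.2)%:E)); last 2 first.
- apply/measurable_EFinP; apply: measurable_funM; exact: measurableT_comp.
- by move=> z; rewrite lee_fin mulr_ge0.
rewrite /fubini_F/=; under eq_integral.
  move=> x _; under eq_integral do rewrite EFinM.
  rewrite ge0_integralZl_EFin//; last 2 first.
  - by move=> y _; rewrite lee_fin.
  - exact/measurable_EFinP.
  over.
rewrite /= ge0_integralZr//.
- exact/measurable_EFinP.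
- by move=> x _; rewrite lee_fin.
- by apply: integral_ge0 => y _; rewrite lee_fin.
Qed.

Lemma integral_product3_ge0 d1 d2 d3 (T1 : measurableType d1)
    (T2 : measurableType d2) (T3 : measurableType d3) (R : realType)
    (m1 : {sigma_finite_measure set T1 -> \bar R})
    (m2 : {sigma_finite_measure set T2 -> \bar R})
    (m3 : {sigma_finite_measure set T3 -> \bar R})
    (f : T1 -> R) (g : T2 -> R) (h : T3 -> R) :
  measurable_fun setT f -> measurable_fun setT g -> measurable_fun setT h ->
  (forall x, 0 <= f x) -> (forall y, 0 <= g y) -> (forall y, 0 <= h y) ->
  (\int[(m1 \x m2 \x m3)%E]_z (f z.1.1 * g z.1.2 * h z.2)%:E =
   (\int[m1]_x (f x)%:E) * (\int[m2]_y (g y)%:E) * (\int[m3]_y (h y)%:E))%E.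
Proof.
move=> mf mg mh f0 g0 h0.
have mfg : measurable_fun setT (fun z : T1 * T2 => f z.1 * g z.2).
  by apply: measurable_funM; exact: measurableT_comp.
rewrite -(integral_product_ge0 m1 m2 mf mg f0 g0).
have sf : sigma_finite setT (m1 \x m2)%E.
  have /sigma_finiteP[F [TF ndF Foo]] := sigma_finiteT m1.
  have /sigma_finiteP[G [TG ndG Goo]] := sigma_finiteT m2.
  exists (fun n => F n `*` G n) => [|n].
    rewrite -setXTT TF TG; apply/seteqP; split => [[x y] [[i _ Fx] [j _ Gy]]|].
      exists (maxn i j) => //; split.
        by have /subsetPset/(_ _ Fx) := ndF _ _ (leq_maxl i j).
      by have /subsetPset/(_ _ Gy) := ndG _ _ (leq_maxr i j).
    by move=> [x y] [n _ [Fx Gy]]; split; exists n.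
  have [mF Fn] := Foo n; have [mG Gn] := Goo n; split; first exact: measurableX.
  by rewrite product_measure1E// lte_mul_pinfty// ge0_fin_numE.
pose m12 : {sigma_finite_measure set (T1 * T2)%type -> \bar R} :=
  HB.pack (m1 \x m2)%E (Measure_isSigmaFinite.Build _ _ _ (m1 \x m2)%E sf).
exact: (integral_product_ge0 m12 m3 mfg mh (fun z => mulr_ge0 (f0 z.1) (g0 z.2)) h0).
Qed.

(** * Haar integrals in exponential coordinates and Gaussian densities *)

Section haar_integral.
Variables (R : realType) (b : 3.-tuple 'M[R]_2) (V : set (R * R * R)).
Hypotheses (hb : basis_of (sl2 R) b) (hV : is_log_domain b V).
Variable mt : {sigma_finite_measure set (PSL2 R) -> \bar R}.
Hypotheses (hmt : is_haar mt) (hmt1 : normalized_at_id b V mt).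
Local Notation R3 := (R * R * R)%type.
Local Notation R3m :=
  (measurableTypeR R * measurableTypeR R * measurableTypeR R)%type.
Local Notation Exp := (PSL2_exp b).
Local Notation Log := (PSL2_log b V).
Local Notation L3 := ((@lebesgue_measure R \x @lebesgue_measure R)
  \x @lebesgue_measure R)%E.

Lemma R3_measurable_fun d (T : measurableType d) (f : T -> R3) :
  (forall i, measurable_fun setT (fun x => R3_coord i (f x))) ->
  measurable_fun setT f.
Proof.
move=> h; have := h 0; have := h 1; have := h 2; rewrite /R3_coord/= => h2 h1 h0.
have -> : f = fun x => ((f x).1.1, (f x).1.2, (f x).2).
  by apply/funext => x; case: (f x) => -[].
by do 2?apply: measurable_fun_pair.
Qed.

Lemma Log_measurable : measurable_fun setT Log.
Proof. by apply: R3_measurable_fun => i; exact: PSL2_log_measurable. Qed.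

Lemma haar_translate (y : PSL2 R) (f : PSL2 R -> \bar R) :
  measurable_fun setT f -> (forall x, 0 <= f x)%E ->
  (\int[mt]_x f (y * x)%g = \int[mt]_x f x)%E.
Proof.
move=> mf f0.
have my : measurable_fun setT (fun x : PSL2 R => (y * x)%g).
  by apply: PSL2_mul_measurable.
have [inv _ _] := hmt.
have := @ge0_integral_pushforward _ _ _ _ R _ my mt setT f measurableT mf (fun x _ => f0 x).
rewrite preimage_setT => <-; apply: eq_measure_integral => A mA _.
transitivity (mt [set (y^-1 * x)%g | x in A]); last by rewrite inv.
congr (mt _); apply/seteqP; split => [x Ax|_ [x Ax <-]].
  by exists (y * x)%g => //; rewrite mulKg.
by rewrite /= mulVKg.
Qed.

(** By [haar_le_lebesgue], Haar measure on exp (cube) is dominated by 1 + K r times the image of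
    Lebesgue measure on the cube. Domination passes to integrals, and Log undoes Exp on the cube. *)
Lemma haar_exp_integral_le : exists2 r0, 0 < r0 & exists2 K : R, 1 <= K &
  cube 0 r0 `<=` V /\
  forall r (psi : R3 -> \bar R), 0 <= r -> r <= r0 ->
    measurable_fun setT psi -> (forall v, 0 <= psi v)%E ->
    (\int[mt]_(x in Exp @` cube 0%R r) psi (Log x) <=
     (1 + K * r)%:E * \int[L3]_v psi v)%E.
Proof.
have [r0 r00 [K K1 [cV hK]]] := haar_le_lebesgue hb hV hmt hmt1.
exists r0 => //; exists K => //; split => // r psi rge0 rr0 mpsi psi0.
have mE : measurable (Exp @` cube 0 r).
  by apply: PSL2_exp_compact_measurable => //; exact: cube_compact.
have mC : measurable (cube (0 : R3) r : set R3m) by exact: cube_measurable.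
have mExp : measurable_fun [set: R3m] (Exp : R3m -> PSL2 R).
  exact: PSL2_exp_measurable hb.
have mf : measurable_fun setT (psi \o Log).
  by apply: measurableT_comp => //; exact: Log_measurable.
have k0 : 0 <= 1 + K * r by rewrite addr_ge0// mulr_ge0// (le_trans _ K1).
pose k : {nonneg R} := NngNum k0.
pose m1 := mrestr mt mE.
pose m2 := mscale k (pushforward_measure (mrestr L3 mC) mExp).
have -> : (\int[mt]_(x in Exp @` cube 0%R r) psi (Log x) =
    \int[m1]_(x in Exp @` cube 0%R r) psi (Log x))%E.
  by apply: eq_measure_integral => A mA AE; rewrite -[RHS]/(mt (A `&` _)) setIidl.
apply: le_trans (ge0_subset_integral _ mE measurableT mf _ (@subsetT _ _)) _.
  by move=> x _; exact: psi0.
apply: le_trans (@ge0_le_measure_integral _ _ _ m1 m2 _ _ _ measurableT _ mf) _.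
- move=> A mA; rewrite /m1 /m2 /mscale /= /mrestr /pushforward.
  rewrite (le_trans (hK r A rge0 rr0 mA))//.
  by rewrite setIC.
- by move=> x; exact: psi0.
rewrite /m2 ge0_integral_mscale//; last by move=> x _; exact: psi0.
rewrite lee_wpmul2l ?lee_fin//.
have -> := @ge0_integral_pushforward _ _ _ _ R _ mExp (mrestr L3 mC) setT
  (psi \o Log) measurableT mf (fun x _ => psi0 _).
rewrite preimage_setT.
have mg : measurable_fun [set: R3m] ((psi \o Log) \o Exp) by exact: measurableT_comp.
(* The restricted Lebesgue measure is null off the cube, so [Log (Exp v)] matters only where it
   equals v. *)
rewrite -(setUv (cube (0 : R3) r : set R3m)) ge0_integral_setU//; last 4 first.
- exact: measurableC.
- by rewrite setUv.
- by move=> x _; exact: psi0.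
- by apply/disj_setPS; rewrite setICr.
rewrite [X in (_ + X)%E]null_set_integral ?adde0; last 3 first.
- exact: measurableC.
- exact: measurable_funTS.
- by transitivity (L3 set0); [congr (L3 _); exact: setICl|exact: measure0].
have -> : (\int[mrestr L3 mC]_(x in cube 0%R r) ((psi \o Log) \o Exp) x =
    \int[L3]_(x in cube 0%R r) psi x)%E.
  transitivity (\int[L3]_(x in cube 0%R r) ((psi \o Log) \o Exp) x)%E.
    by apply: eq_measure_integral => A mA AE; rewrite -[LHS]/(L3 (A `&` _)) setIidl.
  apply: eq_integral => v; rewrite inE => vr /=; rewrite PSL2_expK//; apply: cV.
  by rewrite /cube/= in vr *; exact: le_trans vr rr0.
rewrite setUv; exact: (@ge0_subset_integral _ R3m R L3 (cube 0 r) setT mC measurableT psi mpsi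
  (fun v _ => psi0 v) (@subsetT _ _)).
Qed.

Definition gauss3 (m : R3) (s : R) (v : R3) : R :=
  normal_pdf m.1.1 s v.1.1 * normal_pdf m.1.2 s v.1.2 * normal_pdf m.2 s v.2.

Lemma gauss3_ge0 m s v : 0 <= gauss3 m s v.
Proof. by rewrite /gauss3 !mulr_ge0// normal_pdf_ge0. Qed.

Lemma normal_pdf_gt0 (m s x : R) : s != 0 -> 0 < normal_pdf m s x.
Proof.
by move=> s0; rewrite normal_pdfE// mulr_gt0 ?normal_peak_gt0// expR_gt0.
Qed.

Lemma gauss3_gt0 m s v : s != 0 -> 0 < gauss3 m s v.
Proof. by move=> s0; rewrite /gauss3 !mulr_gt0// normal_pdf_gt0. Qed.

Lemma ln_normal_pdf (m s x : R) : 0 < s -> ln (normal_pdf m s x) =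
  - (ln (2 * pi * s ^+ 2) / 2) - (x - m) ^+ 2 / (2 * s ^+ 2).
Proof.
move=> s0; have sn0 : s != 0 by rewrite gt_eqF.
rewrite normal_pdfE// [LHS]lnM ?posrE ?normal_peak_gt0 ?expR_gt0// expRK; congr (_ + _).
  rewrite /normal_peak lnV ?posrE ?sqrtr_gt0; last first.
    by rewrite mulrn_wgt0// mulr_gt0 ?pi_gt0// exprn_gt0.
  have -> : s ^+ 2 * pi *+ 2 = 2 * pi * s ^+ 2 by rewrite -mulr_natl; ring.
  have p0 : 0 < 2 * pi * s ^+ 2 by rewrite !mulr_gt0 ?pi_gt0// exprn_gt0.
  congr (- _); rewrite -[in RHS](sqr_sqrtr (ltW p0)) lnXn ?sqrtr_gt0//.
  by move: (ln _) => L; field.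
by rewrite mulNr -[s ^+ 2 *+ 2]mulr_natl.
Qed.

Lemma ln_gauss3 m s v : 0 < s -> ln (gauss3 m s v) =
  - (3 / 2 * ln (2 * pi * s ^+ 2))
  - (\sum_(i < 3) (R3_coord i v - R3_coord i m) ^+ 2) / (2 * s ^+ 2).
Proof.
move=> s0; have sn0 : s != 0 by rewrite gt_eqF.
have ln3 (x y z : R) : 0 < x -> 0 < y -> 0 < z -> ln (x * y * z) = ln x + ln y + ln z.
  by move=> x0 y0 z0; rewrite !lnM ?posrE ?mulr_gt0.
rewrite /gauss3 [LHS]ln3 ?normal_pdf_gt0// !ln_normal_pdf//.
rewrite !big_ord_recl big_ord0 /R3_coord/= addr0.
by move: (ln _) => L; field.
Qed.

Lemma normal_pdf_measurable d (T : measurableType d) (f g : T -> R) (s : R) :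
  measurable_fun setT f -> measurable_fun setT g ->
  measurable_fun setT (fun x => normal_pdf (f x) s (g x)).
Proof.
move=> mf mg; have [->|s0] := eqVneq s 0.
  rewrite /normal_pdf eqxx; exact: measurableT_comp.
have -> : (fun x => normal_pdf (f x) s (g x)) =
    (fun x => normal_peak s * expR (- (g x - f x) ^+ 2 / (s ^+ 2 *+ 2))).
  by apply/funext => x; rewrite normal_pdfE.
apply: measurable_funM => //; apply: measurableT_comp => //.
apply: measurable_funM => //; apply: measurableT_comp => //.
by apply: measurable_funX; exact: measurable_funB.
Qed.

Lemma gauss3_measurable d (T : measurableType d) (f g : T -> R3) (s : R) :
  measurable_fun setT f -> measurable_fun setT g ->
  measurable_fun setT (fun x => gauss3 (f x) s (g x)).
Proof.
move=> mf mg.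
have c1 (h : T -> R3) : measurable_fun setT h -> measurable_fun setT (fun x => (h x).1.1).
  by move=> mh; apply: measurableT_comp => //; apply: measurableT_comp.
have c2 (h : T -> R3) : measurable_fun setT h -> measurable_fun setT (fun x => (h x).1.2).
  by move=> mh; apply: measurableT_comp => //; apply: measurableT_comp.
have c3 (h : T -> R3) : measurable_fun setT h -> measurable_fun setT (fun x => (h x).2).
  by move=> mh; apply: measurableT_comp.
rewrite /gauss3; do 2?apply: measurable_funM; apply: normal_pdf_measurable; auto.
Qed.

Lemma integral_gauss3 m s : s != 0 -> (\int[L3]_v (gauss3 m s v)%:E = 1)%E.
Proof.
move=> s0.
have mn a : measurable_fun [set: measurableTypeR R] (normal_pdf a s).
  exact: measurable_normal_pdf.
have n0 a x : 0 <= normal_pdf a s x by exact: normal_pdf_ge0.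
have h := @integral_product3_ge0 _ _ _ _ _ _ R lebesgue_measure lebesgue_measure
  lebesgue_measure _ _ _ (mn m.1.1) (mn m.1.2) (mn m.2) (n0 _) (n0 _) (n0 _).
by rewrite [LHS]h !integral_normal_pdf !mule1.
Qed.

End haar_integral.

(** * Entropy *)

Lemma ae_le_Rintegral d (T : measurableType d) (R : realType)
    (mu : {measure set T -> \bar R}) (f1 f2 : T -> R) :
  mu.-integrable setT (EFin \o f1) -> mu.-integrable setT (EFin \o f2) ->
  {ae mu, forall x, f1 x <= f2 x} ->
  (\int[mu]_x f1 x)%R <= (\int[mu]_x f2 x)%R.
Proof.
move=> i1 i2 f12.
have i21 : mu.-integrable setT (EFin \o (fun x => f2 x - f1 x)).
  have -> : EFin \o (fun x => f2 x - f1 x) = ((EFin \o f2) \- (EFin \o f1))%E.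
    by apply/funext => x /=; rewrite EFinB.
  exact: integrableB.
have : 0 <= (\int[mu]_x (f2 x - f1 x))%R.
  have m21 : measurable_fun setT (fun x => f2 x - f1 x).
    by apply/measurable_EFinP; exact: measurable_int i21.
  have -> : (\int[mu]_x (f2 x - f1 x))%R = (\int[mu]_x Num.max 0 (f2 x - f1 x))%R.
    congr fine; apply: ae_eq_integral => //.
    - exact/measurable_EFinP.
    - by apply/measurable_EFinP; exact: measurable_maxr.
    apply: filterS f12 => x h _; congr EFin; apply/esym/max_r.
    by rewrite subr_ge0.
  by apply: Rintegral_ge0 => x _; rewrite le_max lexx.
by rewrite RintegralB// subr_ge0.
Qed.

Lemma invr_measurable (R : realType) : measurable_fun setT (fun x : R => x^-1).
Proof.
have -> : [set: R] = [set x | x != 0] `|` [set 0].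
  apply/seteqP; split => // x _; have [->|x0] := eqVneq x 0; [by right|by left].
have o : open [set x : R | x != 0] by exact: open_neq.
apply/measurable_funU => //; first exact: open_measurable.
split; last exact: measurable_fun_set1.
apply: open_continuous_measurable_fun => // x; rewrite inE => x0.
exact: inv_continuous.
Qed.

Lemma gibbs_arith (R : realType) (x y z q w m : R) :
  w <= m -> y + q - x - z <= w - 1 -> - x - - y + - z <= m - 1 - q.
Proof. lra. Qed.

Section gibbs.
Variable R : realType.
Local Notation G := (PSL2 R).
Variable mt : {sigma_finite_measure set (PSL2 R) -> \bar R}.
Hypothesis hmt : is_haar mt.
Context d (T : measurableType d).
Variables (P : probability T R) (g s1 s2 : {RV P >-> G}).
Hypothesis ind : independent3 P g s1 s2.
Let X : {RV P >-> G} := mfun_mul g s1.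
Let Y : {RV P >-> G} := mfun_mul g s2.
Let law (Z : {RV P >-> G}) : probability G R := distribution P Z.
Hypotheses (X_mt : law X `<< mt) (Y_mt : law Y `<< mt) (s2_mt : law s2 `<< mt).
Let F1 := rn_density mt (law X).
Let F2 := rn_density mt (law Y).
Let f2 := rn_density mt (law s2).
Let F10 x : 0 <= F1 x. Proof. exact: rn_density_ge0. Qed.
Let F20 x : 0 <= F2 x. Proof. exact: rn_density_ge0. Qed.
Let f20 x : 0 <= f2 x. Proof. exact: rn_density_ge0. Qed.
Let mF1 : measurable_fun setT F1. Proof. exact: measurable_rn_density. Qed.
Let mF2 : measurable_fun setT F2. Proof. exact: measurable_rn_density. Qed.
Let mf2 : measurable_fun setT f2. Proof. exact: measurable_rn_density. Qed.

Variables (q : G * G -> R) (M : R).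
Hypotheses (mq : measurable_fun setT q) (q0 : forall z, 0 <= q z).
Hypothesis qM : forall y, (\int[mt]_x (q (y, x))%:E <= M%:E)%E.

Let M0 : 0 <= M.
Proof.
rewrite -lee_fin; apply: le_trans (qM 1%g); apply: integral_ge0 => x _.
by rewrite lee_fin.
Qed.

(** The ratio t of the overview as a function of z = (g, s1, s2), so that the three variables can be
    integrated separately. Where F1 or f2 vanishes its value is 0, by the convention on inverses. *)
Let weight (z : G * G * G) : R :=
  F2 (z.1.1 * z.2)%g * q (z.1.1 * z.2, z.1.1 * z.1.2)%g
  / (F1 (z.1.1 * z.1.2)%g * f2 z.2).

Let weight_ge0 z : 0 <= weight z.
Proof. by rewrite /weight divr_ge0// mulr_ge0. Qed.

Let weight_measurable : measurable_fun setT weight.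
Proof.
have m1 : measurable_fun setT (fun z : G * G * G => (z.1.1 * z.2)%g).
  by apply: PSL2_mul_measurable => //; do 2?apply: measurableT_comp => //.
have m2 : measurable_fun setT (fun z : G * G * G => (z.1.1 * z.1.2)%g).
  by apply: PSL2_mul_measurable; do 2?apply: measurableT_comp => //.
apply: measurable_funM; first apply: measurable_funM.
- exact: measurableT_comp.
- by apply: (measurableT_comp (f := q)) => //; exact: measurable_fun_pair.
apply: (measurableT_comp (f := fun x : R => x^-1)); first exact: invr_measurable.
by apply: measurable_funM; exact: measurableT_comp.
Qed.

(** When s2 is integrated first, its density cancels and left invariance turns g s2 into a Haar
    variable y; this removes g, and what remains depends on X only. The density of X cancels next,
    and after the exchange of x and y only the mass bound on q and the total mass 1 of F2 are
    left. *)
Lemma gibbs_weight_le :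
  (\int[P]_w (F2 (Y w) * q (Y w, X w) / (F1 (X w) * f2 (s2 w)))%:E <= M%:E)%E.
Proof.
have mE (Z : {RV P >-> G}) : measurable_fun setT Z by exact: measurable_funPT.
have mu (y : G) : measurable_fun setT (fun x : G => (y * x)%g).
  exact: PSL2_mul_measurable.
pose Q (x : G) : \bar R := (\int[mt]_y (F2 y * q (y, x) / F1 x)%:E)%E.
have mF2q : measurable_fun setT (fun z : G * G => F2 z.1 * q z).
  by apply: measurable_funM => //; exact: measurableT_comp.
have mQ : measurable_fun setT Q.
  apply: (@measurable_fun_fubini_tonelli_F _ _ _ _ _ mt (fun z : G * G =>
      (F2 z.2 * q (z.2, z.1) / F1 z.1)%:E)).
    apply/measurable_EFinP; apply: measurable_funM.
      apply: (measurableT_comp (f := fun z : G * G => F2 z.1 * q z)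
        (g := fun z : G * G => (z.2, z.1))) => //.
      exact: measurable_fun_pair.
    apply: (measurableT_comp (f := fun x : R => x^-1)); first exact: invr_measurable.
    exact: measurableT_comp.
  by move=> z; rewrite lee_fin divr_ge0// mulr_ge0.
have Q0 x : (0 <= Q x)%E.
  by apply: integral_ge0 => y _; rewrite lee_fin divr_ge0// mulr_ge0.
have mw : measurable_fun setT (EFin \o weight) by exact/measurable_EFinP.
have mQx (x : G) : measurable_fun setT (fun y => (F2 y * q (y, x) / F1 x)%:E).
  apply/measurable_EFinP; apply: measurable_funM => //.
  by apply: (measurableT_comp (f := fun z : G * G => F2 z.1 * q z)
    (g := fun y : G => (y, x))) => //; exact: measurable_fun_pair.
have := independent3_integral ind mw (fun z => weight_ge0 z).
rewrite /= => ->.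
apply: (@le_trans _ _ (\int[P]_w Q (X w))%E).
  apply: ge0_le_integral => //.
  - by move=> w _; apply: integral_ge0 => z _; rewrite lee_fin.
  - apply: (measurableT_comp (f := fubini_F (law s2) (EFin \o weight))
      (g := fun w => (g w, s1 w))).
      by apply: measurable_fun_fubini_tonelli_F => // z; rewrite lee_fin.
    exact: measurable_fun_pair.
  - exact: measurableT_comp.
  move=> w _.
  rewrite (integral_rn_density s2_mt)//; last 2 first.
  - by move=> z; rewrite lee_fin.
  - exact: measurable_fun_pair2 mw.
  (* The substitution y = g z in the Haar integral defining [Q], with X = g s1 held fixed. *)
  rewrite -/f2 /Q -(haar_translate hmt (g w)); last 2 first.
  - exact: mQx.
  - by move=> z; rewrite lee_fin divr_ge0// mulr_ge0.
  apply: ge0_le_integral => //.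
  - by move=> z _; rewrite lee_fin mulr_ge0.
  - apply: emeasurable_funM; first exact: measurable_fun_pair2 mw.
    exact/measurable_EFinP.
  - exact: measurableT_comp (mQx (X w)) (mu (g w)).
  move=> z _; rewrite -EFinM lee_fin /weight/= invfM mulrA -[leLHS]mulrA.
  rewrite -[X in _ <= X]mulr1 ler_wpM2l//.
    by rewrite mulr_ge0 ?invr_ge0// mulr_ge0.
  (* Only an inequality is available: where f2 vanishes the left side is 0. *)
  have [->|z0] := eqVneq (f2 z) 0; first by rewrite mulr0.
  by rewrite mulVf.
rewrite -(ge0_integral_distribution X mQ Q0) (integral_rn_density X_mt Q0 mQ) -/F1.
pose H (x y : G) : \bar R := (F2 y * q (y, x))%:E.
have mH : measurable_fun setT (fun z : G * G => H z.1 z.2).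
  apply/measurable_EFinP.
  apply: (measurableT_comp (f := fun z : G * G => F2 z.1 * q z)
    (g := fun z : G * G => (z.2, z.1))) => //.
  exact: measurable_fun_pair.
have H0 x y : (0 <= H x y)%E by rewrite lee_fin mulr_ge0.
have mJ : measurable_fun setT (fun x => \int[mt]_y H x y)%E.
  by apply: (@measurable_fun_fubini_tonelli_F _ _ _ _ _ mt (fun z : G * G => H z.1 z.2)).
apply: (@le_trans _ _ (\int[mt]_x \int[mt]_y H x y)%E).
  apply: ge0_le_integral => //.
  - by move=> x _; rewrite mule_ge0// lee_fin.
  - by apply: emeasurable_funM => //; exact/measurable_EFinP.
  move=> x _; rewrite /Q -ge0_integralZr//; last 2 first.
  - by move=> y _; rewrite lee_fin divr_ge0// mulr_ge0.
  - by rewrite lee_fin.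
  apply: ge0_le_integral => //.
  - by move=> y _; rewrite mule_ge0// lee_fin ?divr_ge0// mulr_ge0.
  - by apply: emeasurable_funM => //; exact: mQx.
  - exact: measurable_fun_pair2 mH.
  move=> y _; rewrite -EFinM lee_fin -[leRHS]mulr1 -[leLHS]mulrA ler_wpM2l ?mulr_ge0//.
  have [->|x0] := eqVneq (F1 x) 0; first by rewrite mulr0.
  by rewrite mulVf.
rewrite (fubini_tonelli (m1 := mt) (m2 := mt) _ mH (fun z => H0 z.1 z.2)).
apply: (@le_trans _ _ (\int[mt]_y (M%:E * (F2 y)%:E))%E).
  apply: ge0_le_integral => //.
  - by move=> y _; apply: integral_ge0.
  - exact: (@measurable_fun_fubini_tonelli_G _ _ _ _ _ mt (fun z : G * G => H z.1 z.2)).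
  - by apply: emeasurable_funM => //; exact/measurable_EFinP.
  move=> y _; rewrite /H/=.
  under eq_integral do rewrite EFinM.
  rewrite ge0_integralZl_EFin//; last 2 first.
  - by move=> x _; rewrite lee_fin.
  - by apply/measurable_EFinP; exact: measurable_fun_pair2.
  by rewrite muleC lee_wpmul2r// lee_fin.
rewrite ge0_integralZl_EFin//; last 2 first.
- by move=> y _; rewrite lee_fin.
- exact/measurable_EFinP.
have -> : (\int[mt]_y (F2 y)%:E = 1)%E.
  rewrite -(@probability_setT _ _ _ (law Y)).
  rewrite (Radon_Nikodym_SigmaFinite.f_integral Y_mt measurableT).
  by apply: eq_integral => y _; rewrite /F2 rn_densityE.
by rewrite mule1.
Qed.

Lemma ae_distribution (Z : {RV P >-> G}) (A : G -> Prop) :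
  {ae law Z, forall x, A x} -> {ae P, forall w, A (Z w)}.
Proof.
move=> [N [mN N0 NA]]; exists (Z @^-1` N); split.
- by rewrite -[X in measurable X]setTI; exact: measurable_funPT.
- exact: N0.
- by move=> w /= nA; exact: NA.
Qed.

Lemma integrable_distribution (Z : {RV P >-> G}) (f : G -> R) :
  (law Z).-integrable setT (EFin \o f) -> P.-integrable setT (EFin \o (f \o Z)).
Proof.
move=> /integrableP[mf fi]; apply/integrableP; split.
  exact: (measurableT_comp (f := EFin \o f)).
by move: fi; rewrite ge0_integral_distribution//; exact: measurableT_comp.
Qed.

Lemma entropy_distribution (Z : {RV P >-> G}) : law Z `<< mt ->
  finite_entropy mt (law Z) ->
  P.-integrable setT (EFin \o (fun w => ln (rn_density mt (law Z) (Z w)))) /\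
  entropy mt (law Z) = - (\int[P]_w ln (rn_density mt (law Z) (Z w)))%R.
Proof.
move=> Zmt fe; have i := integrable_ln_rn_density Zmt fe.
have iP := integrable_distribution i; split => //.
rewrite entropyE// /Rintegral; congr (- fine _).
by rewrite integral_distribution//; exact: measurable_int i.
Qed.

Lemma gibbs_entropy : finite_entropy mt (law X) -> finite_entropy mt (law Y) ->
  finite_entropy mt (law s2) ->
  P.-integrable setT (EFin \o (fun w => ln (q (Y w, X w)))) ->
  {ae P, forall w, 0 < q (Y w, X w)} ->
  entropy mt (law X) - entropy mt (law Y) + entropy mt (law s2) <=
    M - 1 - (\int[P]_w ln (q (Y w, X w)))%R.
Proof.
move=> feX feY fe2 iq qpos.
have [iX ->] := entropy_distribution X_mt feX.
have [iY ->] := entropy_distribution Y_mt feY.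
have [i2 ->] := entropy_distribution s2_mt fe2.
pose W w := F2 (Y w) * q (Y w, X w) / (F1 (X w) * f2 (s2 w)).
have mW : measurable_fun setT W.
  apply: (measurableT_comp (f := weight) (g := fun w => (g w, s1 w, s2 w))) => //.
  by apply: measurable_fun_pair => //; exact: measurable_fun_pair.
have W0 w : 0 <= W w by rewrite divr_ge0// mulr_ge0.
have iW : P.-integrable setT (EFin \o W).
  apply/integrableP; split; first exact/measurable_EFinP.
  under eq_integral do rewrite /= ger0_norm//.
  by apply: le_lt_trans gibbs_weight_le _; rewrite ltry.
have WM : (\int[P]_w W w)%R <= M.
  have := gibbs_weight_le; rewrite -lee_fin /Rintegral fineK//.
  by apply: integrable_fin_num.
have i1 : P.-integrable setT (EFin \o (cst 1 : T -> R)).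
  exact: finite_measure_integrable_cst.
pose L w := ln (F2 (Y w)) + ln (q (Y w, X w)) - ln (F1 (X w)) - ln (f2 (s2 w)).
have iYq : P.-integrable setT (EFin \o (fun w => ln (F2 (Y w)) + ln (q (Y w, X w)))).
  exact: (integrableD measurableT iY iq).
have iYqX : P.-integrable setT (EFin \o (fun w => ln (F2 (Y w)) + ln (q (Y w, X w)) - ln (F1 (X w)))).
  exact: (integrableB measurableT iYq iX).
have iL : P.-integrable setT (EFin \o L).
  exact: (integrableB measurableT iYqX i2).
have iW1 : P.-integrable setT (EFin \o (fun w => W w - cst 1 w)).
  exact: (integrableB measurableT iW i1).
have : (\int[P]_w L w)%R <= (\int[P]_w (W w - cst 1 w))%R.
  apply: ae_le_Rintegral => //.
  (* A density is almost surely positive under its own law. Together with [qpos] this makes all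
     factors of W positive, so that its logarithm splits. *)
  have h1 := ae_distribution (rn_density_gt0 X_mt).
  have h2 := ae_distribution (rn_density_gt0 Y_mt).
  have h3 := ae_distribution (rn_density_gt0 s2_mt).
  apply: filterS2 (filterI h1 h2) (filterI h3 qpos) => w [x0 y0] [z0 q1].
  have -> : L w = ln (W w).
    rewrite /L /W ln_div ?posrE ?mulr_gt0// !lnM ?posrE//.
    by rewrite opprD addrA.
  have Wp : 0 < W w by rewrite divr_gt0 ?mulr_gt0.
  have := @le_ln1Dx R (W w - 1); by rewrite (addrC 1) subrK; apply; rewrite ltrBrDr addNr.
rewrite /L RintegralB// RintegralB// RintegralD// RintegralB// Rintegral_cst//.
rewrite mul1r; set p := fine (P _); have -> : p = 1 by rewrite /p probability_setT.
by rewrite -/F1 -/F2 -/f2; exact: gibbs_arith.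
Qed.

End gibbs.

(** * Bounded random variables *)

Section bounded_measurable.
Context d (T : measurableType d) (R : realType) (P : probability T R).
Implicit Types f g : T -> R.

(** This class is closed under sums and products and integrable under every probability, so
    integrability of the quadratic expressions below follows from their shape. *)
Definition bounded_measurable f :=
  measurable_fun setT f /\ exists c, forall w, `|f w| <= c.

Lemma bounded_measurable_integrable f : bounded_measurable f ->
  P.-integrable setT (EFin \o f).
Proof.
move=> [mf [c fc]]; apply: measurable_bounded_integrable => //.
  by rewrite -ge0_fin_numE// fin_num_measure.
exists c; split; first exact: num_real.
by move=> x cx w _ /=; rewrite (le_trans (fc w))// ltW.
Qed.

Lemma bounded_measurable_cst c : bounded_measurable (cst c).
Proof. by split => //; exists `|c|. Qed.

Lemma bounded_measurableD f g : bounded_measurable f -> bounded_measurable g ->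
  bounded_measurable (fun w => f w + g w).
Proof.
move=> [mf [c fc]] [mg [e ge]]; split; first exact: measurable_funD.
by exists (c + e) => w; rewrite (le_trans (ler_normD _ _))// lerD.
Qed.

Lemma bounded_measurableB f g : bounded_measurable f -> bounded_measurable g ->
  bounded_measurable (fun w => f w - g w).
Proof.
move=> [mf [c fc]] [mg [e ge]]; split; first exact: measurable_funB.
by exists (c + e) => w; rewrite (le_trans (ler_normB _ _))// lerD.
Qed.

Lemma bounded_measurableM f g : bounded_measurable f -> bounded_measurable g ->
  bounded_measurable (fun w => f w * g w).
Proof.
move=> [mf [c fc]] [mg [e ge]]; split; first exact: measurable_funM.
by exists (c * e) => w; rewrite normrM ler_pM.
Qed.

Lemma bounded_measurable_sqr f : bounded_measurable f ->
  bounded_measurable (fun w => f w ^+ 2).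
Proof. by move=> bf; exact: bounded_measurableM. Qed.

Lemma bounded_measurable_sum (n : nat) (f : 'I_n -> T -> R) :
  (forall i, bounded_measurable (f i)) ->
  bounded_measurable (fun w => \sum_(i < n) f i w).
Proof.
elim: n f => [|n IH] f bf.
  rewrite (_ : (fun w => _) = cst 0); first exact: bounded_measurable_cst.
  by apply/funext => w; rewrite big_ord0.
rewrite (_ : (fun w => _) = fun w => \sum_(i < n) f (widen_ord (leqnSn n) i) w + f ord_max w).
  by apply: bounded_measurableD => //; exact: (IH (fun i => f (widen_ord (leqnSn n) i))).
by apply/funext => w; rewrite big_ord_recr.
Qed.

Lemma Rintegral_sum (n : nat) (f : 'I_n -> T -> R) :
  (forall i, bounded_measurable (f i)) ->
  (\int[P]_w \sum_(i < n) f i w)%R = \sum_(i < n) (\int[P]_w f i w)%R.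
Proof.
elim: n f => [|n IH] f bf.
  rewrite big_ord0; under eq_Rintegral do rewrite big_ord0.
  by rewrite Rintegral_cst// mul0r.
rewrite big_ord_recr/= -IH//; under eq_Rintegral do rewrite big_ord_recr/=.
rewrite RintegralD//; apply: bounded_measurable_integrable => //.
exact: (bounded_measurable_sum (f := fun i => f (widen_ord (leqnSn n) i))).
Qed.

Lemma ae_eq_Rintegral f g : measurable_fun setT f -> measurable_fun setT g ->
  {ae P, forall w, f w = g w} -> (\int[P]_w f w)%R = (\int[P]_w g w)%R.
Proof.
move=> mf mg fg; congr fine; apply: ae_eq_integral => //.
- exact/measurable_EFinP.
- exact/measurable_EFinP.
by apply: filterS fg => w -> _.
Qed.

Lemma ae_eq_integrable f g : measurable_fun setT f ->
  {ae P, forall w, f w = g w} -> P.-integrable setT (EFin \o g) ->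
  P.-integrable setT (EFin \o f).
Proof.
move=> mf fg /integrableP[mg ig]; apply/integrableP; split.
  exact/measurable_EFinP.
rewrite (ae_eq_integral (fun w => `|(EFin \o g) w|)%E)//.
- by apply: measurableT_comp => //; exact/measurable_EFinP.
- exact: measurableT_comp.
by apply: filterS fg => w /= -> _.
Qed.

(** The projection to [-c, c] when c >= 0. The coordinates of log s1 and log s2 are bounded only
    almost surely; the clamped ones agree with them almost surely and are bounded everywhere. *)
Definition clamp (c x : R) := Num.max (- c) (Num.min c x).

Lemma clamp_le c x : 0 <= c -> `|clamp c x| <= c.
Proof.
move=> c0; rewrite /clamp ler_norml; apply/andP; split; first by rewrite le_max lexx.
by rewrite ge_max ge_min lexx andbT ge0_cp.
Qed.

Lemma clamp_id c x : `|x| <= c -> clamp c x = x.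
Proof.
by rewrite ler_norml => /andP[h1 h2]; rewrite /clamp (min_idPr h2) (max_idPr h1).
Qed.

Lemma clamp_dist_le c x y : `|x| <= c -> (x - clamp c y) ^+ 2 <= (x - y) ^+ 2.
Proof.
rewrite ler_norml /clamp => /andP[h1 h2].
have [yc|cy] := leP c y.
  have [?|?] := leP c (- c); nra.
have [?|?] := leP (- c) y; nra.
Qed.

Lemma clamp_measurable c f : measurable_fun setT f ->
  measurable_fun setT (fun w => clamp c (f w)).
Proof. by move=> mf; apply: measurable_maxr => //; exact: measurable_minr. Qed.

Lemma clamp_bounded_measurable c f : 0 <= c -> measurable_fun setT f ->
  bounded_measurable (fun w => clamp c (f w)).
Proof.
move=> c0 mf; split; first exact: clamp_measurable.
by exists c => w; exact: clamp_le.
Qed.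

End bounded_measurable.

Section independence_product.
Context d d' (T : measurableType d) (G : measurableType d') (R : realType).
Variables (P : probability T R) (X Y Z : {RV P >-> G}).
Hypothesis ind : independent3 P X Y Z.

(** Tonelli asks for nonnegative integrands, so u and v are shifted by their bounds; the extra terms
    of the expanded product cancel. *)
Lemma independent3_Rintegral_mul (u : G * G -> R) (v : G -> R) :
  bounded_measurable u -> bounded_measurable v ->
  (\int[P]_w (u (X w, Y w) * v (Z w)))%R =
  (\int[P]_w u (X w, Y w))%R * (\int[P]_w v (Z w))%R.
Proof.
move=> [mu [c uc]] [mv [e ve]].
have mXY : measurable_fun setT (fun w => (X w, Y w)).
  by apply: measurable_fun_pair; exact: measurable_funPT.
have bu : bounded_measurable (fun w => u (X w, Y w)).
  by split; [exact: measurableT_comp|exists c].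
have bv : bounded_measurable (fun w => v (Z w)).
  by split; [exact: measurableT_comp|exists e].
have bc (k : R) : bounded_measurable (fun _ : T => k) by exact: bounded_measurable_cst.
have uc0 z : 0 <= u z + c by have := uc z; rewrite ler_norml => /andP[]; lra.
have ve0 z : 0 <= v z + e by have := ve z; rewrite ler_norml => /andP[]; lra.
have i1 := bounded_measurable_integrable P (bounded_measurableD bu (bc c)).
have i2 := bounded_measurable_integrable P (bounded_measurableD bv (bc e)).
have key : (\int[P]_w ((u (X w, Y w) + c) * (v (Z w) + e)))%R =
    (\int[P]_w (u (X w, Y w) + c))%R * (\int[P]_w (v (Z w) + e))%R.
  have mf : measurable_fun setT (fun z : G * G * G => ((u z.1 + c) * (v z.2 + e))%:E).
    apply/measurable_EFinP; apply: measurable_funM; apply: measurable_funD => //;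
      exact: measurableT_comp.
  have := independent3_integral ind mf (fun z => mulr_ge0 (uc0 z.1) (ve0 z.2)).
  rewrite /= /Rintegral => ->.
  have mv' : measurable_fun setT (fun z => (v z + e)%:E).
    by apply/measurable_EFinP; exact: measurable_funD.
  have E w : (\int[distribution P Z]_z ((u (X w, Y w) + c) * (v z + e))%:E =
      (u (X w, Y w) + c)%:E * \int[P]_w (v (Z w) + e)%:E)%E.
    under eq_integral do rewrite EFinM.
    rewrite ge0_integralZl_EFin//; last by move=> z _; rewrite lee_fin.
    by rewrite (ge0_integral_distribution Z mv' (fun z => ve0 z)).
  rewrite [X in fine X = _](eq_integral (fun w => (u (X w, Y w) + c)%:E *
    \int[P]_w (v (Z w) + e)%:E)%E); last by move=> w _; exact: E.
  have fin : (\int[P]_w (v (Z w) + e)%:E)%E \is a fin_num by exact: integrable_fin_num i2.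
  rewrite -(fineK fin) ge0_integralZr//; last 3 first.
  - exact: measurable_int i1.
  - by move=> w _; rewrite lee_fin.
  - by rewrite lee_fin fine_ge0// integral_ge0// => w _; rewrite lee_fin.
  rewrite fineM//; exact: integrable_fin_num i1.
have ib f : bounded_measurable f -> P.-integrable setT (EFin \o f).
  exact: bounded_measurable_integrable.
have cst k : (\int[P]_w (k : R))%R = k.
  rewrite Rintegral_cst//; set p := fine (P _).
  have -> : p = 1 by rewrite /p probability_setT.
  by rewrite mulr1.
move: key; rewrite !RintegralD ?cst//; [|exact: ib..].
have -> : (\int[P]_w ((u (X w, Y w) + c) * (v (Z w) + e)))%R =
    (\int[P]_w (u (X w, Y w) * v (Z w) + (u (X w, Y w) * e + (c * v (Z w) + c * e))))%R.
  by apply: eq_Rintegral => w _; ring.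
have b1 : bounded_measurable (fun w => u (X w, Y w) * v (Z w)).
  exact: bounded_measurableM.
have b2 : bounded_measurable (fun w => u (X w, Y w) * e) by exact: bounded_measurableM.
have b3 : bounded_measurable (fun w => c * v (Z w)) by exact: bounded_measurableM.
have b4 : bounded_measurable (fun w => c * v (Z w) + c * e) by exact: bounded_measurableD.
have b5 : bounded_measurable (fun w => u (X w, Y w) * e + (c * v (Z w) + c * e)).
  exact: bounded_measurableD.
rewrite !RintegralD ?cst//; [|exact: ib..].
rewrite RintegralZl//; last exact: ib.
rewrite RintegralZr//; last exact: ib.
lra.
Qed.

End independence_product.

Section kernel_Rintegral.
Context d d' (T : measurableType d) (G : measurableType d') (R : realType).
Variable kappa : T -> pprobability G R.
Hypothesis mkappa : measurable_fun setT kappa.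

Lemma kernel_Rintegral_measurable (f : T * G -> R) : measurable_fun setT f ->
  measurable_fun setT
    (fun w => (\int[kappa w : probability G R]_x f (w, x))%R).
Proof.
move=> mf; apply: measurableT_comp => //.
under eq_fun do rewrite integralE.
have mE : measurable_fun setT (EFin \o f) by exact/measurable_EFinP.
have hp := kernel_integral_measurable mkappa (measurable_funepos mE)
  (fun z => funepos_ge0 _ z).
have hn := kernel_integral_measurable mkappa (measurable_funeneg mE)
  (fun z => funeneg_ge0 _ z).
rewrite (_ : (fun w => _) = fun w => (\int[kappa w : probability G R]_x (EFin \o f)^\+ (w, x)
    - \int[kappa w : probability G R]_x (EFin \o f)^\- (w, x))%E).
  exact: emeasurable_funB.
apply/funext => w; congr (_ - _)%E; apply: eq_integral => x _.
  by rewrite !funeposE.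
by rewrite !funenegE.
Qed.

End kernel_Rintegral.

Lemma tr_PSL2_Var (R : realType) (b : 3.-tuple 'M[R]_2) (V : set (R * R * R))
    d (T : measurableType d) (P : probability T R) (g0 : PSL2 R)
    (X : T -> PSL2 R) :
  let f i w := R3_coord i (PSL2_log b V (g0^-1 * X w)%g) in
  \tr (PSL2_Var b V P g0 X) =
  \sum_(i < 3) (\int[P]_w (f i w - (\int[P]_w f i w)%R) ^+ 2)%R.
Proof.
move=> f; apply: eq_bigr => i _; rewrite mxE covariance.unlock !expectation.unlock.
by [].
Qed.

Lemma R3_coordB (R : realType) (i : 'I_3) (u v : R * R * R) :
  R3_coord i (u - v) = R3_coord i u - R3_coord i v.
Proof. by case: u v => [[? ?] ?] [[? ?] ?]; case: i => -[|[|[|//]]] ?. Qed.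

Definition R3_of (R : realType) (f : 'I_3 -> R) : R * R * R := (f 0, f 1, f 2).

Lemma R3_coord_of (R : realType) (f : 'I_3 -> R) i : R3_coord i (R3_of f) = f i.
Proof. by case: i => -[|[|[|//]]] ?; congr f; exact: val_inj. Qed.

(** * The entropy estimate near the identity *)

Section local_estimate.
Variables (R : realType) (b : 3.-tuple 'M[R]_2) (V : set (R * R * R)).
Hypotheses (hb : basis_of (sl2 R) b) (hV : is_log_domain b V).
Variable mt : {sigma_finite_measure set (PSL2 R) -> \bar R}.
Hypothesis (hmt : is_haar mt).
Local Notation R3 := (R * R * R)%type.
Local Notation G := (PSL2 R).
Local Notation Exp := (PSL2_exp b).
Local Notation Log := (PSL2_log b V).
Local Notation L3 := ((@lebesgue_measure R \x @lebesgue_measure R)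
  \x @lebesgue_measure R)%E.
Let lg i (x : G) := R3_coord i (Log x).
Let mlg i : measurable_fun setT (lg i).
Proof. exact: PSL2_log_measurable. Qed.

(** [delta] bounds log s1 and log s2, [r] bounds log (Y^-1 X), [err] bounds its distance from log s1
    - log s2, and 1 + [Mq] bounds the mass of q. In the theorem they are O(eps), O(eps), O(eps^2)
    and O(eps). *)
Variables (delta r err Mq : R).
Hypotheses (delta0 : 0 <= delta) (delta_r : delta <= r) (err0 : 0 <= err).
Hypothesis cubeV : cube (0 : R3) r `<=` V.
Hypothesis log_mul : forall u v : R3, `|u| <= delta -> `|v| <= delta ->
  exists w, [/\ Exp w = ((Exp u)^-1 * Exp v)%g, `|w - (v - u)| <= err & `|w| <= r].
Hypothesis mass : forall psi : R3 -> \bar R, measurable_fun setT psi ->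
  (forall v, 0 <= psi v)%E ->
  (\int[mt]_(x in Exp @` cube 0%R r) psi (Log x) <=
   (1 + Mq)%:E * \int[L3]_v psi v)%E.

Context d (T : measurableType d).
Variables (P : probability T R) (g s1 s2 : {RV P >-> G}).
Hypothesis ind : independent3 P g s1 s2.
Let X : {RV P >-> G} := mfun_mul g s1.
Let Y : {RV P >-> G} := mfun_mul g s2.
Let law (Z : {RV P >-> G}) : probability G R := distribution P Z.
Hypothesis as1 : {ae P, forall w, exists2 v, s1 w = Exp v & `|v| <= delta}.
Hypothesis as2 : {ae P, forall w, exists2 v, s2 w = Exp v & `|v| <= delta}.
Let a i (w : T) := clamp delta (lg i (s1 w)).
Let sg i (w : T) := clamp delta (lg i (s2 w)).
Let alpha i := (\int[P]_w a i w)%R.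

Let mRV (Z : {RV P >-> G}) : measurable_fun setT Z.
Proof. exact: measurable_funPT. Qed.

Lemma log_small v i : `|v| <= delta -> lg i (Exp v) = R3_coord i v /\
  clamp delta (lg i (Exp v)) = R3_coord i v.
Proof.
move=> vd; have Vv : V v.
  by apply: cubeV; rewrite /cube/= subr0 (le_trans vd).
rewrite /lg PSL2_expK//; split => //; apply: clamp_id.
exact: le_trans (R3_coord_le _ _) vd.
Qed.

Lemma log_inv_small v i : `|v| <= delta -> lg i (Exp v)^-1%g = - R3_coord i v.
Proof.
move=> vd; rewrite -(PSL2_expN hb).
have nvd : `|- v| <= delta by rewrite normrN.
have [-> _] := log_small i nvd.
by case: v {vd nvd} => [[? ?] ?]; case: i => -[|[|[|//]]] ?.
Qed.

Let ba i : bounded_measurable (a i).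
Proof. by apply: clamp_bounded_measurable => //; exact: measurableT_comp. Qed.

Let bsg i : bounded_measurable (sg i).
Proof. by apply: clamp_bounded_measurable => //; exact: measurableT_comp. Qed.

Let alpha_le i : `|alpha i| <= delta.
Proof.
have ia := bounded_measurable_integrable P (ba i).
rewrite (le_trans (le_normr_Rintegral _ ia))//.
have ic : P.-integrable setT (EFin \o (cst delta : T -> R)).
  exact: finite_measure_integrable_cst.
have := le_Rintegral measurableT (integrable_norm ia) ic
  (fun w _ => clamp_le (lg i (s1 w)) delta0).
rewrite Rintegral_cst//; set p := fine (P _).
have -> : p = 1 by rewrite /p probability_setT.
by rewrite mulr1.
Qed.

Section center.
Variables mu : 'I_3 -> G -> R.
Hypotheses (mmu : forall i, measurable_fun setT (mu i))
  (mu_le : forall i y, `|mu i y| <= delta).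
Let v i (w : T) := sg i w + mu i (Y w).
Let u i (w : T) := a i w - alpha i.

Let bmuY i : bounded_measurable (fun w => mu i (Y w)).
Proof. by split; [exact: measurableT_comp|exists delta => w]. Qed.

Let bv i : bounded_measurable (v i).
Proof. exact: bounded_measurableD. Qed.

Let bu i : bounded_measurable (u i).
Proof. apply: bounded_measurableB => //; exact: bounded_measurable_cst. Qed.

Lemma cross_term i : (\int[P]_w (u i w * v i w))%R = 0.
Proof.
(* This lemma separates the third variable from the first two, hence the exchange of s1 and s2. *)
have := @independent3_Rintegral_mul _ _ _ _ _ P g s2 s1 (independent3_swap ind)
  (fun z => clamp delta (lg i z.2) + mu i (z.1 * z.2)%g)
  (fun x => clamp delta (lg i x) - alpha i).
have b1 : bounded_measurable (fun z : G * G => clamp delta (lg i z.2) + mu i (z.1 * z.2)%g).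
  apply: bounded_measurableD.
    by apply: clamp_bounded_measurable => //; exact: measurableT_comp.
  split; last by exists delta => z.
  by apply: (measurableT_comp (f := mu i)) => //; exact: PSL2_mul_measurable.
have b2 : bounded_measurable (fun x : G => clamp delta (lg i x) - alpha i).
  apply: bounded_measurableB; last exact: bounded_measurable_cst.
  exact: clamp_bounded_measurable.
move=> /(_ b1 b2).
rewrite (_ : (\int[P]_w (clamp delta (lg i (s1 w)) - alpha i))%R = 0) ?mulr0.
  by move=> <-; apply: eq_Rintegral => w _; rewrite mulrC.
rewrite RintegralB//; last 2 first.
- exact: bounded_measurable_integrable (ba i).
- exact: finite_measure_integrable_cst.
rewrite Rintegral_cst//; set p := fine (P _).
have -> : p = 1 by rewrite /p probability_setT.
by rewrite mulr1 subrr.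
Qed.

Lemma quotient_log : {ae P, forall w,
  (Exp @` cube 0 r) ((Y w)^-1 * X w)%g /\
  forall i, `|lg i ((Y w)^-1 * X w)%g - (a i w - sg i w)| <= err /\
    `|lg i ((Y w)^-1 * X w)%g| <= r}.
Proof.
apply: filterS2 as1 as2 => w [v1 s1E v1d] [v2 s2E v2d].
have [z [zE zd zr]] := log_mul v2d v1d.
have -> : ((Y w)^-1 * X w)%g = Exp z.
  by rewrite zE -s1E -s2E /X /Y /= /mfun_mul invgM -mulgA (mulgA (g w)^-1%g) mulVg mul1g.
split; first by exists z; [rewrite /cube/= subr0|reflexivity].
move=> i; have Vz : V z by apply: cubeV; rewrite /cube/= subr0.
rewrite /lg PSL2_expK// -/(lg i _); split; last exact: le_trans (R3_coord_le _ _) zr.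
have -> : a i w = R3_coord i v1 by rewrite /a s1E; exact: (log_small i v1d).2.
have -> : sg i w = R3_coord i v2 by rewrite /sg s2E; exact: (log_small i v2d).2.
rewrite -!R3_coordB; exact: le_trans (R3_coord_le _ _) zd.
Qed.

Variable s : R.
Hypothesis s0 : 0 < s.
Let m y : R3 := R3_of (fun i => alpha i + mu i y).
Let E := Exp @` cube 0 r.
Let q (z : G * G) : R :=
  \1_E (z.1^-1 * z.2)%g * gauss3 (m z.1) s (Log (z.1^-1 * z.2)%g).

Let mE : measurable E.
Proof. by apply: (PSL2_exp_compact_measurable hb); exact: cube_compact. Qed.

Let mquot : measurable_fun setT (fun z : G * G => (z.1^-1 * z.2)%g).
Proof.
apply: PSL2_mul_measurable; last exact: measurable_snd.
by apply: PSL2_inv_measurable; exact: measurable_fst.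
Qed.

Let m_measurable : measurable_fun setT m.
Proof.
apply: R3_measurable_fun => i.
under eq_fun do rewrite R3_coord_of.
exact: measurable_funD.
Qed.

Let q_measurable : measurable_fun setT q.
Proof.
apply: measurable_funM.
  by apply: (measurableT_comp (f := \1_E : G -> R)); [exact: measurable_indic|exact: mquot].
apply: gauss3_measurable; first exact: (measurableT_comp m_measurable).
by apply: (measurableT_comp (Log_measurable hb hV)); exact: mquot.
Qed.

Let q_ge0 z : 0 <= q z.
Proof. by rewrite mulr_ge0 ?gauss3_ge0. Qed.

Let q_mass y : (\int[mt]_x (q (y, x))%:E <= (1 + (1 + Mq) - 1)%:E)%E.
Proof.
pose F x := (\1_E x * gauss3 (m y) s (Log x))%:E.
have mF : measurable_fun setT F.
  apply/measurable_EFinP; apply: measurable_funM; first exact: measurable_indic.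
  by apply: gauss3_measurable; [exact: measurable_cst|exact: Log_measurable].
have F0 x : (0 <= F x)%E by rewrite lee_fin mulr_ge0 ?gauss3_ge0.
(* Left invariance replaces y^-1 x by x. The mass is then compared with the full Gaussian integral,
   uniformly in y. *)
rewrite (haar_translate hmt y^-1%g mF F0).
have -> : (\int[mt]_x F x = \int[mt]_(x in E) (gauss3 (m y) s (Log x))%:E)%E.
  rewrite [RHS]integral_mkcond; apply: eq_integral => x _; rewrite patchE /F indicE.
  by case: (x \in E); rewrite ?mul1r ?mul0r.
have mg : measurable_fun setT (fun w : R3 => (gauss3 (m y) s w)%:E).
  by apply/measurable_EFinP; apply: gauss3_measurable; [exact: measurable_cst|exact: measurable_id].
have g0 (w : R3) : (0 <= (gauss3 (m y) s w)%:E)%E by rewrite lee_fin gauss3_ge0.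
apply: le_trans (mass mg g0) _.
rewrite integral_gauss3 ?gt_eqF// mule1 lee_fin; lra.
Qed.

Let l i w := clamp r (lg i ((Y w)^-1 * X w)%g).
(** The logarithm of the Gaussian density at its mean is -c0. *)
Let c0 := 3 / 2 * ln (2 * pi * s ^+ 2).
Let dist2 w := \sum_(i < 3) (l i w - (alpha i + mu i (Y w))) ^+ 2.

Let r0 : 0 <= r. Proof. exact: le_trans delta_r. Qed.

Let bl i : bounded_measurable (l i).
Proof.
apply: clamp_bounded_measurable => //; apply: (measurableT_comp (mlg i)).
by apply: PSL2_mul_measurable; [apply: PSL2_inv_measurable|]; exact: mRV.
Qed.

Let bdist2 : bounded_measurable dist2.
Proof.
apply: bounded_measurable_sum => i; apply: bounded_measurable_sqr.
apply: bounded_measurableB => //; apply: bounded_measurableD => //.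
exact: bounded_measurable_cst.
Qed.

Let q_log : {ae P, forall w, 0 < q (Y w, X w) /\
  ln (q (Y w, X w)) = - c0 - dist2 w / (2 * s ^+ 2)}.
Proof.
apply: filterS quotient_log => w [Ew lw]; rewrite /q/=.
have -> : \1_E ((Y w)^-1 * X w)%g = 1 :> R by rewrite indicE mem_set.
rewrite mul1r gauss3_gt0 ?gt_eqF// ln_gauss3//; split => //.
congr (_ - _ / _); apply: eq_bigr => i _; rewrite R3_coord_of -/(lg i _).
by rewrite /l clamp_id//; exact: (lw i).2.
Qed.

(** If log (Y^-1 X) is off by x in a coordinate, (u - v + x)^2 exceeds (u - v)^2 by at most 2 |u -
    v| |x| + x^2, where |u - v| <= 4 delta and |x| <= err. The factor 3 counts coordinates. *)
Let K3 := 3 * (8 * delta * err + err ^+ 2).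

Let dist2_le : {ae P, forall w, dist2 w <=
  \sum_(i < 3) (u i w ^+ 2 + v i w ^+ 2 - 2 * (u i w * v i w)) + K3}.
Proof.
apply: filterS quotient_log => w [_ lw].
have -> : K3 = \sum_(i < 3) (8 * delta * err + err ^+ 2).
  by rewrite sumr_const card_ord /K3 mulr_natl.
rewrite -big_split/=; apply: ler_sum => i _.
have [h1 h2] := lw i; rewrite /l clamp_id//.
have ud : `|u i w| <= 2 * delta.
  rewrite (le_trans (ler_normB _ _))// mulr_natl mulr2n lerD//; exact: clamp_le.
have vd : `|v i w| <= 2 * delta.
  rewrite (le_trans (ler_normD _ _))// mulr_natl mulr2n lerD//; exact: clamp_le.
move: h1 ud vd; rewrite /u /v; move: (lg i _) (a i w) (sg i w) (alpha i) (mu i _) => x y z t p.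
rewrite !ler_norml => /andP[h1 h3] /andP[h4 h5] /andP[h6 h7].
have -> : x - (t + p) = (y - t) - (z + p) + (x - (y - z)) by ring.
move: (y - t) (z + p) (x - (y - z)) h1 h3 h4 h5 h6 h7 => A B e h1 h3 h4 h5 h6 h7.
nra.
Qed.

(** The deviation [s] and the centre [mu] are still free here: [mu] will be supplied by the
    conditional variance and [s] by the variance of s1. *)
Lemma local_entropy_le :
  law X `<< mt -> law Y `<< mt -> law s2 `<< mt ->
  finite_entropy mt (law X) -> finite_entropy mt (law Y) ->
  finite_entropy mt (law s2) ->
  entropy mt (law X) - entropy mt (law Y) + entropy mt (law s2) <=
  Mq + c0 + (\sum_(i < 3) (\int[P]_w (u i w ^+ 2))%R +
             \sum_(i < 3) (\int[P]_w (v i w ^+ 2))%R + K3) / (2 * s ^+ 2).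
Proof.
move=> X_mt Y_mt s2_mt feX feY fe2.
have mqw : measurable_fun setT (fun w => q (Y w, X w)).
  by apply: (measurableT_comp q_measurable); exact: measurable_fun_pair.
have mlnq : measurable_fun setT (fun w => ln (q (Y w, X w))) by exact: measurableT_comp.
have bL : bounded_measurable (fun w => - c0 - dist2 w / (2 * s ^+ 2)).
  apply: bounded_measurableB; first exact: bounded_measurable_cst.
  by apply: bounded_measurableM => //; exact: bounded_measurable_cst.
have qL : {ae P, forall w, ln (q (Y w, X w)) = - c0 - dist2 w / (2 * s ^+ 2)}.
  by apply: filterS q_log => w [].
have iq : P.-integrable setT (EFin \o (fun w => ln (q (Y w, X w)))).
  exact: ae_eq_integrable mlnq qL (bounded_measurable_integrable P bL).
have qp : {ae P, forall w, 0 < q (Y w, X w)} by apply: filterS q_log => w [].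
apply: le_trans (gibbs_entropy hmt ind X_mt Y_mt s2_mt q_measurable q_ge0 q_mass
  feX feY fe2 iq qp) _.
rewrite (ae_eq_Rintegral mlnq bL.1 qL).
pose N w := \sum_(i < 3) (u i w ^+ 2 + v i w ^+ 2 - 2 * (u i w * v i w)).
have bN i : bounded_measurable (fun w => u i w ^+ 2 + v i w ^+ 2 - 2 * (u i w * v i w)).
  apply: bounded_measurableB.
    by apply: bounded_measurableD; exact: bounded_measurable_sqr.
  apply: bounded_measurableM; first exact: bounded_measurable_cst.
  exact: bounded_measurableM.
have ib f : bounded_measurable f -> P.-integrable setT (EFin \o f).
  exact: bounded_measurable_integrable.
have pc (k : R) : (\int[P]_w k)%R = k.
  rewrite Rintegral_cst//; set p := fine (P _).
  have -> : p = 1 by rewrite /p probability_setT.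
  by rewrite mulr1.
have bc (k : R) : bounded_measurable (fun _ : T => k) by exact: bounded_measurable_cst.
have dle : (\int[P]_w dist2 w)%R <= \sum_(i < 3) (\int[P]_w (u i w ^+ 2))%R +
    \sum_(i < 3) (\int[P]_w (v i w ^+ 2))%R + K3.
  have bNK : bounded_measurable (fun w => N w + K3).
    by apply: bounded_measurableD => //; exact: bounded_measurable_sum.
  apply: le_trans (ae_le_Rintegral (ib _ bdist2) (ib _ bNK) dist2_le) _.
  rewrite RintegralD//; [|exact/ib/bounded_measurable_sum|exact/ib/bc].
  rewrite pc lerD2r Rintegral_sum// -big_split/= ler_sum// => i _.
  have bu2 := bounded_measurable_sqr (bu i); have bv2 := bounded_measurable_sqr (bv i).
  have buv := bounded_measurableM (bu i) (bv i).
  rewrite RintegralB//; [|exact/ib/bounded_measurableD|exact/ib/bounded_measurableM].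
  rewrite RintegralD//; [|exact/ib|exact/ib].
  by rewrite RintegralZl//; [rewrite cross_term mulr0 subr0|exact/ib].
rewrite RintegralB//; [|exact/ib/bc|exact/ib/bounded_measurableM].
rewrite pc RintegralZr//; last exact/ib.
have := ler_wpM2r (_ : 0 <= (2 * s ^+ 2)^-1) dle.
rewrite invr_ge0 mulr_ge0 ?sqr_ge0// => /(_ isT); lra.
Qed.

End center.
End local_estimate.

(** * Conditional variance *)

Section conditional_variance.
Context d d' d'' (T : measurableType d) (G : measurableType d')
  (H : measurableType d'') (R : realType).
Variables (P : probability T R) (X : {RV P >-> G}) (Y : {RV P >-> H}).
Variable kappa : {mfun g_sigma_algebra_preimageType Y >-> pprobability G R}.
Hypothesis rcd : is_rcd P X Y kappa.
Variable f : H * G -> R.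
Hypothesis mf : measurable_fun setT f.

Let mX : measurable_fun setT X. Proof. exact: measurable_funPT. Qed.
Let mY : measurable_fun setT Y. Proof. exact: measurable_funPT. Qed.

Lemma preimage_measurable_fun d1 (T1 : measurableType d1) (h : T -> T1) :
  measurable_fun [set: g_sigma_algebra_preimageType Y] h ->
  measurable_fun [set: T] h.
Proof.
move=> mh _ A mA; rewrite setTI.
have : measurable (h @^-1` A : set (g_sigma_algebra_preimageType Y)).
  by rewrite -[X in measurable X]setTI; exact: mh.
by move=> [B mB <-]; exact: mY.
Qed.

Let mY' : measurable_fun [set: g_sigma_algebra_preimageType Y] (Y : T -> H).
Proof. by move=> _ B mB; exists B. Qed.

Let mkappa : measurable_fun [set: T] (kappa : T -> pprobability G R).
Proof. by apply: preimage_measurable_fun; exact: measurable_funPT. Qed.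

Definition conditional_mean (w : T) := (\int[kappa w : probability G R]_x f (Y w, x))%R.

Definition conditional_variance (w : T) :=
  (\int[kappa w : probability G R]_x (f (Y w, x) - conditional_mean w) ^+ 2)%R.

Let mean_measurable :
  measurable_fun [set: g_sigma_algebra_preimageType Y] conditional_mean.
Proof.
apply: (@kernel_Rintegral_measurable _ _ (g_sigma_algebra_preimageType Y) _ _ kappa
  (measurable_funPT kappa) (fun z => f (Y z.1, z.2))).
apply: measurableT_comp => //; apply: measurable_fun_pair => //.
exact: (measurableT_comp mY').
Qed.

Lemma conditional_variance_measurable : measurable_fun [set: T] conditional_variance.
Proof.
apply: (kernel_Rintegral_measurable mkappa
  (f := fun z => (f (Y z.1, z.2) - conditional_mean z.1) ^+ 2)).
apply: measurable_funX; apply: measurable_funB.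
  apply: measurableT_comp => //; apply: measurable_fun_pair => //.
  exact: (measurableT_comp mY).
by apply: measurableT_comp => //; exact: preimage_measurable_fun.
Qed.

Let disint (F : G * H -> \bar R) : measurable_fun setT F -> (forall z, 0 <= F z)%E ->
  (\int[P]_w \int[kappa w : probability G R]_x F (x, Y w) =
   \int[P]_w F (X w, Y w))%E.
Proof.
move=> mF F0; apply: (disintegration mkappa mX mY _ mF F0) => A B mA mB.
by apply: rcd => //; exists B => //; rewrite setTI.
Qed.

(** The conditional mean is measurable for the sigma-algebra of Y, so it is a function mu of Y by
    Doob-Dynkin, and disintegration turns the expected conditional variance into the mean of (f (Y,
    X) - mu (Y))^2. Clamping mu to the range of zeta only brings it closer to zeta. *)
Lemma le_conditional_variance (zeta : T -> R) (c : R) :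
  measurable_fun setT zeta -> (forall w, `|zeta w| <= c) ->
  {ae P, forall w, f (Y w, X w) = zeta w} ->
  exists mu : H -> R, [/\ measurable_fun setT mu, forall y, `|mu y| <= c &
    ((\int[P]_w (zeta w - mu (Y w)) ^+ 2)%R%:E <=
     \int[P]_w (conditional_variance w)%:E)%E].
Proof.
move=> mz zc fz.
have c0 : 0 <= c by exact: le_trans (zc point).
have [mu mmu muE] := measurable_factorization mean_measurable.
exists (fun y => clamp c (mu y)); split.
- exact: clamp_measurable.
- by move=> y; exact: clamp_le.
have mfswap : measurable_fun setT (fun z : G * H => f (z.2, z.1)).
  by apply: measurableT_comp => //; exact: measurable_fun_pair.
have mfYX : measurable_fun setT (fun w => f (Y w, X w)).
  by apply: measurableT_comp => //; exact: measurable_fun_pair.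
have bz : bounded_measurable zeta by split => //; exists c.
have bmu : bounded_measurable (fun w => clamp c (mu (Y w))).
  by apply: clamp_bounded_measurable => //; exact: measurableT_comp.
have b2 := bounded_measurable_sqr (bounded_measurableB bz bmu).
have i2 := bounded_measurable_integrable P b2.
rewrite /Rintegral fineK; last exact: integrable_fin_num.
pose F (z : G * H) := ((f (z.2, z.1) - mu z.2) ^+ 2)%:E.
have mF : measurable_fun setT F.
  apply/measurable_EFinP; apply: measurable_funX; apply: measurable_funB => //.
  exact: measurableT_comp.
have F0 z : (0 <= F z)%E by rewrite lee_fin sqr_ge0.
(* A real integral is 0 by convention where it diverges, which could make [conditional_variance] too
   small. The conditional second moment D has expectation E zeta^2, so it is finite almost surely
   and the convention does no harm. *)
pose D (w : T) := (\int[kappa w : probability G R]_x (f (Y w, x) ^+ 2)%:E)%E.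
have mD : measurable_fun setT D.
  have mF2 : measurable_fun setT (fun z : T * G => (f (Y z.1, z.2) ^+ 2)%:E).
    apply/measurable_EFinP; apply: measurable_funX; apply: measurableT_comp => //.
    by apply: measurable_fun_pair => //; exact: (measurableT_comp mY).
  have F20 z : (0 <= (f (Y z.1, z.2) ^+ 2)%:E)%E by rewrite lee_fin sqr_ge0.
  exact: (kernel_integral_measurable mkappa mF2 F20).
have D0 w : (0 <= D w)%E by apply: integral_ge0 => x _; rewrite lee_fin sqr_ge0.
have Dfin : {ae P, forall w, D w \is a fin_num}.
  have iD : P.-integrable setT D.
    apply/integrableP; split => //.
    under eq_integral do rewrite gee0_abs//.
    rewrite (disint (F := fun z => (f (z.2, z.1) ^+ 2)%:E)); last 2 first.
    - by apply/measurable_EFinP; exact: measurable_funX.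
    - by move=> z; rewrite lee_fin sqr_ge0.
    have iz := bounded_measurable_integrable P (bounded_measurable_sqr bz).
    rewrite (ae_eq_integral (EFin \o (fun w => zeta w ^+ 2)))//.
    - exact: integrable_lty.
    - by apply/measurable_EFinP; exact: measurable_funX.
    - exact: measurable_int iz.
    by apply: filterS fz => w /= -> _.
  by apply: filterS (integrable_ae measurableT iD) => w; apply.
have inner w : D w \is a fin_num ->
    (\int[kappa w : probability G R]_x F (x, Y w))%E = (conditional_variance w)%:E.
  move=> Dw; rewrite /F /conditional_variance /Rintegral /=.
  have -> : mu (Y w) = conditional_mean w by rewrite -muE.
  have mfx : measurable_fun setT (fun x => f (Y w, x)).
    by apply: measurableT_comp => //; exact: measurable_fun_pair.
  rewrite fineK// ge0_fin_numE; last first.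
    by apply: integral_ge0 => x _; rewrite lee_fin sqr_ge0.
  move: (conditional_mean w) => e.
  (* By (f - e)^2 <= 2 f^2 + 2 e^2, a finite second moment about 0 gives one about every e. *)
  apply: (@le_lt_trans _ _ (\int[kappa w : probability G R]_x
      ((2 * f (Y w, x) ^+ 2)%:E + (2 * e ^+ 2)%:E))%E).
    apply: ge0_le_integral => //=.
    - by move=> x _; rewrite lee_fin sqr_ge0.
    - by apply/measurable_EFinP; apply: measurable_funX; exact: measurable_funB.
    - apply/measurable_EFinP; apply: measurable_funD => //.
      by apply: measurable_funM => //; exact: measurable_funX.
    by move=> x _; rewrite lee_fin; have := sqr_ge0 (f (Y w, x) + e); lra.
  rewrite ge0_integralD//=; first last.
  - by move=> x _; rewrite lee_fin mulr_ge0// sqr_ge0.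
  - by apply/measurable_EFinP; apply: measurable_funM => //; exact: measurable_funX.
  - by move=> x _; rewrite lee_fin mulr_ge0// sqr_ge0.
  under eq_integral do rewrite EFinM.
  rewrite ge0_integralZl_EFin//; last 2 first.
  - by move=> x _; rewrite lee_fin sqr_ge0.
  - by apply/measurable_EFinP; exact: measurable_funX.
  rewrite integral_cst//; apply: lte_add_pinfty.
    rewrite -/(D w) -(fineK Dw); exact: ltry.
  by rewrite ltey_eq fin_numM// fin_num_measure.
have -> : (\int[P]_w (conditional_variance w)%:E = \int[P]_w F (X w, Y w))%E.
  rewrite -(disint mF F0); apply/esym/ae_eq_integral => //.
  - have mFs : measurable_fun setT (fun z : T * G => F (z.2, Y z.1)).
      apply: measurableT_comp => //; apply: measurable_fun_pair => //.
      exact: (measurableT_comp mY).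
    exact: (kernel_integral_measurable mkappa mFs (fun z => F0 _)).
  - by apply/measurable_EFinP; exact: conditional_variance_measurable.
  by apply: filterS Dfin => w /inner.
apply: ae_ge0_le_integral => //.
- by move=> w _; rewrite lee_fin sqr_ge0.
- exact: measurable_int i2.
- apply: measurableT_comp => //; exact: measurable_fun_pair.
apply: filterS fz => w /= fE _; rewrite lee_fin fE; exact: clamp_dist_le.
Qed.

End conditional_variance.

(** * Variances in clamped coordinates *)

Section variance_bounds.
Variables (R : realType) (b : 3.-tuple 'M[R]_2) (V : set (R * R * R)).
Hypotheses (hb : basis_of (sl2 R) b) (hV : is_log_domain b V).
Local Notation G := (PSL2 R).
Local Notation Exp := (PSL2_exp b).
Let lg i (x : G) := R3_coord i (PSL2_log b V x).
Let mlg i : measurable_fun setT (lg i).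
Proof. exact: PSL2_log_measurable. Qed.
Variables (delta : R).
Hypotheses (delta0 : 0 <= delta) (cubeV : cube (0 : R * R * R) delta `<=` V).
Context d (T : measurableType d) (P : probability T R).

Lemma tr_PSL2_Var_clamp (s : {RV P >-> G}) :
  {ae P, forall w, exists2 v, s w = Exp v & `|v| <= delta} ->
  \tr (PSL2_Var b V P 1%g s) =
  \sum_(i < 3) (\int[P]_w (clamp delta (lg i (s w)) -
    (\int[P]_w' clamp delta (lg i (s w')))%R) ^+ 2)%R.
Proof.
move=> as_; rewrite tr_PSL2_Var; apply: eq_bigr => i _.
have ml : measurable_fun setT (fun w => lg i (s w)).
  by apply: (measurableT_comp (mlg i)); exact: measurable_funPT.
have mc := clamp_measurable delta ml.
have cl : {ae P, forall w, lg i (s w) = clamp delta (lg i (s w))}.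
  apply: filterS as_ => w [v -> vd].
  by have [e1 e2] := log_small hV (lexx delta) cubeV i vd; rewrite [RHS]e2 [LHS]e1.
have <- : (\int[P]_w lg i (s w))%R = (\int[P]_w clamp delta (lg i (s w)))%R.
  exact: ae_eq_Rintegral.
transitivity (\int[P]_w (lg i (s w) - (\int[P]_w' lg i (s w'))%R) ^+ 2)%R.
  apply: eq_Rintegral => w _; congr ((_ - _) ^+ 2); first by rewrite invg1 mul1g.
  by apply: eq_Rintegral => w' _; rewrite invg1 mul1g.
move: (\int[P]_w lg i (s w))%R => c.
apply: ae_eq_Rintegral.
- by apply: measurable_funX; exact: measurable_funB.
- by apply: measurable_funX; exact: measurable_funB.
by apply: filterS cl => w h; rewrite [in LHS]h.
Qed.

(** [le_conditional_variance] is applied to each coordinate of log (y^-1 g), which at y = Y is that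
    of - log s2. The sign makes zeta - mu the negative of the sum whose square appears in the
    entropy estimate. *)
Lemma expectation_tr_PSL2_Var_ge (g s2 : {RV P >-> G}) :
  let Y : {RV P >-> G} := mfun_mul g s2 in
  forall kappa : {mfun g_sigma_algebra_preimageType Y >-> pprobability G R},
  is_rcd P g Y kappa ->
  {ae P, forall w, exists2 v, s2 w = Exp v & `|v| <= delta} ->
  exists mu : 'I_3 -> G -> R,
    [/\ forall i, measurable_fun setT (mu i),
        forall i y, `|mu i y| <= delta &
        ((\sum_(i < 3) (\int[P]_w (clamp delta (lg i (s2 w)) + mu i (Y w)) ^+ 2)%R)%:E
         <= 'E_P[fun w => \tr (PSL2_Var b V (kappa w : probability G R) (Y w) id)])%E].
Proof.
move=> Y kappa rcd as2.
pose f i (z : G * G) := lg i (z.1^-1 * z.2)%g.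
have mf i : measurable_fun setT (f i).
  apply: (measurableT_comp (mlg i)); apply: PSL2_mul_measurable; last exact: measurable_snd.
  by apply: PSL2_inv_measurable; exact: measurable_fst.
have ml i : measurable_fun setT (fun w => lg i (s2 w)).
  by apply: (measurableT_comp (mlg i)); exact: measurable_funPT.
pose zeta i w := - clamp delta (lg i (s2 w)).
have mz i : measurable_fun setT (zeta i).
  by apply: measurableT_comp => //; exact: clamp_measurable.
have zd i w : `|zeta i w| <= delta by rewrite normrN clamp_le.
have fz i : {ae P, forall w, f i (Y w, g w) = zeta i w}.
  apply: filterS as2 => w [v sE vd]; rewrite /f /zeta.
  have -> : ((Y w, g w).1^-1 * (Y w, g w).2)%g = (Exp v)^-1%g.
    by rewrite /Y /= /mfun_mul invgM -mulgA mulVg mulg1 sE.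
  rewrite sE [LHS](log_inv_small hb hV (lexx delta) cubeV i vd).
  by rewrite (log_small hV (lexx delta) cubeV i vd).2.
have /choice[mu muP] := fun i => le_conditional_variance rcd (mf i) (mz i) (zd i) (fz i).
exists (fun i y => mu i y); split => [i|i y|]; [by case: (muP i)..|].
rewrite expectation.unlock.
under eq_integral do rewrite tr_PSL2_Var.
rewrite (eq_integral (fun w => \sum_(i < 3) (conditional_variance kappa (f i) w)%:E)%E).
  rewrite ge0_integral_sum//.
  - rewrite -sumEFin; apply: lee_sum => i _; have [_ _] := muP i; apply: le_trans.
    rewrite lee_fin le_eqVlt; apply/orP; left; apply/eqP; apply: eq_Rintegral => w _.
    by rewrite /zeta -[LHS]sqrrN opprD.
  - by move=> i; apply/measurable_EFinP; exact: conditional_variance_measurable.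
  - by move=> i w _; rewrite lee_fin; apply: Rintegral_ge0 => x _; exact: sqr_ge0.
by move=> w _; rewrite sumEFin.
Qed.

End variance_bounds.

(** * Constants and the final estimate *)

Lemma entropy_variance_arith (R : realType) (hX hY h1 h2 Q L t S K D : R) :
  0 < t ->
  hX - hY + h2 <= Q + 3 / 2 * L + (t + S + K) / (2 * (t / 3)) ->
  K <= 2 / 3 * (D - Q) * t ->
  2 / 3 * (hX - h1 - hY + h2 - (3 / 2 * (L + 1) - h1) - D) * t <= S.
Proof.
move=> t0 h KD.
(* The summand t contributes t / (2 (t / 3)) = 3/2, which matches the 1 in [L + 1]: the factor e
   under the logarithm in c pays for it. [D] stands for C eps, [Q] for the excess mass and [K] for
   the error in the squared distance. *)
have E : (t + S + K) / (2 * (t / 3)) * t = 3 / 2 * (t + S + K).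
  by field; rewrite gt_eqF.
have := ler_wpM2r (ltW t0) h; rewrite [X in _ <= X -> _]mulrDl E; lra.
Qed.

(** Here A enters. As e < 1, the left side is at most B e^3, and A e^2 <= t turns this into (B / A)
    e t. The 3/2 in the constant cancels 2/3, and its summand 4 Kh kap cancels the excess mass. *)
Lemma error_term_arith (R : realType) (A e t K2 kap Kh : R) :
  0 < A -> 0 < e -> e < 1 -> 0 < kap -> 0 < K2 -> A * e ^+ 2 <= t ->
  3 * (8 * (kap * e) * (2 * K2 * (kap * e) ^+ 2) + (2 * K2 * (kap * e) ^+ 2) ^+ 2) <=
  2 / 3 * ((4 * Kh * kap + 3 / 2 *
    (3 * (16 * K2 * kap ^+ 3 + 4 * K2 ^+ 2 * kap ^+ 4) / A)) * e
    - Kh * (4 * (kap * e))) * t.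
Proof.
move=> A0 e0 e1 kap0 K20 At.
pose B := 3 * (16 * K2 * kap ^+ 3 + 4 * K2 ^+ 2 * kap ^+ 4).
have k3 : 0 <= K2 * kap ^+ 3 by rewrite mulr_ge0 ?exprn_ge0 ?ltW.
have k4 : 0 <= K2 ^+ 2 * kap ^+ 4 by rewrite mulr_ge0 ?exprn_ge0 ?ltW.
have B0 : 0 <= B by rewrite /B; lra.
rewrite -/B; apply: (@le_trans _ _ (B * e ^+ 3)).
  have e3 : 0 <= e ^+ 3 * (1 - e) by rewrite mulr_ge0 ?exprn_ge0 ?ltW// subr_gt0.
  have := mulr_ge0 k4 e3; rewrite /B; lra.
have -> : 2 / 3 * ((4 * Kh * kap + 3 / 2 * (B / A)) * e - Kh * (4 * (kap * e))) * t =
    B / A * e * t by field; rewrite gt_eqF.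
have -> : B * e ^+ 3 = B / A * e * (A * e ^+ 2) by field; rewrite gt_eqF.
have BA : 0 <= B / A by rewrite divr_ge0 // ltW.
by rewrite ler_wpM2l// mulr_ge0 ?(ltW e0).
Qed.

Lemma PSL2_log_mul_le (R : realType) (b : 3.-tuple 'M[R]_2) :
  basis_of (sl2 R) b -> exists2 r0 : R, 0 < r0 & exists2 K : R, 0 < K &
  forall (r : R) (u v : R * R * R), 0 <= r -> r <= r0 -> `|u| <= r -> `|v| <= r ->
  exists w, [/\ PSL2_exp b w = ((PSL2_exp b u)^-1 * PSL2_exp b v)%g,
    `|w - (v - u)| <= 2 * K * r ^+ 2 & `|w| <= 4 * r].
Proof.
move=> hb; have [r0 r00 [K K1 logM]] := PSL2_log_mul hb.
have K0 : 0 < K by exact: lt_le_trans K1.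
(* K r <= 1 makes the error at most 2 r, whence |w| <= 4 r. *)
exists (Num.min r0 K^-1); first by rewrite lt_min r00 invr_gt0.
exists K => // r u v rge0; rewrite le_min => /andP[rr0 rK] ur vr.
have {}rK : K * r <= 1 by rewrite mulrC -ler_pdivlMr// mul1r.
have [w wE wd] := logM r u v rr0 ur vr.
have vu : `|v - u| <= 2 * r.
  by rewrite (le_trans (ler_normB _ _))// mulr_natl mulr2n lerD.
have Kr0 : 0 <= K * r by rewrite mulr_ge0// ltW.
have {}wd : `|w - (v - u)| <= K * r * (2 * r) by apply: (le_trans wd); rewrite ler_wpM2l.
exists w; split => //.
  by have -> : 2 * K * r ^+ 2 = K * r * (2 * r) by ring.
rewrite -(subrK (v - u) w) (le_trans (ler_normD _ _))//.
have -> : 4 * r = 1 * (2 * r) + 2 * r by ring.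
by rewrite lerD// (le_trans wd)// ler_wpM2r// mulr_ge0.
Qed.

Lemma PSL2_ball_exp (R : realType) (ip : 'M[R]_2 -> 'M[R]_2 -> R)
    (b : 3.-tuple 'M[R]_2) : is_inner_product ip -> basis_of (sl2 R) b ->
  exists2 r0 : R, 0 < r0 <= 1 & exists2 K : R, 0 < K &
  forall e x, 0 < e -> e <= r0 -> PSL2_ball ip 1%g e x ->
  exists2 v, x = PSL2_exp b v & `|v| <= K * e.
Proof.
move=> hip hb; have [Kb Kb1 lift] := PSL2_ball_lift hip.
have [r1 r10 [K1 K11 logE]] := PSL2_log_exists hb.
have Kb0 : 0 < Kb by exact: lt_le_trans Kb1.
have K10 : 0 < K1 by exact: lt_le_trans K11.
exists (Num.min 1 (r1 / Kb)); first by rewrite lt_min ltr01 divr_gt0//= ge_min lexx.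
exists (K1 * Kb); first exact: mulr_gt0.
move=> e x e0; rewrite le_min => /andP[e1 er1] /(lift _ _ e0 e1)[B <- hB].
have [|v <- hv] := logE B.
  by rewrite (le_trans hB)// mulrC -ler_pdivlMr.
by exists v => //; rewrite (le_trans hv)// -mulrA ler_pM2l.
Qed.

Theorem theorem1p26 (R : realType)
    (ip : 'M[R]_2 -> 'M[R]_2 -> R) (hip : is_inner_product ip)
    (b : 3.-tuple 'M[R]_2) (hb : basis_of (sl2 R) b)
    (V : set (R * R * R)) (hV : is_log_domain b V)
    (mt : {sigma_finite_measure set (PSL2 R) -> \bar R})
    (hmt : is_haar mt) (hmt1 : normalized_at_id b V mt) :
  exists eps0 : R, 0 < eps0 /\ forall A : R, 0 < A -> exists C : R, 0 < C /\
  forall (d : measure_display) (T : measurableType d) (P : probability T R)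
    (g s1 s2 : {RV P >-> PSL2 R})
    (eps : R),
  let law (X : {RV P >-> PSL2 R}) : probability (PSL2 R) R :=
    distribution P X in
  let H (X : {RV P >-> PSL2 R}) := entropy mt (law X) in
  let TrVar1 := \tr (PSL2_Var b V P 1%g s1) in
  let gs1 : {RV P >-> PSL2 R} := mfun_mul g s1 in
  let gs2 : {RV P >-> PSL2 R} := mfun_mul g s2 in
  let k := H gs1 - H s1 - H gs2 + H s2 in
  let c := 3 / 2 * ln (2 / 3 * pi * expR 1 * TrVar1) - H s1 in
  independent3 P g s1 s2 ->
  law s1 `<< mt -> law s2 `<< mt ->
  finite_entropy mt (law s1) -> finite_entropy mt (law s2) ->
  finite_entropy mt (law gs1) -> finite_entropy mt (law gs2) ->
  0 < k ->
  0 < eps < eps0 ->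
  {ae P, forall w, PSL2_ball ip 1%g eps (s1 w)} ->
  {ae P, forall w, PSL2_ball ip 1%g eps (s2 w)} ->
  A * eps ^+ 2 <= TrVar1 ->
  forall kappa : {mfun g_sigma_algebra_preimageType gs2 >->
                       pprobability (PSL2 R) R},
  is_rcd P g gs2 kappa ->
  ((2 / 3 * (k - c - C * eps) * TrVar1)%:E <=
    'E_P[fun w => \tr (PSL2_Var b V (kappa w : probability (PSL2 R) R)
                                    (gs2 w) id)])%E.
Proof.
have [r1 /andP[r10 r11] [kap kap0 ballE]] := PSL2_ball_exp hip hb.
have [r2 r20 [K2 K20 logM]] := PSL2_log_mul_le hb.
have [r0 r00 [Kh Kh1 [cubeV mass]]] := haar_exp_integral_le hb hV hmt hmt1.
have Kh0 : 0 < Kh by exact: lt_le_trans Kh1.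
(* With delta = kap eps, the three bounds put the balls in the exponential chart, delta in the range
   of the product estimate, and 4 delta, which bounds log (Y^-1 X), in that of the Haar
   comparison. *)
exists (Num.min r1 (Num.min (r2 / kap) (r0 / (4 * kap)))); split.
  by rewrite !lt_min r10 !divr_gt0// mulr_gt0.
(* The first summand pays for the mass of the cut-off Gaussian, the second for the error in the
   squared distance divided by T >= A eps^2. *)
move=> A A0; exists (4 * Kh * kap +
  3 / 2 * (3 * (16 * K2 * kap ^+ 3 + 4 * K2 ^+ 2 * kap ^+ 4) / A)).
split.
  rewrite ltr_wpDr//; last by rewrite !mulr_gt0.
  do 2?[apply: mulr_ge0 => //]; last by rewrite invr_ge0 ltW.
  by rewrite mulr_ge0// addr_ge0// !mulr_ge0 ?exprn_ge0 ?(ltW K20) ?(ltW kap0).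
move=> d T P g s1 s2 e law H TrVar1 gs1 gs2 k c ind ac1 ac2 fe1 fe2 fegs1 fegs2 _.
rewrite !lt_min => /and4P[e0 er1 er2 er0] b1 b2 AT kappa rcd.
have e1 : e < 1 by exact: lt_le_trans r11.
pose delta := kap * e.
have delta0 : 0 <= delta by rewrite mulr_ge0// ltW.
have delta40 : 0 <= 4 * delta by rewrite mulr_ge0.
have delta_4 : delta <= 4 * delta by rewrite ler_peMl// ler1n.
have delta_r0 : 4 * delta <= r0.
  by rewrite mulrA mulrC -ler_pdivlMr ?mulr_gt0// ltW.
have delta_r2 : delta <= r2 by rewrite /delta mulrC -ler_pdivlMr// ltW.
have as_ (s : {RV P >-> PSL2 R}) : {ae P, forall w, PSL2_ball ip 1%g e (s w)} ->
    {ae P, forall w, exists2 v, s w = PSL2_exp b v & `|v| <= delta}.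
  by apply: filterS => w; exact: ballE e0 (ltW er1).
have as1 := as_ _ b1; have as2 := as_ _ b2.
have cV4 : cube (0 : R * R * R) (4 * delta) `<=` V.
  by apply: subset_trans cubeV => v /le_trans; exact.
have cV : cube (0 : R * R * R) delta `<=` V.
  by apply: subset_trans cV4 => v /le_trans; exact.
have [mu [mmu mu_le S_le]] := expectation_tr_PSL2_Var_ge hb hV delta0 cV rcd as2.
apply: le_trans S_le; rewrite lee_fin.
have TE : TrVar1 = _ := tr_PSL2_Var_clamp hb hV cV as1.
have T0 : 0 < TrVar1 by apply: lt_le_trans AT; rewrite mulr_gt0// exprn_gt0.
(* The variance s^2 = T / 3 minimizes 3/2 ln (2 pi s^2) + T / (2 s^2). *)
have s0 : 0 < Num.sqrt (TrVar1 / 3) by rewrite sqrtr_gt0 divr_gt0.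
have log_mul u v := logM delta u v delta0 delta_r2.
have mass4 psi := mass (4 * delta) psi delta40 delta_r0.
have := local_entropy_le hb hV hmt delta0 delta_4 cV4 log_mul mass4 ind as1 as2
  mmu mu_le s0 fegs1.1 fegs2.1 ac2 fegs1 fegs2 fe2.
rewrite sqr_sqrtr; last by rewrite divr_ge0// ltW.
rewrite -TE -/(H _) -/(H _) -/(H _) => main.
have lnE : ln (2 / 3 * pi * expR 1 * TrVar1) = ln (2 * pi * (TrVar1 / 3)) + 1.
  rewrite -[X in _ + X](expRK 1) -lnM ?posrE ?expR_gt0//; last first.
    by rewrite !mulr_gt0 ?pi_gt0// invr_gt0.
  by congr ln; field.
rewrite /k /c lnE; apply: entropy_variance_arith T0 main _.
exact: error_term_arith.
Qed.
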